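(* Let $u\in BV(0,T)^M$ be feasible for (P) and let $(n,a,t)$ be the minimal representation of $u$. Let $J$ be the set of all $j\in\{1,\dots,n-1\}$ for which $\Lambda_j:=\{\lambda\in(0,1):\lambda a_j+(1-\lambda)a_{j+1}\in\mathcal V\}$ is nonempty. Assume that $F:L^1(0,T)^M\to\mathbb R$ is twice Fréchet differentiable with $\nabla F(u)\in C^1([0,T])^M$ and $\nabla^2F(u)\in C([0,T]^2;\mathbb R^{M\times M})$, and define $\mu_j:=a_j-a_{j+1}$ for $j=1,\dots,n-1$. (1) Let $p\in[1,\infty]$. If $u$ is a local minimizer of (P) in $L^1(0,T)^M$, then $$\mu_j^\top\nabla F(u)(t_j)=0\quad\forall j=1,\dots,n-1,$$ $$\mu_j^\top(\nabla F(u))'(t_j)\ge0\quad\forall j\in J,$$ $$\sum_{j=1}^{n-1}\mu_j^\top(\nabla F(u))'(t_j)\,\tau_j^2+\sum_{j,k=1}^{n-1}\mu_j^\top\nabla^2F(u)(t_j,t_k)\mu_k\,\tau_j\tau_k\ge0\quad\forall\tau\in\mathbb R^{n-1}.$$ (2) Let $p\in(1,\infty)$. Then $u$ is a local minimizer of (P) satisfying a quadratic growth condition in $L^1(0,T)^M$ if and only if $$\mu_j^\top\nabla F(u)(t_j)=0\quad\forall j=1,\dots,n-1,$$ $$\mu_j^\top(\nabla F(u))'(t_j)>0\quad\forall j\in J,$$ $$\sum_{j=1}^{n-1}\mu_j^\top(\nabla F(u))'(t_j)\,\tau_j^2+\sum_{j,k=1}^{n-1}\mu_j^\top\nabla^2F(u)(t_j,t_k)\mu_k\,\tau_j\tau_k>0\quad\forall\tau\in\mathbb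 R^{n-1}\setminus\{0\}.$$
   Context: Let $T>0$, $M\in\mathbb N$, $\beta>0$, and let $\mathcal V=\{\nu_1,\dots,\nu_d\}\subset\mathbb Z^M$ be a finite set with $d\ge2$ elements. The functional $F:L^1(0,T)^M\to\mathbb R$ is bounded from below and lower semicontinuous. When $F$ is twice Fréchet differentiable, $F'(u)$ is identified with $\nabla F(u)\in L^\infty(0,T)^M$ via $F'(u)v=\int_0^T\nabla F(u)(s)^\top v(s)\,ds$, and $F''(u)$ with $\nabla^2F(u)\in L^\infty((0,T)^2;\mathbb R^{M\times M})$ via $$F''(u)[v,w]=\int_0^T\int_0^T v(r)^\top\nabla^2F(u)(r,s)w(s)\,dr\,ds\quad\forall v,w\in L^1(0,T)^M.$$ For $p\in[1,\infty]$ with Hölder conjugate $p'$ and $u\in L^1(0,T)^M$ let $$\mathrm{TV}_p(u)=\sup\Big\{\int_0^T u^\top\varphi'\,dt : \varphi\in C_c^1(0,T)^M,\ \|\varphi(t)\|_{p'}\le1\ \forall t\in(0,T)\Big\}.$$ Set $U_{\mathrm{ad}}=\{u\in BV(0,T)^M: u(t)\in\mathcal V\text{ for a.a. }t\in(0,T)\}$. Problem (P) is: minimize $F(u)+\beta\,\mathrm{TV}_p(u)$ over $u\in U_{\mathrm{ad}}$. Here $\|u\|_{L^1}=\int_0^T\|u(t)\|_1\,dt$. ''$u$ is a local minimizer of (P) in $L^1(0,T)^M$'' means that there is $\varepsilon>0$ with $F(w)+\beta\mathrm{TV}_p(w)\ge F(u)+\beta\mathrm{TV}_p(u)$ for all $w\in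 U_{\mathrm{ad}}$ with $\|w-u\|_{L^1}\le\varepsilon$. A quadratic growth condition in $L^1(0,T)^M$ means that there are $\varepsilon,\eta>0$ with $F(w)+\beta\mathrm{TV}_p(w)\ge F(u)+\beta\mathrm{TV}_p(u)+\frac\eta2\|w-u\|_{L^1}^2$ for all such $w$. Minimal representation: every $u\in U_{\mathrm{ad}}$ can uniquely be written (a.e.) as $u=v^{t,a}:=a_1\chi_{(t_0,t_1)}+\sum_{j=2}^n a_j\chi_{[t_{j-1},t_j)}$ with $n\in\mathbb N$, $0=t_0<t_1<\dots<t_{n-1}<t_n=T$, $a=(a_1,\dots,a_n)\in\mathcal V^n$ and $a_i\ne a_{i+1}$ for $i=1,\dots,n-1$; the data $(n,a,t)$ is the minimal representation of $u$. *)

(* Defs.v *)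
From HB Require Import structures.
From mathcomp Require Import all_boot all_order all_algebra.
From mathcomp Require Import finmap.
From mathcomp Require Import all_classical all_reals all_analysis.

Set Implicit Arguments.
Unset Strict Implicit.
Unset Printing Implicit Defensive.

Import Order.TTheory GRing.Theory Num.Theory.
Import numFieldNormedType.Exports.

Local Open Scope classical_set_scope.
Local Open Scope ring_scope.

(** Elements of [L^1(0,T)^M] are represented by functions [R -> 'cV[R]_M] whose
    components are integrable on [(0,T)]; the values outside [(0,T)] are
    irrelevant, and equality in [L^1(0,T)^M] is [eqL1]. Only the restriction of
    a functional [F : (R -> 'cV[R]_M) -> R] to [inL1] is ever constrained. *)

Section Spaces.
Context {R : realType} {M : nat}.
Notation mu := (@lebesgue_measure R).
Implicit Types (T : R) (u v w : R -> 'cV[R]_M).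

Definition inL1 T u : Prop :=
  forall i, mu.-integrable `]0, T[ (fun s => (u s i 0)%:E).

Definition eqL1 T u v : Prop := {ae mu, forall s, s \in `]0, T[ -> u s = v s}.

Definition normL1 T u : R := \int[mu]_(s in `]0, T[) \sum_i `|u s i 0|.

Definition dotp (x y : 'cV[R]_M) : R := (x^T *m y) 0 0.

(** The [q]-norm on [R^M], meaningful for [1 <= q]; for [q = +oo] it is the
    library norm of matrices, which is the maximum norm. *)
Definition qnorm (q : \bar R) (x : 'cV[R]_M) : R :=
  match q with
  | r%:E => (\sum_i `|x i 0| `^ r) `^ r^-1
  | +oo%E => `|x|
  | -oo%E => 0
  end.

(** [C_c^1(0,T)^M], each function being extended by zero to [R]. *)
Definition C1c T (phi : R -> 'cV[R]_M) : Prop :=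
  [/\ forall s, derivable phi s 1,
      continuous (derive1 phi),
      compact (closure [set s | phi s != 0]) &
      closure [set s | phi s != 0] `<=` `]0, T[ ].

(** [C^1([0,T])^M]: the derivative on [(0,T)] has a continuous extension to
    [[0,T]]. *)
Definition C1 T (g : R -> 'cV[R]_M) : Prop :=
  [/\ {within `[0, T], continuous g},
      forall s, s \in `]0, T[ -> derivable g s 1 &
      exists2 g' : R -> 'cV[R]_M, {within `[0, T], continuous g'} &
        forall s, s \in `]0, T[ -> g' s = derive1 g s].

Definition TV T (p : \bar R) u : \bar R :=
  ereal_sup [set (\int[mu]_(s in `]0, T[) dotp (u s) (derive1 phi s))%:E
    | phi in [set phi | C1c T phi /\
        forall s, s \in `]0, T[ -> qnorm (hoelder_conjugate p) (phi s) <= 1]].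

End Spaces.

Definition component {R : realType} {M : nat} (u : R -> 'cV[R]_M) (i : 'I_M) :
    R -> 'cV[R]_1 := fun s => const_mx (u s i 0).

(** [BV(0,T)^M], componentwise; for scalar functions [TV T p] does not depend
    on [p]. *)
Definition inBV {R : realType} {M : nat} (T : R) (u : R -> 'cV[R]_M) : Prop :=
  inL1 T u /\ forall i, (TV T 1 (component u i) < +oo)%E.

Section Frechet.
Context {R : realType} {M : nat}.
Notation fct := (R -> 'cV[R]_M).
Implicit Types (T : R) (u v w h : fct).

Definition bounded_below T (F : fct -> R) : Prop :=
  exists c : R, forall u, inL1 T u -> c <= F u.

Definition lsc T (F : fct -> R) : Prop :=
  forall u, inL1 T u -> forall e, 0 < e ->
  exists2 delta, 0 < delta &
    forall w, inL1 T w -> normL1 T (w - u) < delta -> F u - e < F w.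

Definition linearL1 T (L : fct -> R) : Prop :=
  forall (k : R) v w, inL1 T v -> inL1 T w -> L (k *: v + w) = k * L v + L w.

(** [L] has dual norm at most [C]. *)
Definition dual_norm_le T (L : fct -> R) (C : R) : Prop :=
  forall v, inL1 T v -> `|L v| <= C * normL1 T v.

Definition dualL1 T (L : fct -> R) : Prop :=
  linearL1 T L /\ exists C, dual_norm_le T L C.

Definition frechet_derivative T (F : fct -> R) u (L : fct -> R) : Prop :=
  dualL1 T L /\
  forall e, 0 < e -> exists2 delta, 0 < delta &
    forall h, inL1 T h -> normL1 T h <= delta ->
      `|F (u + h) - F u - L h| <= e * normL1 T h.

(** Fréchet derivative at [u] of a map [G] from [L^1(0,T)^M] to its dual; the
    derivative [B] is a bounded linear map of the same type. *)
Definition frechet_derivative_dual T (G : fct -> fct -> R) u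
    (B : fct -> fct -> R) : Prop :=
  [/\ forall v, inL1 T v -> dualL1 T (B v),
      forall w, inL1 T w -> linearL1 T (B^~ w),
      exists C, forall v, inL1 T v -> dual_norm_le T (B v) (C * normL1 T v) &
      forall e, 0 < e -> exists2 delta, 0 < delta &
        forall h, inL1 T h -> normL1 T h <= delta ->
          dual_norm_le T (fun w => G (u + h) w - G u w - B h w)
            (e * normL1 T h)].

(** [F' u v] is [F'(u)v] and [F'' u v w] is [F''(u)[v,w]]. *)
Definition twice_frechet T (F : fct -> R) (F' : fct -> fct -> R)
    (F'' : fct -> fct -> fct -> R) : Prop :=
  forall u, inL1 T u ->
    frechet_derivative T F u (F' u) /\ frechet_derivative_dual T F' u (F'' u).

Notation mu := (@lebesgue_measure R).

Definition is_gradient T (L : fct -> R) (g : R -> 'cV[R]_M) : Prop :=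
  forall v, inL1 T v -> L v = \int[mu]_(s in `]0, T[) dotp (g s) (v s).

Definition is_hessian T (B : fct -> fct -> R) (H : R -> R -> 'M[R]_M) : Prop :=
  forall v w, inL1 T v -> inL1 T w ->
    B v w = \int[mu]_(s in `]0, T[) \int[mu]_(r in `]0, T[)
              dotp (v r) (H r s *m w s).

End Frechet.

Section Problem.
Context {R : realType} {M : nat}.
Notation mu := (@lebesgue_measure R).
Notation fct := (R -> 'cV[R]_M).
Implicit Types (T : R) (V : {fset 'cV[int]_M}) (u w : fct).

Definition toR (z : 'cV[int]_M) : 'cV[R]_M := map_mx (fun k : int => k%:~R) z.

Definition setV V : set 'cV[R]_M := [set toR z | z in [set` V]].

Definition Uad T V u : Prop :=
  inBV T u /\ {ae mu, forall s, s \in `]0, T[ -> setV V (u s)}.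

Definition objective T (F : fct -> R) (beta : R) (p : \bar R) u : \bar R :=
  ((F u)%:E + beta%:E * TV T p u)%E.

Definition local_minimizer T V F beta p u : Prop :=
  exists2 e, 0 < e &
    forall w, Uad T V w -> normL1 T (w - u) <= e ->
      (objective T F beta p u <= objective T F beta p w)%E.

Definition quadratic_growth T V F beta p u : Prop :=
  exists e eta : R, [/\ 0 < e, 0 < eta &
    forall w, Uad T V w -> normL1 T (w - u) <= e ->
      (objective T F beta p u + (eta / 2 * normL1 T (w - u) ^+ 2)%:E
         <= objective T F beta p w)%E].

(** The data [a_1, ..., a_n] and [t_0, ..., t_n] are given by functions on
    [nat]; the values at other indices are irrelevant. *)
Definition step_fun (n : nat) (a : nat -> 'cV[int]_M) (t : nat -> R) : fct :=
  fun s => \1_(`]t 0%N, t 1%N[) s *: toR (a 1%N) +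
    \sum_(2 <= j < n.+1) \1_(`[t j.-1, t j[) s *: toR (a j).

Definition minimal_representation T V u (n : nat) (a : nat -> 'cV[int]_M)
    (t : nat -> R) : Prop :=
  [/\ (0 < n)%N,
      [/\ t 0%N = 0, t n = T & forall j, (j < n)%N -> t j < t j.+1],
      forall j, (1 <= j <= n)%N -> a j \in V,
      forall j, (1 <= j < n)%N -> a j != a j.+1 &
      eqL1 T u (step_fun n a t)].

Definition jump (a : nat -> 'cV[int]_M) (j : nat) : 'cV[R]_M :=
  toR (a j) - toR (a j.+1).

Definition inJ V (n : nat) (a : nat -> 'cV[int]_M) (j : nat) : Prop :=
  (1 <= j < n)%N /\
  exists lambda : R, 0 < lambda < 1 /\
    setV V (lambda *: toR (a j) + (1 - lambda) *: toR (a j.+1)).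

(** The entry [tau 0 j] of [tau], with [j < n - 1], belongs to the jump
    [j + 1]. *)
Definition quad_form (n : nat) (a : nat -> 'cV[int]_M) (t : nat -> R)
    (g : R -> 'cV[R]_M) (H : R -> R -> 'M[R]_M) (tau : 'rV[R]_n.-1) : R :=
  \sum_(j < n.-1) dotp (jump a j.+1) (derive1 g (t j.+1)) * tau 0 j ^+ 2 +
  \sum_(j < n.-1) \sum_(k < n.-1)
    dotp (jump a j.+1) (H (t j.+1) (t k.+1) *m jump a k.+1)
      * tau 0 j * tau 0 k.

End Problem.

(* Main.v *)
(** The function [u] is a staircase with jumps [mu_j] at the points [t_j].
    Testing the total variation against bumps between Lebesgue points shows that
    [TV u] is minimal among admissible functions near [u], and, because [V] is
    finite and the [p]-norm is strictly convex for [1 < p < +oo], that every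
    admissible [w] near [u] whose variation exceeds [TV u] by less than a fixed
    gap has the form [u + \sum_j th_j mu_j], where [th_j] is supported near
    [t_j], has values in [[-1,0]] to the left and in [[0,1]] to the right of
    [t_j], and is the difference of two step functions if [j] is not in [J].
    A second-order expansion gives
      [F w - F u = \sum_j mu_j.g(t_j) \int th_j
         + \sum_j mu_j.g'(t_j) \int th_j (s - t_j)
         + 1/2 \sum_(j,k) mu_j.H(t_j,t_k) mu_k \int th_j \int th_k]
    up to higher-order terms. Translating the jumps, or splitting a jump with
    [j] in [J] in two, yields the necessary conditions. Conversely, the bathtub
    principle bounds [\int th_j (s - t_j)] below by
    [((\int th_j)^2 + (\int |th_j|)^2) / 4], while it equals [(\int th_j)^2 / 2]
    for [j] not in [J]; hence [F] grows quadratically. If the variation exceeds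
    the gap, lower semicontinuity of [F] suffices. *)

Require Import Defs.
From HB Require Import structures.
From mathcomp Require Import all_boot all_order all_algebra.
From mathcomp Require Import finmap.
From mathcomp Require Import ring lra.
From mathcomp Require Import all_classical all_reals all_analysis.
From mathcomp Require Import measurable_realfun.

Set Implicit Arguments.
Unset Strict Implicit.
Unset Printing Implicit Defensive.

Import Order.TTheory GRing.Theory Num.Theory.
Import numFieldNormedType.Exports.

Local Open Scope classical_set_scope.
Local Open Scope ring_scope.

(** * Integrals over (0,T) *)

(** An admissible [w] is known only almost everywhere, while its variation is a supremum over smooth
    test functions. Hence it is read off at Lebesgue points where [w] has its values in [V]; since
    [V] consists of integer vectors, every interval longer than the L1 distance to the staircase
    contains such a point at which the two functions agree. The exponent enters through equality in
    the triangle inequality: a value visited between [a_j] and [a_(j+1)] at no extra cost lies on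
    their segment if the norm is strictly convex, but may leave it for [p = 1] or [p = +oo]. The set
    [J] marks the jumps for which such a value can be interior to the segment. Only then can [th_j]
    have mean zero without vanishing, a direction that the quadratic form does not see and that the
    sign of [mu_j.g'(t_j)] must control. The first moment of [th_j] is not bounded by the square of
    its mass, so the error made in linearizing the gradient cannot be absorbed by squared masses
    alone; the lower bound therefore keeps the moments beside them. *)

Section Integrals.
Context {R : realType} (T : R).
Notation mu := (@lebesgue_measure R).
Local Notation D := (`]0, T[%classic : set (measurableTypeR R)).
Implicit Types f k : R -> R.

Definition intg f := mu.-integrable D (EFin \o f).
Definition Int f : R := \int[mu]_(x in D) f x.
Definition aeT (P : R -> Prop) := {ae mu, forall s, s \in `]0, T[ -> P s}.

Lemma measD : measurable D. Proof. exact: measurable_itv. Qed.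

Lemma muD_lty : (mu D < +oo)%E.
Proof. by rewrite /= lebesgue_measure_itv/=; case: ifP => _; rewrite -?EFinD ltry. Qed.

Lemma aeTW P : (forall s, s \in `]0, T[ -> P s) -> aeT P.
Proof. by move=> h; apply: aeW => s; apply: h. Qed.

Lemma aeT_imp P Q : (forall s, s \in `]0, T[ -> P s -> Q s) -> aeT P -> aeT Q.
Proof. by move=> PQ; apply: (@filterS _ _ (ae_filter_ringOfSetsType mu)) => s Ps sT; apply: PQ => //; apply: Ps. Qed.

Lemma aeT_and P Q : aeT P -> aeT Q -> aeT (fun s => P s /\ Q s).
Proof. by move=> hP hQ; apply: (@filterS2 _ _ (ae_filter_ringOfSetsType mu) _ _ _ _ hP hQ) => s p q sT; split; [apply: p|apply: q]. Qed.

Lemma intg_meas f : intg f -> measurable_fun D f.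
Proof. by move=> /measurable_int /measurable_EFinP. Qed.

Lemma intg_bound f k : measurable_fun D f -> intg k ->
  (forall s, s \in `]0, T[ -> `|f s| <= k s) -> intg f.
Proof.
move=> mf ik fk; apply: (le_integrable measD _ _ ik) => [|s Ds /=]; first exact/measurable_EFinP.
by rewrite lee_fin (le_trans (fk s _))// ler_norm.
Qed.

Lemma intg_cst c : intg (fun=> c).
Proof.
by apply: measurable_bounded_integrable; [exact: measD|exact: muD_lty| |exact: bounded_cst].
Qed.

Lemma intg_bounded f C : measurable_fun D f ->
  (forall s, s \in `]0, T[ -> `|f s| <= C) -> intg f.
Proof. by move=> mf fC; exact: (intg_bound mf (intg_cst C)). Qed.

Lemma intgD f k : intg f -> intg k -> intg (fun s => f s + k s).
Proof. by move=> If Ik; apply: (integrableD measD If Ik). Qed.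

Lemma intgN f : intg f -> intg (fun s => - f s).
Proof. by move=> If; apply: (integrableN If). Qed.

Lemma intgB f k : intg f -> intg k -> intg (fun s => f s - k s).
Proof. by move=> If Ik; apply: intgD => //; apply: intgN. Qed.

Lemma intgZ c f : intg f -> intg (fun s => c * f s).
Proof. by move=> If; apply: (integrableZl measD c If). Qed.

Lemma intg_norm f : intg f -> intg (fun s => `|f s|).
Proof. exact: integrable_norm. Qed.

Lemma intgM f k C : intg f -> measurable_fun D k ->
  (forall s, s \in `]0, T[ -> `|k s| <= C) -> intg (fun s => f s * k s).
Proof.
move=> If mk kC; apply: (@intg_bound _ (fun s => C * `|f s|)).
- by apply: measurable_funM => //; exact: intg_meas.
- exact/intgZ/intg_norm.
- by move=> s sT; rewrite normrM mulrC ler_wpM2r// kC.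
Qed.

Lemma intg_sum (I : Type) (r : seq I) (P : pred I) (f : I -> R -> R) :
  (forall i, P i -> intg (f i)) -> intg (fun s => \sum_(i <- r | P i) f i s).
Proof.
move=> If; elim: r => [|i r IH].
  by rewrite (_ : (fun _ => _) = fun=> 0); [exact: intg_cst|apply/funext => s; rewrite big_nil].
case Pi : (P i).
  rewrite (_ : (fun _ => _) = fun s => f i s + \sum_(i <- r | P i) f i s).
    by apply: intgD => //; exact: If.
  by apply/funext => s; rewrite big_cons Pi.
rewrite (_ : (fun _ => _) = fun s => \sum_(i <- r | P i) f i s)//.
by apply/funext => s; rewrite big_cons Pi.
Qed.

Lemma eq_Int f k : (forall s, s \in `]0, T[ -> f s = k s) -> Int f = Int k.
Proof. by move=> fk; apply: eq_Rintegral => s; rewrite inE => /fk. Qed.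

Lemma eq_intg f k : (forall s, s \in `]0, T[ -> f s = k s) -> intg f -> intg k.
Proof.
by move=> fk; apply: eq_integrable => [|s]; [exact: measD|rewrite inE => /fk /= ->].
Qed.

Lemma ae_eq_Int f k : measurable_fun D f -> measurable_fun D k ->
  aeT (fun s => f s = k s) -> Int f = Int k.
Proof.
move=> mf mk fk; rewrite /Int /Rintegral; congr fine.
apply: ae_eq_integral; [exact: measD|exact/measurable_EFinP|exact/measurable_EFinP|].
by apply: (@filterS _ _ (ae_filter_ringOfSetsType mu) _ _ _ fk) => s h Ds /=; rewrite h.
Qed.

Lemma ae_le_Int f k : intg f -> intg k ->
  aeT (fun s => f s <= k s) -> Int f <= Int k.
Proof.
move=> If Ik fk.
(* The maximum dominates [f] everywhere and equals [k] almost everywhere, which reduces the claim to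
   pointwise monotonicity. *)
rewrite (_ : Int k = Int (fun s => Num.max (f s) (k s))).
  apply: le_Rintegral; [exact: measD|exact: If| |by move=> s _; rewrite le_max lexx].
  apply: (@intg_bound _ (fun s => `|f s| + `|k s|)).
  - by apply: measurable_maxr; exact: intg_meas.
  - by apply: intgD; exact: intg_norm.
  - by move=> s _; case: (leP (f s) (k s)) => _; rewrite ?lerDl ?lerDr normr_ge0.
apply: ae_eq_Int; [exact: intg_meas|by apply: measurable_maxr; exact: intg_meas|].
by apply: aeT_imp fk => s _ /max_idPr ->.
Qed.

Lemma le_Int f k : intg f -> intg k ->
  (forall s, s \in `]0, T[ -> f s <= k s) -> Int f <= Int k.
Proof. by move=> If Ik fk; apply: ae_le_Int => //; exact: aeTW. Qed.

Lemma IntD f k : intg f -> intg k -> Int (fun s => f s + k s) = Int f + Int k.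
Proof. exact: RintegralD measD. Qed.

Lemma IntB f k : intg f -> intg k -> Int (fun s => f s - k s) = Int f - Int k.
Proof. exact: RintegralB measD. Qed.

Lemma IntZ c f : intg f -> Int (fun s => c * f s) = c * Int f.
Proof. by move=> If; rewrite /Int RintegralZl//; exact: measD. Qed.

Lemma Int0 : Int (fun=> 0) = 0.
Proof. by rewrite /Int Rintegral_cst ?mul0r//; exact: measD. Qed.

Lemma Int_sum (I : Type) (r : seq I) (P : pred I) (f : I -> R -> R) :
  (forall i, P i -> intg (f i)) ->
  Int (fun s => \sum_(i <- r | P i) f i s) = \sum_(i <- r | P i) Int (f i).
Proof.
move=> If; elim: r => [|i r IH].
  by rewrite big_nil -[RHS]Int0; apply: eq_Int => s _; rewrite big_nil.
rewrite big_cons; case: ifP => Pi; last first.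
  by rewrite -IH; apply: eq_Int => s _; rewrite big_cons Pi.
rewrite -IH -IntD; [|exact: If|exact: intg_sum].
by apply: eq_Int => s _; rewrite big_cons Pi.
Qed.

Lemma le_norm_Int f : intg f -> `|Int f| <= Int (fun s => `|f s|).
Proof. exact: le_normr_Rintegral measD. Qed.

Lemma Int_ge0 f : (forall s, s \in `]0, T[ -> 0 <= f s) -> 0 <= Int f.
Proof. by move=> f0; apply: Rintegral_ge0 => s; exact: f0. Qed.

Lemma aeT_neq (a : R) : aeT (fun s => s != a).
Proof.
exists [set a]; split => //; first exact: lebesgue_measure_set1.
by move=> s /= h; apply: contrapT => /eqP sa; apply: h.
Qed.

(** The fundamental theorem of calculus, with the subinterval as a boolean factor of the integrand
    so that every integral stays over (0,T). *)
Lemma Int_indic_itvoo (f F : R -> R) (a b : R) : 0 <= a -> a <= b -> b <= T ->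
  continuous f -> (forall x : R, is_derive x 1 F (f x)) ->
  Int (fun s => (a < s < b)%R%:R * f s) = F b - F a.
Proof.
move=> a0 ab bT cf dF.
have [ab'|ba] := ltP a b; last first.
  have -> : a = b by apply/eqP; rewrite eq_le ab ba.
  rewrite subrr -[RHS]Int0; apply: eq_Int => s _.
  by case: ltP => // bs /=; rewrite ?mul0r// ltNge (ltW bs) mul0r.
have cF : continuous F.
  by move=> x; apply/differentiable_continuous/derivable1_diffP.
have FTC : (\int[mu]_(x in `[a, b]) (f x)%:E = (F b)%:E - (F a)%:E)%E.
  apply: continuous_FTC2 => //; first exact: continuous_subspaceT.
  - split=> [x _||]; first by [].
    + exact/cvg_at_right_filter/cF.
    + exact/cvg_at_left_filter/cF.
  - by move=> x _; rewrite derive1E; apply: derive_val.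
have intf : mu.-integrable `[a, b] (EFin \o f).
  by apply: continuous_compact_integrable; [exact: segment_compact|exact: continuous_subspaceT].
rewrite -[RHS]/(fine ((F b)%:E - (F a)%:E)) -FTC.
rewrite -/(Rintegral mu `[a, b] f) -Rintegral_itv_bndo_bndc; last first.
  by apply: integrableS intf => //; apply: subset_itv; rewrite bnd_simp.
rewrite -Rintegral_itv_obnd_cbnd; last first.
  by apply: integrableS intf => //; apply: subset_itv; rewrite bnd_simp.
have -> : `]a, b[%classic = D `&` `]a, b[.
  apply/seteqP; split=> x /=; rewrite !in_itv/=; last by case.
  by move=> /andP[ax xb]; rewrite ax xb (le_lt_trans a0 ax) (lt_le_trans xb bT).
rewrite Rintegral_mkcondr; apply: eq_Int => s _.
rewrite patchE mem_setE in_itv/=.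
by case: ifP => _; rewrite ?mul1r ?mul0r.
Qed.

End Integrals.

(** * Dual norms as support functions *)

Section SupportFunction.
Context {R : realType} {M : nat}.
Implicit Types (x y nu : 'cV[R]_M) (K : 'cV[R]_M -> Prop).

Lemma dotpE x y : dotp x y = \sum_i x i 0 * y i 0.
Proof. by rewrite /dotp mxE; apply: eq_bigr => i _; rewrite mxE. Qed.

Lemma dotpC x y : dotp x y = dotp y x.
Proof. by rewrite !dotpE; apply: eq_bigr => i _; rewrite mulrC. Qed.

Lemma dotpDl x y z : dotp (x + y) z = dotp x z + dotp y z.
Proof. by rewrite /dotp linearD mulmxDl mxE. Qed.

Lemma dotpZl c x z : dotp (c *: x) z = c * dotp x z.
Proof. by rewrite /dotp linearZ/= -scalemxAl mxE. Qed.

Lemma dotpDr x y z : dotp x (y + z) = dotp x y + dotp x z.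
Proof. by rewrite dotpC dotpDl !(dotpC x). Qed.

Lemma dotpZr c x z : dotp x (c *: z) = c * dotp x z.
Proof. by rewrite dotpC dotpZl dotpC. Qed.

Lemma dotp0l x : dotp 0 x = 0.
Proof. by rewrite -(scale0r 0) dotpZl mul0r. Qed.

Lemma dotp0r x : dotp x 0 = 0.
Proof. by rewrite dotpC dotp0l. Qed.

Lemma dotpNl x y : dotp (- x) y = - dotp x y.
Proof. by rewrite -scaleN1r dotpZl mulN1r. Qed.

Lemma dotpNr x y : dotp x (- y) = - dotp x y.
Proof. by rewrite dotpC dotpNl dotpC. Qed.

Lemma dotpBl x y z : dotp (x - y) z = dotp x z - dotp y z.
Proof. by rewrite dotpDl dotpNl. Qed.

Lemma dotp_suml (I : Type) (r : seq I) (P : pred I) (f : I -> 'cV[R]_M) z :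
  dotp (\sum_(i <- r | P i) f i) z = \sum_(i <- r | P i) dotp (f i) z.
Proof.
elim/big_rec2: _ => [|i a b _ <-]; first exact: dotp0l.
by rewrite dotpDl.
Qed.

Lemma dotp_sumr (I : Type) (r : seq I) (P : pred I) (f : I -> 'cV[R]_M) z :
  dotp z (\sum_(i <- r | P i) f i) = \sum_(i <- r | P i) dotp z (f i).
Proof. by rewrite dotpC dotp_suml; apply: eq_bigr => i _; rewrite dotpC. Qed.

Lemma dotp_gt0 x : x != 0 -> 0 < dotp x x.
Proof.
move=> x0; rewrite lt_neqAle eq_sym; apply/andP; split.
  apply: contra x0 => /eqP; rewrite dotpE => h.
  apply/eqP/matrixP => i j; rewrite ord1 mxE.
  have /eqP := psumr_eq0P (fun k (_ : true) => sqr_ge0 (x k 0)) h (i := i) isT.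
  by rewrite mulf_eq0 orbb => /eqP.
by rewrite dotpE sumr_ge0// => i _; rewrite -expr2 sqr_ge0.
Qed.

(* The only properties of the dual unit ball that enter: a jump [x] contributes
   [suppf K x] to the total variation, so the duality of the [p]- and
   [p']-norms is not needed. *)
Record unit_ball K : Prop := UnitBall {
  ball_balanced : forall c x, `|c| <= 1 -> K x -> K (c *: x);
  ball_bounded : forall x i, K x -> `|x i 0| <= 1;
  ball_absorbing : exists2 c, 0 < c & forall x, (forall i, `|x i 0| <= c) -> K x }.

Definition suppf K nu : R := sup [set dotp nu x | x in K].

Variables (K : 'cV[R]_M -> Prop) (hK : unit_ball K).

Lemma ball0 : K 0.
Proof.
have [c c0 h] := ball_absorbing hK.
by apply: h => i; rewrite mxE normr0 ltW.
Qed.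

Lemma suppf_has_sup nu : has_sup [set dotp nu x | x in K].
Proof.
split; first by exists (dotp nu 0); exists 0 => //; exact: ball0.
exists (\sum_i `|nu i 0|) => _ [x Kx <-].
rewrite dotpE; apply: ler_sum => i _.
rewrite (le_trans (ler_norm _))// normrM ler_piMr//.
exact: (ball_bounded hK).
Qed.

Lemma suppf_ub nu x : K x -> dotp nu x <= suppf K nu.
Proof.
by move=> Kx; apply: (sup_upper_bound (suppf_has_sup nu)); exists x.
Qed.

Lemma suppf_le nu c : (forall x, K x -> dotp nu x <= c) -> suppf K nu <= c.
Proof.
move=> h; apply: sup_le_ub; first by have [] := suppf_has_sup nu.
by move=> _ [x Kx <-]; exact: h.
Qed.

Lemma suppf_adherent nu e : 0 < e -> exists2 x, K x & suppf K nu - e < dotp nu x.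
Proof.
by move=> e0; have [_ [x Kx <-] h] := sup_adherent e0 (suppf_has_sup nu); exists x.
Qed.

Lemma suppf_ge0 nu : 0 <= suppf K nu.
Proof. by rewrite -(dotp0r nu); apply: suppf_ub; exact: ball0. Qed.

(** One inequality suffices: used for [c] and for its inverse, it gives both. *)
Lemma suppf_scale c nu : suppf K (c *: nu) = `|c| * suppf K nu.
Proof.
have le (d : R) y : suppf K (d *: y) <= `|d| * suppf K y.
  apply: suppf_le => x Kx; rewrite dotpZl {1}(numEsg d) (mulrC (Num.sg d)) -mulrA.
  rewrite ler_wpM2l// -dotpZr; apply: suppf_ub.
  apply: (ball_balanced hK) => //.
  by rewrite normr_sg; case: (d != 0); rewrite ?normr0 ?normr1.
apply/eqP; rewrite eq_le le /=.
have [->|c0] := eqVneq c 0; first by rewrite normr0 mul0r suppf_ge0.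
rewrite -ler_pdivlMl ?normr_gt0// -normfV (le_trans _ (le _ _))//.
by rewrite scalerA mulVf// scale1r.
Qed.

Lemma suppfN nu : suppf K (- nu) = suppf K nu.
Proof. by rewrite -scaleN1r suppf_scale normrN1 mul1r. Qed.

Lemma suppf_gt0 nu : nu != 0 -> 0 < suppf K nu.
Proof.
move=> nu0; have [c c0 h] := ball_absorbing hK.
pose s := \sum_i `|nu i 0| + 1.
have s0 : 0 < s by rewrite ltr_wpDl// sumr_ge0.
apply: (@lt_le_trans _ _ (dotp nu ((c / s) *: nu))).
  by rewrite dotpZr mulr_gt0 ?divr_gt0 ?dotp_gt0.
apply/suppf_ub/h => i; rewrite mxE normrM gtr0_norm ?divr_gt0//.
rewrite -mulrA ler_piMr ?(ltW c0)// ler_pdivrMl// mulr1 /s.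
by rewrite (bigD1 i)//= -addrA lerDl addr_ge0// sumr_ge0.
Qed.

End SupportFunction.

Section QnormBall.
Context {R : realType} {M : nat}.
Implicit Types (x : 'cV[R]_M).

Lemma hoelder_conjugate_fin (p : R) : 1 < p ->
  hoelder_conjugate p%:E = (p / (p - 1))%:E.
Proof.
move=> p1; rewrite /hoelder_conjugate/= eqe gt_eqF ?(lt_trans _ p1)//.
by rewrite -EFinD inver gt_eqF ?subr_gt0// -EFinM.
Qed.

Lemma hoelder_conjugateP (p : \bar R) : (1 <= p)%E ->
  hoelder_conjugate p = +oo%E \/ exists2 q : R, 1 <= q & hoelder_conjugate p = q%:E.
Proof.
case: p => [p| |//]; last by move=> _; right; exists 1; rewrite ?hoelder_conjugatey.
rewrite lee_fin le_eqVlt => /predU1P[<-|p1]; [left; exact: hoelder_conjugate1|right].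
exists (p / (p - 1)); first by rewrite ler_pdivlMr ?subr_gt0// mul1r gerBl.
exact: hoelder_conjugate_fin.
Qed.

Lemma powR_le1P (y r : R) : 0 <= y -> 0 < r -> (y `^ r <= 1) = (y <= 1).
Proof.
have one : (1 : R) `^ r = 1 by rewrite powR1.
move=> y0 r0; apply/idP/idP => [|y1]; last first.
  by rewrite -one ge0_ler_powR// ?nnegrE// ltW.
apply: contraTT; rewrite -!ltNge -{2}one => y1.
by rewrite gt0_ltr_powR// nnegrE.
Qed.

Lemma qnorm_le1 (q : R) x : 1 <= q -> (qnorm q%:E x <= 1) = (\sum_i `|x i 0| `^ q <= 1).
Proof.
move=> q1; rewrite /qnorm powR_le1P ?invr_gt0 ?(lt_le_trans _ q1)//.
by apply: sumr_ge0 => i _; exact: powR_ge0.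
Qed.

Lemma qnorm_unit_ball (p : \bar R) : (1 <= p)%E ->
  unit_ball (fun x => qnorm (hoelder_conjugate p) x <= 1).
Proof.
move=> /hoelder_conjugateP[->|[q q1 ->]].
  have maxP x c : 0 <= c -> (`|x| <= c) = [forall i, `|x i 0| <= c].
    move=> c0; rewrite /Num.Def.normr/= mx_normrE.
    apply/idP/forallP => [/bigmax_leP[_ h] i|h]; first exact: (h (i, 0)).
    by apply/bigmax_leP; split=> // -[i j] _ /=; rewrite ord1; exact: h.
  split=> [c x c1|x i|]; rewrite /qnorm.
  - by rewrite normrZ => x1; rewrite mulr_ile1.
  - by rewrite maxP// => /forallP.
  - by exists 1 => // x h; rewrite maxP//; apply/forallP.
have q0 : 0 < q by apply: lt_le_trans q1.
split=> [c x c1|x i|].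
- move=> hx; rewrite (qnorm_le1 (c *: x) q1).
  have {}hx : \sum_i `|x i 0| `^ q <= 1 by rewrite -(qnorm_le1 x q1).
  apply: (le_trans _ hx); apply: ler_sum => i _.
  by rewrite ge0_ler_powR ?nnegrE ?(ltW q0)// mxE normrM ler_piMl.
- rewrite qnorm_le1// => h; rewrite -(@powR_le1P _ q)//; apply: le_trans h.
  by rewrite (bigD1 i)//= lerDl sumr_ge0// => j _; exact: powR_ge0.
(* Entries of size at most 1/(M+1) do not grow under the [q]-th power, and M of them sum to at most
   M/(M+1). The successor covers M = 0. *)
- exists M.+1%:R^-1 => [|x h]; first by rewrite invr_gt0.
  rewrite qnorm_le1// (@le_trans _ _ (\sum_(i < M) M.+1%:R^-1))//; last first.
    by rewrite sumr_const card_ord -[leLHS]mulr_natl ler_pdivrMr// mul1r ler_nat.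
  apply: ler_sum => i _; apply: le_trans (h i).
  have x1 : `|x i 0| <= 1 by apply: le_trans (h i) _; rewrite invf_le1// ler1n.
  have [->|x0] := eqVneq `|x i 0| 0; first by rewrite powR0// gt_eqF.
  by rewrite ge1r_powR// lt_neqAle eq_sym x0 normr_ge0.
Qed.

End QnormBall.

(** * Strict convexity of the p-norm for finite p > 1 *)

Section StrictConvexity.
Context {R : realType}.
Variable p : R.
Hypothesis p_gt1 : 1 < p.
Let q := p / (p - 1).

Let p0 : 0 < p. Proof. exact: lt_trans p_gt1. Qed.

Let pq : p^-1 + q^-1 = 1.
Proof. by rewrite /q; field; rewrite ?gt_eqF ?subr_gt0. Qed.

Let q0 : 0 < q.
Proof.
rewrite -invr_gt0 -(ltrD2l p^-1) addr0 pq invf_lt1//.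
Qed.

Let q_gt1 : 1 < q.
Proof. by rewrite -invf_lt1// -pq ltrDr invr_gt0. Qed.

(* Convexity of [expR], through its tangent line at [ln (a * b)]. *)
Lemma young_eq (a b : R) : 0 <= a -> 0 <= b ->
  a * b <= a `^ q / q + b `^ p / p /\
  (a * b = a `^ q / q + b `^ p / p -> a `^ q = b `^ p).
Proof.
move=> a0 b0; have [->|an0] := eqVneq a 0.
  rewrite mul0r powR0 ?gt_eqF// mul0r add0r; split.
    by rewrite divr_ge0 ?powR_ge0 ?ltW.
  by move=> /esym/eqP; rewrite mulf_eq0 invr_eq0 (gt_eqF p0) orbF => /eqP.
have [->|bn0] := eqVneq b 0.
  rewrite mulr0 (@powR0 R p) ?gt_eqF// mul0r addr0; split.
    by rewrite divr_ge0 ?powR_ge0 ?ltW.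
  by move=> /esym/eqP; rewrite mulf_eq0 invr_eq0 (gt_eqF q0) orbF => /eqP.
have {an0} {}a0 : 0 < a by rewrite lt_neqAle eq_sym an0.
have {bn0} {}b0 : 0 < b by rewrite lt_neqAle eq_sym bn0.
rewrite /powR !gt_eqF//; set A := q * ln a; set B := p * ln b.
pose m := A / q + B / p.
have abE : a * b = expR m.
  rewrite /m /A /B [q * _]mulrC [p * _]mulrC !mulfK ?gt_eqF//.
  by rewrite expRD !lnK.
have tang x : expR m * (1 + (x - m)) <= expR x.
  have -> : expR x = expR m * expR (x - m) by rewrite -expRD subrKC.
  by rewrite ler_pM2l ?expR_gt0// expR_ge1Dx.
have tangs x : x != m -> expR m * (1 + (x - m)) < expR x.
  move=> xm; have -> : expR x = expR m * expR (x - m) by rewrite -expRD subrKC.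
  by rewrite ltr_pM2l ?expR_gt0// expR_gt1Dx// subr_eq0.
have tot : expR m * (1 + (A - m)) / q + expR m * (1 + (B - m)) / p = expR m.
  rewrite -!mulrA -mulrDr -[RHS]mulr1; congr (_ * _).
  transitivity ((1 - m) * (p^-1 + q^-1) + m); last by rewrite pq; ring.
  transitivity ((1 - m) * (p^-1 + q^-1) + (A / q + B / p)); last by [].
  by ring.
rewrite abE; split.
  by rewrite -{1}tot lerD// ler_wpM2r// invr_ge0 ltW.
move=> e; congr expR; apply/eqP; apply: contraT => AB.
have /orP AmBm : (A != m) || (B != m).
  by rewrite -negb_and; apply: contra AB => /andP[/eqP -> /eqP ->].
suff : expR m < expR m by rewrite ltxx.
rewrite {2}e -{1}tot; case: AmBm => h.
  by apply: ltr_leD; [rewrite ltr_pM2r ?invr_gt0// tangs|rewrite ler_wpM2r// invr_ge0 ltW].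
by apply: ler_ltD; [rewrite ler_wpM2r// invr_ge0 ltW|rewrite ltr_pM2r ?invr_gt0// tangs].
Qed.

Context {M : nat}.
Implicit Types (x y z xi : 'cV[R]_M).
Let K xi := qnorm q%:E xi <= 1.
Let K_ball : unit_ball K.
Proof.
rewrite /K -hoelder_conjugate_fin//.
by apply: qnorm_unit_ball; rewrite lee_fin ltW.
Qed.

Definition pnormalized x := \sum_i `|x i 0| `^ p = 1.

Lemma pnormalize x : x != 0 -> exists c y, [/\ 0 < c, pnormalized y & x = c *: y].
Proof.
move=> x0; pose s := \sum_i `|x i 0| `^ p.
have s0 : 0 < s.
  rewrite lt_neqAle eq_sym sumr_ge0 ?andbT => [|i _]; last exact: powR_ge0.
  apply: contra x0 => /eqP s0; apply/eqP/matrixP => i j; rewrite ord1 mxE.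
  have /eqP := psumr_eq0P (fun k (_ : true) => powR_ge0 `|x k 0| p) s0 (i := i) isT.
  by rewrite powR_eq0 normr_eq0 => /andP[/eqP].
pose c := s `^ p^-1; have c0 : 0 < c by exact: powR_gt0.
have cp : c `^ p = s by rewrite -powRrM mulVf ?gt_eqF// powRr1// ltW.
exists c, (c^-1 *: x); split=> //; last by rewrite scalerA mulfV ?gt_eqF// scale1r.
apply: (mulfI (lt0r_neq0 s0)); rewrite mulr1 mulr_sumr; apply: eq_bigr => i _.
by rewrite -cp -powRM ?(ltW c0)// mxE normrM gtr0_norm ?invr_gt0// mulrA mulfV ?gt_eqF// mul1r.
Qed.

(** The equality case of Hoelder's inequality recovers [x] from [xi] alone. Two normalized vectors
    with a common extremal functional therefore coincide, which is the source of strict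
    convexity. *)
Lemma hoelder_sum xi x : K xi -> pnormalized x ->
  dotp x xi <= 1 /\ (dotp x xi = 1 ->
    x = \col_i (Num.sg (xi i 0) * `|xi i 0| `^ (q / p))).
Proof.
rewrite /K qnorm_le1 ?(ltW q_gt1)// => Kxi px.
pose Y i := `|xi i 0| `^ q / q + `|x i 0| `^ p / p.
have Y1 : \sum_i Y i <= 1.
  rewrite big_split/= -!mulr_suml px mul1r -pq addrC lerD2l.
  by rewrite -[leRHS]mul1r ler_wpM2r// invr_ge0 ltW.
have le i : x i 0 * xi i 0 <= Y i.
  have [h _] := young_eq (normr_ge0 (xi i 0)) (normr_ge0 (x i 0)).
  by rewrite mulrC (le_trans (ler_norm _))// normrM.
split; first by rewrite dotpE (le_trans _ Y1)// ler_sum.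
rewrite dotpE => e.
(* The defects in Young's inequality are nonnegative and their sum is at most 0, so equality holds
   in every coordinate. *)
have ze : forall i, Y i - x i 0 * xi i 0 = 0.
  have Y0 i : true -> 0 <= Y i - x i 0 * xi i 0 by rewrite subr_ge0.
  have S0 : \sum_i (Y i - x i 0 * xi i 0) = 0.
    apply/eqP; rewrite eq_le sumr_ge0 ?andbT => [|j _]; last by rewrite subr_ge0.
    by rewrite sumrB e subr_le0.
  by move=> i; exact: (psumr_eq0P (fun i _ => Y0 i isT) S0).
apply/matrixP => i j; rewrite ord1 mxE.
have /eqP := ze i; rewrite subr_eq0 => /eqP Yi.
have [h heq] := young_eq (normr_ge0 (xi i 0)) (normr_ge0 (x i 0)).
have E : `|xi i 0| * `|x i 0| = x i 0 * xi i 0.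
  apply/eqP; rewrite eq_le -{1}Yi h/=.
  by rewrite -normrM mulrC ler_norm.
have {}heq := heq (etrans E (esym Yi)).
have xn : `|x i 0| = `|xi i 0| `^ (q / p).
  by rewrite powRrM heq -powRrM mulfV ?gt_eqF// powRr1.
rewrite -xn; have [xi0|xin0] := eqVneq (xi i 0) 0.
  move: xn; rewrite xi0 normr0 powR0; last by rewrite mulf_neq0 ?invr_eq0 ?gt_eqF.
  by move/normr0_eq0 => ->; rewrite normr0 mulr0.
apply: (mulIf xin0); rewrite -E (normrEsg (xi i 0)); ring.
Qed.

(** The extremal [xi] is the gradient of the p-norm at [x]; it lies in the dual ball because (p - 1)
    * q = p. *)
Lemma suppf_pnormalized x : pnormalized x ->
  suppf K x = 1 /\ exists2 xi, K xi & dotp x xi = 1.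
Proof.
move=> px; pose xi := \col_i (Num.sg (x i 0) * `|x i 0| `^ (p - 1)).
have Kxi : K xi.
  rewrite /K qnorm_le1 ?(ltW q_gt1)// -px ler_sum// => i _.
  rewrite mxE normrM normr_sg ger0_norm ?powR_ge0//.
  have [->|x0] := eqVneq (x i 0) 0; first by rewrite normr0 mul0r !powR0 ?gt_eqF.
  rewrite mul1r -powRrM (_ : (p - 1) * q = p)//.
  by rewrite /q mulrC divfK// subr_eq0 gt_eqF.
have xxi : dotp x xi = 1.
  rewrite dotpE -px; apply: eq_bigr => i _; rewrite mxE mulrA [_ * Num.sg _]mulrC -normrEsg.
  by rewrite mulr_powRB1.
split; last by exists xi.
apply/eqP; rewrite eq_le -{2}xxi suppf_ub// andbT.
by apply: suppf_le => // z Kz; have [] := hoelder_sum Kz px.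
Qed.

(** A functional that is extremal for [x + y] must be extremal for [x] and for [y] as well. By the
    equality case their normalizations agree, so both are nonnegative multiples of one vector. *)
Lemma suppf_strict x y : suppf K x + suppf K y <= suppf K (x + y) ->
  exists2 l, 0 <= l <= 1 & y = l *: (x + y).
Proof.
have [->|x0] := eqVneq x 0.
  by exists 1; rewrite ?ler01 ?lexx// scale1r add0r.
have [->|y0] := eqVneq y 0.
  by exists 0; rewrite ?ler01 ?lexx// scale0r.
have [z0|z0] := eqVneq (x + y) 0.
  rewrite z0 -(scale0r 0) suppf_scale// normr0 mul0r leNgt.
  by rewrite addr_gt0// suppf_gt0.
have [a [x' [a0 px' xE]]] := pnormalize x0.
have [b [y' [b0 py' yE]]] := pnormalize y0.
have [c [z' [c0 pz' zE]]] := pnormalize z0.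
have [Nx _] := suppf_pnormalized px'.
have [Ny _] := suppf_pnormalized py'.
have [Nz [xi Kxi zxi]] := suppf_pnormalized pz'.
rewrite {1}xE {1}yE zE !suppf_scale// Nx Ny Nz !mulr1 !gtr0_norm// => abc.
have [hx ex] := hoelder_sum Kxi px'.
have [hy ey] := hoelder_sum Kxi py'.
have cE : c = a * dotp x' xi + b * dotp y' xi.
  by rewrite -!dotpZl -xE -yE -dotpDl zE dotpZl zxi mulr1.
have x1 : dotp x' xi = 1 by nra.
have y1 : dotp y' xi = 1 by nra.
have xy : x' = y' by rewrite ex// ey.
exists (b / (a + b)).
  have ab0 : 0 < a + b by rewrite addr_gt0.
  by rewrite divr_ge0 ?(ltW b0) ?(ltW ab0)//= ler_pdivrMr// mul1r lerDr ltW.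
rewrite -zE xE yE xy -scalerDl scalerA divfK// gt_eqF ?addr_gt0//.
Qed.

End StrictConvexity.

(** * Total variation *)

Section TotalVariation.
Context {R : realType} {M : nat} (T : R).
Hypothesis T_gt0 : 0 < T.
Implicit Types (u v w phi : R -> 'cV[R]_M) (x : 'cV[R]_M).
Notation mu := (@lebesgue_measure R).
Local Notation D := (`]0, T[%classic : set (measurableTypeR R)).

Lemma meas_continuous (f : R -> R) : continuous f ->
  measurable_fun D (f : measurableTypeR R -> R).
Proof. by move=> cf; apply: measurable_funTS; exact: continuous_measurable_fun. Qed.

Lemma continuous_bounded (f : R -> R) : continuous f ->
  exists C, forall s, s \in `]0, T[ -> `|f s| <= C.
Proof.
move=> cf; have cf' : {within `[0, T], continuous (fun s => `|f s|)}.
  by apply: continuous_subspaceT => s; apply: cvg_norm; exact: cf.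
have [c _ h] := EVT_max (ltW T_gt0) cf'.
exists `|f c| => s; rewrite in_itv/= => /andP[s0 sT].
by apply: h; rewrite in_itv/= !ltW.
Qed.

Lemma intg_continuous_mul (f k : R -> R) : intg T f -> continuous k ->
  intg T (fun s => f s * k s).
Proof.
move=> If ck; have [C hC] := continuous_bounded ck.
by apply: (intgM (C := C)) => //; exact: meas_continuous.
Qed.

Section TestFunction.
Variables (phi : R -> 'cV[R]_M).
Hypothesis phiC : C1c T phi.

Lemma C1c_is_derive i (s : R) :
  is_derive s 1 (fun r : R => phi r i 0) (derive1 phi s i 0).
Proof.
have [d _ _ _] := phiC; have ds := d s.
apply: DeriveDef; first by move/derivable_mxP : ds; apply.
by rewrite derive1E derive_mx// mxE.
Qed.

Lemma C1c_continuous_derive i : continuous (fun s => derive1 phi s i 0).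
Proof.
have [_ c _ _] := phiC; move=> s.
by apply: (@continuous_comp _ _ _ (derive1 phi) (fun A : 'cV[R]_M => A i 0));
  [exact: c|exact: coord_continuous].
Qed.

Lemma C1c_eq0 s : s \notin `]0, T[ -> phi s = 0.
Proof.
have [_ _ _ sub] := phiC; move=> sT; apply/eqP/negPn/negP => ps.
by move/negP : sT; apply; apply: sub; apply: subset_closure.
Qed.

Lemma intg_dotp w : inL1 T w -> intg T (fun s => dotp (w s) (derive1 phi s)).
Proof.
move=> Lw.
apply: (@eq_intg _ _ (fun s => \sum_i w s i 0 * derive1 phi s i 0)).
  by move=> s _; rewrite dotpE.
apply: intg_sum => i _; apply: intg_continuous_mul; first exact: Lw.
exact: C1c_continuous_derive.
Qed.

End TestFunction.

Lemma TV_eqL1 p u v : inL1 T u -> inL1 T v -> eqL1 T u v -> TV T p u = TV T p v.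
Proof.
move=> Lu Lv uv; rewrite /TV; congr ereal_sup; apply: eq_imagel => phi [phiC _].
congr (_%:E); apply: ae_eq_Int.
- exact: intg_meas (intg_dotp phiC Lu).
- exact: intg_meas (intg_dotp phiC Lv).
- by apply: aeT_imp uv => s _ ->.
Qed.

(** [c] is the value to the right of all jumps, and [nu i] is the value on the left of [tau i] minus
    the value on the right. The [tau i] may come in any order and may coincide, so translated and
    split jumps have the same form. *)
Definition stair (I : finType) (c : 'cV[R]_M) (tau : I -> R) (nu : I -> 'cV[R]_M) :
  R -> 'cV[R]_M := fun s => c + \sum_i (s < tau i)%R%:R *: nu i.

Lemma meas_lt (r : R) : measurable_fun D (fun s : R => (s < r)%R%:R : R).
Proof.
have -> : (fun s : R => (s < r)%R%:R : R) = \1_(`]-oo, r[%classic).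
  by apply/funext => s; rewrite indicE mem_setE in_itv.
by apply: measurable_funTS; apply: measurable_indic; exact: measurable_itv.
Qed.

Lemma intg_lt (r : R) : intg T (fun s : R => (s < r)%R%:R).
Proof.
apply: (@intg_bounded _ _ _ 1); first exact: meas_lt.
by move=> s _; rewrite normr_nat; case: (_ < _).
Qed.

Lemma inL1_stair (I : finType) c tau (nu : I -> _) : inL1 T (stair c tau nu).
Proof.
move=> i; apply: (@eq_intg _ _ (fun s => c i 0 + \sum_k nu k i 0 * (s < tau k)%R%:R)).
  by move=> s _; rewrite !mxE summxE; congr (_ + _); apply: eq_bigr => k _; rewrite mxE mulrC.
apply: intgD; first exact: intg_cst.
by apply: intg_sum => k _; apply: intgZ; exact: intg_lt.
Qed.

(** As [phi] vanishes at 0 and [T], the integral of its derivative up to [tau k] is [phi (tau k)],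
    and the constant [c] contributes nothing. *)
Lemma Int_stair (I : finType) c tau (nu : I -> _) phi : C1c T phi ->
  (forall k, tau k \in `]0, T[) ->
  Int T (fun s => dotp (stair c tau nu s) (derive1 phi s)) =
  \sum_k dotp (nu k) (phi (tau k)).
Proof.
move=> phiC tauT.
have p0 : phi 0 = 0 by apply: (C1c_eq0 phiC); rewrite in_itv/= ltxx.
have pT : phi T = 0 by apply: (C1c_eq0 phiC); rewrite in_itv/= ltxx andbF.
have FTC i (r : R) : 0 <= r -> r <= T ->
    Int T (fun s => (s < r)%R%:R * derive1 phi s i 0) = phi r i 0.
  move=> r0 rT; transitivity (phi r i 0 - phi 0 i 0); last by rewrite p0 mxE subr0.
  have H := @Int_indic_itvoo _ T (fun s => derive1 phi s i 0) (fun s => phi s i 0)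
    0 r (lexx 0) r0 rT (C1c_continuous_derive phiC (i := i)) (C1c_is_derive phiC i).
  by rewrite -[RHS]H; apply: eq_Int => s; rewrite in_itv/= => /andP[-> _].
pose P i s := c i 0 * derive1 phi s i 0 +
  \sum_k nu k i 0 * ((s < tau k)%R%:R * derive1 phi s i 0).
have IP i : intg T (fun s => derive1 phi s i 0).
  apply: (@eq_intg _ _ (fun s => 1 * derive1 phi s i 0)); first by move=> s _; rewrite mul1r.
  by apply: intg_continuous_mul; [exact: intg_cst|exact: C1c_continuous_derive].
have IQ i k : intg T (fun s => (s < tau k)%R%:R * derive1 phi s i 0).
  by apply: intg_continuous_mul; [exact: intg_lt|exact: C1c_continuous_derive].
rewrite (@eq_Int _ _ _ (fun s => \sum_i P i s)); last first.
  move=> s _; rewrite dotpE; apply: eq_bigr => i _.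
  rewrite !mxE summxE mulrDl mulr_suml; congr (_ + _); apply: eq_bigr => k _.
  by rewrite mxE; ring.
rewrite Int_sum => [|i _]; last first.
  by apply: intgD; [exact: intgZ|apply: intg_sum => k _; exact: intgZ].
transitivity (\sum_i \sum_k nu k i 0 * phi (tau k) i 0).
  apply: eq_bigr => i _; rewrite IntD; last 2 first.
  - exact: intgZ.
  - by apply: intg_sum => k _; exact: intgZ.
  rewrite IntZ// Int_sum => [|k _]; last exact: intgZ.
  rewrite (@eq_Int _ _ _ (fun s => (s < T)%R%:R * derive1 phi s i 0)); last first.
    by move=> s; rewrite in_itv/= => /andP[_ ->]; rewrite mul1r.
  rewrite (FTC i T (ltW T_gt0) (lexx T)) pT mxE mulr0 add0r; apply: eq_bigr => k _.
  have := tauT k; rewrite in_itv/= => /andP[t0 tT].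
  by rewrite IntZ// (FTC i _ (ltW t0) (ltW tT)).
by rewrite exchange_big; apply: eq_bigr => k _; rewrite dotpE.
Qed.

Lemma TV_stair_le p (I : finType) c tau (nu : I -> _) : (1 <= p)%E ->
  (forall k, tau k \in `]0, T[) ->
  (TV T p (stair c tau nu) <=
   (\sum_k suppf (fun x => qnorm (hoelder_conjugate p) x <= 1) (nu k))%:E)%E.
Proof.
move=> p1 tauT; apply: ge_ereal_sup => _ [phi [phiC phi1] <-].
rewrite lee_fin -/(Int T _) Int_stair//; apply: ler_sum => k _.
apply: suppf_ub; first exact: qnorm_unit_ball.
exact: phi1.
Qed.

End TotalVariation.

(** * Piecewise quadratic step functions *)

Section Bumps.
Context {R : realType}.

Lemma little_o_is_derive (f : R -> R) (x d : R) :
  (forall e, 0 < e -> exists2 r, 0 < r & forall y, `|y| <= r ->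
    `|f (x + y) - f x - d * y| <= e * `|y|) -> is_derive x 1 f d.
Proof.
move=> h.
have cv : (fun y : R => y^-1 *: (f (y *: 1 + x) - f x)) @ 0^' --> d.
  apply/cvgrPdist_le => /= e e0; have [r r0 H] := h e e0; near=> y.
  have y0 : y != 0 by near: y; exact: nbhs_dnbhs_neq.
  rewrite distrC -[y *: 1]/(y * 1) mulr1 addrC (addrC y).
  have -> : - d + y^-1 *: (f (x + y) - f x) = y^-1 * (f (x + y) - f x - d * y).
    by rewrite -[_ *: _]/(_ * _); field.
  rewrite normrM normfV ler_pdivrMl ?normr_gt0// [leRHS]mulrC.
  by apply: H; near: y; exact: dnbhs0_le.
split; first by apply/cvg_ex; exists d.
exact/cvg_lim.
Unshelve. all: by end_near. Qed.

Lemma is_derive_little_o (f : R -> R) (x d : R) : is_derive x 1 f d ->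
  forall e, 0 < e -> exists2 r, 0 < r & forall y, `|y| <= r ->
    `|f (x + y) - f x - d * y| <= e * `|y|.
Proof.
move=> [/cvg_ex[l fl] fd] e e0.
have ld : l = d by rewrite -fd; apply/esym/cvg_lim.
move: fl; rewrite {}ld => /cvgrPdist_le /(_ e e0) [r /= r0 H].
exists (r / 2) => [|y yr]; first by rewrite divr_gt0.
have [->|y0] := eqVneq y 0; first by rewrite addr0 subrr mulr0 subr0 normr0 mulr0.
have /= := H y _ y0; rewrite sub0r normrN => /(_ (le_lt_trans yr _)).
have -> : r / 2 < r by lra.
move=> /(_ isT); rewrite distrC -[y *: 1]/(y * 1) mulr1 (addrC y).
have -> : y^-1 *: (f (x + y) - f x) - d = y^-1 * (f (x + y) - f x - d * y).
  by rewrite -[_ *: _]/(_ * _); field.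
by rewrite normrM normfV ler_pdivrMl ?normr_gt0// [_ * e]mulrC.
Qed.

(** Turns differentiability of piecewise quadratic functions into an algebraic inequality, so that
    the kinks of [Num.max] need no separate limits. *)
Lemma quadratic_is_derive (f : R -> R) (x d C : R) :
  (forall y, `|f (x + y) - f x - d * y| <= C * y ^+ 2) -> is_derive x 1 f d.
Proof.
move=> h; have C0 : 0 <= C by have := h 1; rewrite expr1n !mulr1 => /(le_trans (normr_ge0 _)).
apply: little_o_is_derive => e e0; exists (e / (C + 1)) => [|y].
  by rewrite divr_gt0// ltr_wpDl.
rewrite ler_pdivlMr ?ltr_wpDl// => yc; apply: le_trans (h y) _.
rewrite -real_normK ?num_real// expr2 mulrA ler_wpM2r//.
by apply: le_trans yc; rewrite mulrC ler_wpM2l// lerDl.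
Qed.

Definition pos2 (x : R) := Num.max x 0 ^+ 2.

Lemma pos2_quad x y : `|pos2 (x + y) - pos2 x - 2 * Num.max x 0 * y| <= y ^+ 2.
Proof.
rewrite /pos2 ler_norml; case: (leP (x + y) 0) => h1; case: (leP x 0) => h2;
  apply/andP; split; nra.
Qed.

(* The primitive of a hat function on [[0, 1]]. *)
Definition step (x : R) := 2 * pos2 x - 4 * pos2 (x - 2^-1) + 2 * pos2 (x - 1).

Definition dstep (x : R) :=
  4 * Num.max x 0 - 8 * Num.max (x - 2^-1) 0 + 4 * Num.max (x - 1) 0.

(** The constant is 2 + 4 + 2, the sum of the absolute values of the coefficients in [step]. *)
Lemma step_quad x y : `|step (x + y) - step x - dstep x * y| <= 8 * y ^+ 2.
Proof.
have h0 := pos2_quad x y.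
have h1 := pos2_quad (x - 2^-1) y.
have h2 := pos2_quad (x - 1) y.
rewrite /step /dstep; move: h0 h1 h2; rewrite !(addrAC x y) !ler_norml.
move=> /andP[? ?] /andP[? ?] /andP[? ?]; apply/andP; split; lra.
Qed.

Lemma step_eq0 x : x <= 0 -> step x = 0.
Proof.
move=> x0; rewrite /step /pos2 !max_r//; first by ring.
all: lra.
Qed.

Lemma step_eq1 x : 1 <= x -> step x = 1.
Proof.
move=> x1; rewrite /step /pos2 !max_l; [by field|lra|lra|lra].
Qed.

Lemma step_ge0 x : 0 <= step x.
Proof.
rewrite /step /pos2; case: (leP x 0) => h1; case: (leP (x - 2^-1) 0) => h2;
case: (leP (x - 1) 0) => h3; try nra.
Qed.

Lemma step_le1 x : step x <= 1.
Proof.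
rewrite /step /pos2; case: (leP x 0) => h1; case: (leP (x - 2^-1) 0) => h2;
case: (leP (x - 1) 0) => h3; try nra.
Qed.

Lemma dstep_eq0 x : x <= 0 \/ 1 <= x -> dstep x = 0.
Proof.
case=> h; rewrite /dstep.
  by rewrite !max_r; [ring|lra|lra|lra].
by rewrite !max_l; [field|lra|lra|lra].
Qed.

Lemma dstep_bound x : `|dstep x| <= 2.
Proof.
rewrite /dstep ler_norml; case: (leP x 0) => h1; case: (leP (x - 2^-1) 0) => h2;
case: (leP (x - 1) 0) => h3; apply/andP; split; lra.
Qed.

Lemma continuous_affine (a k c : R) : continuous (fun s : R => (s - a) * k + c).
Proof.
move=> s; apply: cvgD; last exact: cvg_cst.
by apply: cvgM; [apply: cvgB; [exact: cvg_id|exact: cvg_cst]|exact: cvg_cst].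
Qed.

Lemma continuous_dstep : continuous dstep.
Proof.
have cmax (c : R) : continuous (fun x : R => Num.max (x - c) 0).
  move=> x; apply: (@continuous_max _ _ (fun x => x - c : R^o) (cst (0 : R^o))); last exact: cst_continuous.
  by apply: cvgB; [exact: cvg_id|exact: cvg_cst].
have c0 : continuous (fun x : R => Num.max x 0).
  by rewrite (_ : (fun _ => _) = fun x : R => Num.max (x - 0) 0)//; apply/funext => x; rewrite subr0.
have cM (k : R) f : continuous f -> continuous (fun x : R => k * f x).
  by move=> cf x; apply: cvgM; [exact: cvg_cst|exact: cf].
move=> x; apply: cvgD; last exact: (cM 4 _ (cmax 1) x).
by apply: cvgB; [exact: (cM 4 _ c0 x)|exact: (cM 8 _ (cmax 2^-1) x)].
Qed.

End Bumps.

Lemma continuous_mx (R : realType) (M : nat) (f : R -> 'cV[R]_M) :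
  (forall i, continuous (fun s => f s i 0)) -> continuous f.
Proof.
move=> h s; apply/cvgrPdist_le => /= e e0; near=> r.
rewrite /Num.Def.normr/= mx_normrE (bigmax_le _ (ltW e0))//= => -[i j] _ /=.
rewrite !mxE ord1.
move: i; near: r; apply: filter_forall => /= i.
exact: ((cvgrPdist_le _ _).1 (h i s)).
Unshelve. all: by end_near. Qed.

(** * One-sided mollification at Lebesgue points *)

Section Mollify.
Context {R : realType} (T : R).
Notation mu := (@lebesgue_measure R).
Local Notation D := (`]0, T[%classic : set (measurableTypeR R)).

Lemma ae_lebesgue_pt (f : R -> R) : intg T f ->
  {ae mu, forall x, lebesgue_pt (f \_ `]0, T[) x}.
Proof.
move=> If; apply: lebesgue_differentiation; apply: open_integrable_locally.
  exact: openT.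
rewrite -restrict_EFin; by apply/(integrable_mkcond _ (@measD R T)).
Qed.

Lemma intg_ball (f : R -> R) (a h : R) : intg T f ->
  intg T (fun s => (`|s - a| < h)%R%:R * `|f s - f a|).
Proof.
move=> If; have Ifa : intg T (fun s => `|f s - f a|).
  by apply/intg_norm/intgB => //; exact: intg_cst.
apply: (@intg_bound _ _ _ (fun s => `|f s - f a|)) => //; last first.
  by move=> s _; case: (_ < h); rewrite ?mul1r ?mul0r ?normr_id ?normr0.
apply: measurable_funM; last exact: intg_meas.
have -> : (fun s : R => (`|s - a| < h)%R%:R : R) = \1_(`]a - h, a + h[%classic).
  by apply/funext => s; rewrite indicE mem_setE in_itv/= ltr_distl.
by apply: measurable_funTS; apply: measurable_indic; exact: measurable_itv.
Qed.

Lemma lebesgue_pt_ball (f : R -> R) (a : R) : intg T f -> 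
  lebesgue_pt (f \_ `]0, T[) a -> a \in `]0, T[ ->
  forall e, 0 < e -> exists2 h0, 0 < h0 &
    forall h, 0 < h -> h < h0 -> Int T (fun s => (`|s - a| < h)%R%:R * `|f s - f a|) <= e * h.
Proof.
move=> If /fine_cvgP[fa_fin /cvgrPdist_le fa] aT e e0.
(* The average runs over a ball of length [2 * h], so a bound [e / 2] on it bounds the integral by
   [e * h]. *)
have e2 : 0 < e / 2 by lra.
have : \forall h \near (0 : R)^'+, davg (f \_ `]0, T[) a h \is a fin_num /\
    `|0 - fine (davg (f \_ `]0, T[) a h)| <= e / 2 by apply/near_andP; split; [|exact: fa].
move=> [d /= d0 H]; move: (aT); rewrite in_itv/= => /andP[a0 a1].
exists (Num.min d (Num.min a (T - a))) => [|h hp]; first by rewrite !lt_min d0 a0/= subr_gt0.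
rewrite !lt_min => /and3P[hd ha hT].
have [] := H h _ hp; first by rewrite /ball_/= sub0r normrN gtr0_norm.
have ballD : D `&` ball a h = ball a h.
  apply/setIidr => s; rewrite ball_itv/= !in_itv/= => /andP[h1 h2].
  by apply/andP; split; lra.
have FE s : s \in `]0, T[ -> (f \_ `]0, T[) s = f s by move=> sT; rewrite patchE mem_setE sT.
have E : (\int[mu]_(y in ball a h) `| (center ((f \_ `]0, T[) a) \o (f \_ `]0, T[)) y |%:E =
    (Int T (fun s => (`|s - a| < h)%R%:R * `|f s - f a|))%:E)%E.
  rewrite /Int /Rintegral fineK; last by apply: integrable_fin_num; [exact: measD|exact: (intg_ball a h If)].
  rewrite -ballD integral_mkcondr; apply: eq_integral => s sD.
  rewrite patchE; case: ifPn.
    rewrite ball_itv mem_setE in_itv/= -ltr_distl => ->.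
    rewrite mul1r /= FE//; last by rewrite inE in sD.
    by rewrite FE.
  by rewrite ball_itv mem_setE in_itv/= -ltr_distl => /negbTE ->; rewrite mul0r.
rewrite /davg /iavg (lebesgue_measure_ball _ (ltW hp)) E inver mulrn_eq0/= gt_eqF//= => _.
rewrite sub0r normrN => /(le_trans (ler_norm _)); rewrite ler_pdivrMl ?pmulrn_lgt0//.
by rewrite -mulr_natr => h1; apply: (le_trans h1); rewrite le_eqVlt; apply/orP; left; apply/eqP; field.
Qed.

(** The kernel has mass 1 and height at most [2 / h]. It lives on [a, a + h] for [c = 0] and on
    [a - h, a] for [c = 1]: a bump rising after one point and falling before another needs both
    sides. *)
Lemma mollify (f : R -> R) (a : R) : intg T f ->
  lebesgue_pt (f \_ `]0, T[) a -> a \in `]0, T[ ->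
  forall e, 0 < e -> exists2 h0, 0 < h0 & forall h, 0 < h -> h < h0 ->
    forall c, c = 0 \/ c = 1 ->
    `|Int T (fun s => f s * (dstep ((s - a) / h + c) / h)) - f a| <= e.
Proof.
move=> If fa aT e e0.
have e2 : 0 < e / 2 by lra.
have [h0 h00 H] := lebesgue_pt_ball If fa aT e2.
move: (aT); rewrite in_itv/= => /andP[a0 a1].
exists (Num.min h0 (Num.min a (T - a))) => [|h hp]; first by rewrite !lt_min h00 a0/= subr_gt0.
rewrite !lt_min => /and3P[hh0 ha hT] c c01.
pose k s := dstep ((s - a) / h + c) / h.
have ck : continuous k.
  move=> s; apply: cvgM; last exact: cvg_cst.
  apply: (@continuous_comp _ _ _ (fun s => (s - a) / h + c)); last exact: continuous_dstep.
  exact: continuous_affine.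
have dk (x : R) : is_derive x 1 (fun s => step ((s - a) / h + c)) (k x).
  apply: (@quadratic_is_derive _ _ _ _ (8 * h^-1 ^+ 2)) => y.
  rewrite (_ : (x + y - a) / h + c = ((x - a) / h + c) + y / h); last by ring.
  rewrite (_ : k x * y = dstep ((x - a) / h + c) * (y / h)); last by rewrite /k; ring.
  rewrite (_ : 8 * h^-1 ^+ 2 * y ^+ 2 = 8 * (y / h) ^+ 2); last by ring.
  exact: step_quad.
have T0 : 0 < T by exact: lt_trans a1.
have k1 : Int T k = 1.
  have := @Int_indic_itvoo _ T k _ 0 T (lexx 0) (ltW T0) (lexx T) ck dk.
  rewrite (@eq_Int _ _ _ k) => [->|s]; last by rewrite in_itv/= => ->; rewrite mul1r.
  case: c01 => ->; rewrite step_eq1 ?step_eq0 ?subr0//.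
  - by rewrite addr0 sub0r mulNr oppr_le0 divr_ge0// ltW.
  - by rewrite addr0 ler_pdivlMr// mul1r ltW.
  - by rewrite sub0r mulNr addrC subr_le0 ler_pdivlMr// mul1r ltW.
  - by rewrite lerDr divr_ge0 ?ltW// subr_gt0.
have Ifk : intg T (fun s => f s * k s) by apply: intg_continuous_mul.
have Ik : intg T k.
  apply: (@eq_intg _ _ (fun s => 1 * k s)) => [s _|]; first by rewrite mul1r.
  by apply: intg_continuous_mul => //; exact: intg_cst.
rewrite -[f a]mulr1 -k1 -IntZ// -IntB//; last exact: intgZ.
apply: (le_trans (le_norm_Int _)); first by apply: intgB => //; exact: intgZ.
apply: (@le_trans _ _ (Int T (fun s => 2 / h * ((`|s - a| < h)%R%:R * `|f s - f a|)))).
  apply: le_Int.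
  - by apply: intg_norm; apply: intgB => //; exact: intgZ.
  - exact/intgZ/intg_ball.
  move=> s _; rewrite -mulrBl normrM mulrC.
  have [sa|sa] := ltP `|s - a| h.
    rewrite mul1r ler_wpM2r// /k normrM normfV (gtr0_norm hp) ler_wpM2r ?invr_ge0 ?(ltW hp)//.
    exact: dstep_bound.
  rewrite mul0r mulr0 /k dstep_eq0 ?mul0r ?normr0 ?mul0r//.
  move: sa; rewrite ler_normr => /orP sa; case: c01 => ->; case: sa => sa.
  - by right; rewrite addr0 ler_pdivlMr// mul1r.
  - by left; rewrite addr0 ler_pdivrMr// mul0r; lra.
  - by right; rewrite lerDr divr_ge0 ?(ltW hp)//; lra.
  - by left; rewrite -lerBrDr sub0r ler_pdivrMr//; lra.
rewrite IntZ; last exact: intg_ball.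
apply: (@le_trans _ _ (2 / h * (e / 2 * h))).
  by rewrite ler_wpM2l ?divr_ge0 ?(ltW hp)//; exact: H.
by rewrite le_eqVlt; apply/orP; left; apply/eqP; field; rewrite gt_eqF.
Qed.

End Mollify.

(** The start value 1 covers the empty type, which occurs when the staircase has no jump. *)
Lemma fin_min_gt0 (R : realType) (I : finType) (f : I -> R) : (forall i, 0 < f i) ->
  exists2 e, 0 < e & forall i, e <= f i.
Proof.
move=> f0; exists (\big[Num.min/1]_i f i); first by apply: lt_bigmin.
by move=> i; apply: bigmin_le_cond.
Qed.

Lemma continuous_sum (R : realType) (U : topologicalType) (I : Type) (r : seq I) (f : I -> U -> R) :
  (forall i, continuous (f i)) -> continuous (fun s => \sum_(i <- r) f i s).
Proof.
move=> cf; elim: r => [|i r IH] s.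
  by rewrite (_ : (fun _ => _) = cst 0); [exact: cvg_cst|apply/funext => t; rewrite big_nil].
rewrite (_ : (fun _ => _) = fun t => f i t + \sum_(j <- r) f j t).
  by apply: cvgD; [exact: cf|exact: IH].
by apply/funext => t; rewrite big_cons.
Qed.

(** * Lower bounds for the total variation from pairs of Lebesgue points *)

Section TVLower.
Context {R : realType} {M : nat} (T : R).
Hypothesis T_gt0 : 0 < T.
Implicit Types (u v w phi : R -> 'cV[R]_M) (x : 'cV[R]_M).
Notation mu := (@lebesgue_measure R).

Definition lebesgue_vpt w (a : R) :=
  forall i, lebesgue_pt ((fun s => w s i 0) \_ `]0, T[) a.

Lemma ae_lebesgue_vpt w : inL1 T w -> {ae mu, forall s, lebesgue_vpt w s}.
Proof.
move=> Lw; rewrite /lebesgue_vpt.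
have : forall i : 'I_M, {ae mu, forall s, lebesgue_pt ((fun s => w s i 0) \_ `]0, T[) s}.
  by move=> i; apply: ae_lebesgue_pt; exact: Lw.
exact: (@filter_forall _ _ _ _ (ae_filter_ringOfSetsType mu)).
Qed.

Definition kernel (a h c s : R) := dstep ((s - a) / h + c) / h.

Lemma continuous_kernel a h c : continuous (kernel a h c).
Proof.
move=> s; apply: cvgM; last exact: cvg_cst.
apply: (@continuous_comp _ _ _ (fun s => (s - a) / h + c)); last exact: continuous_dstep.
exact: continuous_affine.
Qed.

Lemma intg_dotp_const w x : inL1 T w -> intg T (fun s => dotp (w s) x).
Proof.
move=> Lw; apply: (@eq_intg _ _ (fun s => \sum_i x i 0 * w s i 0)).
  by move=> s _; rewrite dotpE; apply: eq_bigr => i _; rewrite mulrC.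
by apply: intg_sum => i _; apply: intgZ; exact: Lw.
Qed.

Lemma mollify_vec w a : inL1 T w -> lebesgue_vpt w a -> a \in `]0, T[ ->
  forall e, 0 < e -> exists2 h0, 0 < h0 & forall h, 0 < h -> h < h0 ->
    forall c, c = 0 \/ c = 1 -> forall x, (forall i, `|x i 0| <= 1) ->
    `|Int T (fun s => dotp (w s) x * kernel a h c s) - dotp (w a) x| <= e.
Proof.
move=> Lw wa aT e e0; have e1 : 0 < e / M.+1%:R by rewrite divr_gt0.
have /choice[h0 H0] : forall i : 'I_M, exists h0, 0 < h0 /\ (forall h, 0 < h -> h < h0 ->
    forall c, c = 0 \/ c = 1 ->
    `|Int T (fun s => w s i 0 * kernel a h c s) - w a i 0| <= e / M.+1%:R).
  by move=> i; have [h0 ? ?] := mollify (Lw i) (wa i) aT e1; exists h0.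
have [h1 h10 H1] := fin_min_gt0 (fun i => (H0 i).1).
exists h1 => // h hp hh1 c c01 x x1.
have Ii i : intg T (fun s => w s i 0 * kernel a h c s).
  by apply: intg_continuous_mul => //; [exact: Lw|exact: continuous_kernel].
rewrite (@eq_Int _ _ _ (fun s => \sum_i x i 0 * (w s i 0 * kernel a h c s))); last first.
  by move=> s _; rewrite dotpE mulr_suml; apply: eq_bigr => i _; ring.
rewrite Int_sum => [|i _]; last exact: intgZ.
rewrite dotpE -sumrB (le_trans (ler_norm_sum _ _ _))//.
apply: (@le_trans _ _ (\sum_(i < M) e / M.+1%:R)).
  apply: ler_sum => i _; rewrite IntZ// mulrC -mulrBl normrM -[leRHS]mulr1.
  rewrite ler_pM//; have [_ H] := H0 i; apply: H => //.
  exact: lt_le_trans (H1 i).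
rewrite sumr_const card_ord -mulrnAr ler_piMr ?(ltW e0)//.
by rewrite -[_ *+ _]mulr_natl ler_pdivrMr// mul1r ler_nat.
Qed.

(** Rises from 0 to 1 on [a, a + h] and falls back on [b - h, b]. It vanishes outside (a, b), so
    bumps over non-overlapping intervals do not interact and their sum stays in the dual ball. *)
Definition bump (a b h s : R) := step ((s - a) / h + 0) - step ((s - b) / h + 1).

Lemma bump_eq0 a b h s : 0 < h -> 2 * h <= b - a -> s <= a \/ b <= s -> bump a b h s = 0.
Proof.
move=> h0 hab [sa|bs]; rewrite /bump.
  rewrite !step_eq0 ?subrr//.
    by rewrite -lerBrDr sub0r ler_pdivrMr//; lra.
  by rewrite addr0 ler_pdivrMr//; lra.
rewrite !step_eq1 ?subrr//.
  by rewrite lerDr divr_ge0 ?(ltW h0)//; lra.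
by rewrite addr0 ler_pdivlMr//; lra.
Qed.

Lemma bump_bound a b h s : 0 < h -> 2 * h <= b - a -> `|bump a b h s| <= 1.
Proof.
move=> h0 hab; rewrite /bump; have [sb|sb] := leP s (b - h).
  rewrite (@step_eq0 _ (_ + 1)) ?subr0 ?ger0_norm ?step_ge0 ?step_le1//.
  by rewrite -lerBrDr sub0r ler_pdivrMr//; lra.
rewrite (@step_eq1 _ (_ + 0)).
  by rewrite ger0_norm ?subr_ge0 ?step_le1// gerBl step_ge0.
by rewrite addr0 ler_pdivlMr//; lra.
Qed.

Lemma bump_quad a b h s y : 0 < h ->
  `|bump a b h (s + y) - bump a b h s - (kernel a h 0 s - kernel b h 1 s) * y|
    <= 16 * h^-1 ^+ 2 * y ^+ 2.
Proof.
move=> h0; rewrite /bump /kernel.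
have E c d : (s + y - c) / h + d = ((s - c) / h + d) + y / h by ring.
rewrite !E; have := step_quad ((s - a) / h + 0) (y / h).
have := step_quad ((s - b) / h + 1) (y / h).
rewrite !ler_norml (_ : 16 * h^-1 ^+ 2 * y ^+ 2 = 8 * (y / h) ^+ 2 + 8 * (y / h) ^+ 2); last by ring.
set A := step _; set B := step _; set A' := step _; set B' := step _.
set dA := dstep _; set dB := dstep _.
rewrite (_ : (dB / h - dA / h) * y = dB * (y / h) - dA * (y / h)); last by ring.
by move=> /andP[? ?] /andP[? ?]; apply/andP; split; lra.
Qed.

Definition dual_ball (p : \bar R) x := qnorm (hoelder_conjugate p) x <= 1.

Lemma TV_ge_pairs p (I : finType) (a b : I -> R) w : (1 <= p)%E -> inL1 T w ->
  (forall i, [/\ 0 < a i, a i < b i & b i < T]) ->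
  (forall i, lebesgue_vpt w (a i) /\ lebesgue_vpt w (b i)) ->
  (forall i j, i != j -> b i <= a j \/ b j <= a i) ->
  ((\sum_i suppf (dual_ball p) (w (a i) - w (b i)))%:E <= TV T p w)%E.
Proof.
(* Test with a sum of bumps, the [i]-th one going up near [a i], down near [b i]
   and pointing in a nearly optimal direction for [w (a i) - w (b i)]. *)
move=> p1 Lw abT wab disj; apply/lee_addgt0Pr => e e0.
have K_ball := qnorm_unit_ball p1 : unit_ball (@dual_ball p).
(* Three errors per index: the nearly optimal direction and the mollification at either end
   point. *)
pose e' := e / (3 * #|I|.+1%:R).
have e'0 : 0 < e' by rewrite divr_gt0// mulr_gt0.
have /choice[x Hx] : forall i, exists x, dual_ball p x /\
    suppf (dual_ball p) (w (a i) - w (b i)) - e' < dotp (w (a i) - w (b i)) x.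
  by move=> i; have [x ? ?] := suppf_adherent K_ball (w (a i) - w (b i)) e'0; exists x.
have abT' i : (a i \in `]0, T[) /\ (b i \in `]0, T[).
  by have [h1 h2 h3] := abT i; rewrite !in_itv/=; split; apply/andP; split; lra.
have /choice[ha Ha] : forall i, exists h0, 0 < h0 /\ forall h, 0 < h -> h < h0 ->
    forall c, c = 0 \/ c = 1 -> forall x, (forall i, `|x i 0| <= 1) ->
    `|Int T (fun s => dotp (w s) x * kernel (a i) h c s) - dotp (w (a i)) x| <= e'.
  by move=> i; have [h0 ? ?] := mollify_vec Lw (wab i).1 (abT' i).1 e'0; exists h0.
have /choice[hb Hb] : forall i, exists h0, 0 < h0 /\ forall h, 0 < h -> h < h0 ->
    forall c, c = 0 \/ c = 1 -> forall x, (forall i, `|x i 0| <= 1) ->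
    `|Int T (fun s => dotp (w s) x * kernel (b i) h c s) - dotp (w (b i)) x| <= e'.
  by move=> i; have [h0 ? ?] := mollify_vec Lw (wab i).2 (abT' i).2 e'0; exists h0.
have [h1 h10 Hmin] : exists2 h1, 0 < h1 &
    forall i, h1 <= Num.min (ha i) (Num.min (hb i) ((b i - a i) / 2)).
  apply: fin_min_gt0 => i; have [_ ? _] := abT i.
  by rewrite !lt_min (Ha i).1 (Hb i).1 divr_gt0// subr_gt0.
pose h : R := h1 / 2; have h0 : 0 < h by rewrite divr_gt0.
have hh1 : h < h1 by rewrite /h; lra.
have hlt i : [/\ h < ha i, h < hb i & 2 * h <= b i - a i].
  have := lt_le_trans hh1 (Hmin i); rewrite !lt_min => /and3P[-> -> ?].
  by split=> //; lra.
pose dphi (s : R) : 'cV[R]_M := \sum_i (kernel (a i) h 0 s - kernel (b i) h 1 s) *: x i.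
pose phi (s : R) : 'cV[R]_M := \sum_i bump (a i) (b i) h s *: x i.
have phi_der (s : R) j : is_derive s 1 (fun r : R => phi r j 0) (dphi s j 0).
  apply: (@quadratic_is_derive _ _ _ _ (\sum_i 16 * h^-1 ^+ 2 * `|x i j 0|)) => y.
  rewrite /phi /dphi !summxE mulr_suml -!sumrB (le_trans (ler_norm_sum _ _ _))//.
  rewrite mulr_suml ler_sum// => i _; rewrite !mxE.
  rewrite -mulrBl mulrAC -mulrBl normrM mulrAC ler_wpM2r//.
  exact: bump_quad.
have phi_d (s : R) : derivable phi s 1.
  by apply/derivable_mxP => i j; rewrite ord1; have [] := phi_der s i.
have dphi1 : derive1 phi = dphi.
  apply/funext => s; rewrite derive1E derive_mx//; apply/matrixP => i j.
  by rewrite ord1 mxE; have [_ ->] := phi_der s i.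
have dphi_c : continuous dphi.
  apply: continuous_mx => j s; rewrite /dphi.
  rewrite (_ : (fun r : R => _) =
      fun r : R => \sum_i (kernel (a i) h 0 r - kernel (b i) h 1 r) * x i j 0); last first.
    by apply/funext => r; rewrite summxE; apply: eq_bigr => i _; rewrite mxE.
  apply: continuous_sum => i r; apply: cvgM; last exact: cvg_cst.
  by apply: cvgB; exact: continuous_kernel.
have [m m0 Hm] : exists2 m, 0 < m & forall i, m <= Num.min (a i) (T - b i).
  by apply: fin_min_gt0 => i; have [? ? ?] := abT i; rewrite lt_min subr_gt0; apply/andP.
have phi_supp : closure [set s | phi s != 0] `<=` `[m, T - m].
  have cl : closed (`[m, T - m]%classic : set R) by exact: interval_closed.
  rewrite [X in _ `<=` X]((closure_id _).1 cl).
  apply: closure_subset => s /=; apply: contraR => sm.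
  apply/eqP; rewrite /phi big1// => i _; rewrite bump_eq0 ?scale0r//.
    by have [] := hlt i.
  have := Hm i; rewrite le_min => /andP[ma mb].
  move: sm; rewrite in_itv/= negb_and -!ltNge => /orP[]sm; [left|right]; lra.
have phiC : C1c T phi.
  split; [exact: phi_d|by rewrite dphi1| |].
    exact: (subclosed_compact (@closed_closure _ _) (@segment_compact _ m (T - m)) phi_supp).
  apply: (subset_trans phi_supp) => s /=; rewrite !in_itv/= => /andP[? ?].
  by apply/andP; split; lra.
have phi1 s : dual_ball p (phi s).
  have [[i si]|si] := pselect (exists i, a i < s < b i); last first.
    rewrite /phi big1 => [|i _]; first exact: (ball0 K_ball).
    rewrite bump_eq0 ?scale0r//; first by have [] := hlt i.
    have [sa|sa] := leP s (a i); [by left|right].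
    by rewrite leNgt; apply/negP => sb; apply: si; exists i; rewrite sa.
  rewrite /phi (bigD1 i)//= big1 ?addr0 => [|j ji].
    apply: (ball_balanced K_ball); last exact: (Hx i).1.
    by apply: bump_bound => //; have [] := hlt i.
  rewrite bump_eq0 ?scale0r//; first by have [] := hlt j.
  by move: si => /andP[s1 s2]; case: (disj _ _ ji) => ?; [right|left]; lra.
have le1 : ((Int T (fun s => dotp (w s) (derive1 phi s)))%:E <= TV T p w)%E.
  by apply: ereal_sup_ubound; exists phi => //; split=> // s _; exact: phi1.
rewrite -leeBlDr//; apply: le_trans le1; rewrite -EFinB lee_fin dphi1.
have Ik i c (y : R) : intg T (fun s => dotp (w s) (x i) * kernel y h c s).
  by apply: intg_continuous_mul => //; [exact: intg_dotp_const|exact: continuous_kernel].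
rewrite (@eq_Int _ _ _ (fun s => \sum_i (dotp (w s) (x i) * kernel (a i) h 0 s -
    dotp (w s) (x i) * kernel (b i) h 1 s))); last first.
  by move=> s _; rewrite dotp_sumr; apply: eq_bigr => i _; rewrite dotpZr; ring.
rewrite Int_sum => [|i _]; last exact: intgB.
apply: (@le_trans _ _ (\sum_i (suppf (dual_ball p) (w (a i) - w (b i)) - 3 * e'))).
  rewrite sumrB lerD2l lerN2 sumr_const /e'.
  rewrite (_ : 3 * (e / (3 * #|I|.+1%:R)) = e / #|I|.+1%:R); last by field; rewrite nat1r.
  by rewrite -mulrnAr ler_piMr ?(ltW e0)// -[_ *+ _]mulr_natl ler_pdivrMr// mul1r ler_nat.
apply: ler_sum => i _; rewrite IntB//.
have x1 k : `|x i k 0| <= 1 by apply: (ball_bounded K_ball); exact: (Hx i).1.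
have [hi1 hi2 _] := hlt i.
have := (Ha i).2 h h0 hi1 0 (or_introl erefl) (x i) x1.
have := (Hb i).2 h h0 hi2 1 (or_intror erefl) (x i) x1.
have := (Hx i).2; rewrite dotpBl !ler_norml => ? /andP[? ?] /andP[? ?]; lra.
Qed.

End TVLower.

(** * Second-order expansion of [F] *)

Section L1.
Context {R : realType} {M : nat} (T : R).
Notation fct := (R -> 'cV[R]_M).
Implicit Types (u v w h : fct) (L : fct -> R).

Lemma inL1D u v : inL1 T u -> inL1 T v -> inL1 T (u + v).
Proof.
move=> Lu Lv i; apply: (@eq_intg _ _ (fun s => u s i 0 + v s i 0)).
  by move=> s _; rewrite mxE.
by apply: intgD; [exact: Lu|exact: Lv].
Qed.

Lemma inL1Z k u : inL1 T u -> inL1 T (k *: u).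
Proof.
move=> Lu i; apply: (@eq_intg _ _ (fun s => k * u s i 0)).
  by move=> s _; rewrite mxE.
by apply: intgZ; exact: Lu.
Qed.

Lemma inL1B u v : inL1 T u -> inL1 T v -> inL1 T (u - v).
Proof. by move=> Lu Lv; rewrite -scaleN1r; apply: inL1D => //; exact: inL1Z. Qed.

Lemma inL10 : inL1 T (0 : fct).
Proof.
move=> i; apply: (@eq_intg _ _ (fun=> 0)); first by move=> s _; rewrite mxE.
exact: intg_cst.
Qed.

Lemma intg_norm1 u : inL1 T u -> intg T (fun s => \sum_i `|u s i 0|).
Proof. by move=> Lu; apply: intg_sum => i _; apply: intg_norm; exact: Lu. Qed.

Lemma normL1Z k u : inL1 T u -> normL1 T (k *: u) = `|k| * normL1 T u.
Proof.
move=> Lu; rewrite /normL1 -/(Int T _) -/(Int T _) -IntZ; last exact: intg_norm1.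
apply: eq_Int => s _; rewrite mulr_sumr; apply: eq_bigr => i _.
by rewrite mxE normrM.
Qed.

Lemma normL1_ge0 u : 0 <= normL1 T u.
Proof. by apply: Int_ge0 => s _; exact: sumr_ge0. Qed.

Lemma normL1_ae u v : inL1 T u -> inL1 T v -> eqL1 T u v -> normL1 T u = normL1 T v.
Proof.
move=> Lu Lv uv; apply: ae_eq_Int; [exact: intg_meas (intg_norm1 Lu)|exact: intg_meas (intg_norm1 Lv)|].
by apply: aeT_imp uv => s _ ->.
Qed.

Lemma linearL1_0 L : linearL1 T L -> L 0 = 0.
Proof.
move=> lin; have := lin 1 0 0 inL10 inL10; rewrite scale1r addr0 mul1r => /eqP.
by rewrite -subr_eq0 opprD addNKr oppr_eq0 => /eqP.
Qed.

Lemma linearL1_Z L k v : linearL1 T L -> inL1 T v -> L (k *: v) = k * L v.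
Proof.
move=> lin Lv; have := lin k v 0 Lv inL10.
by rewrite addr0 (linearL1_0 lin) addr0.
Qed.

Lemma linearL1_sum L (I : Type) (r : seq I) (v : I -> fct) : linearL1 T L ->
  (forall i, inL1 T (v i)) ->
  inL1 T (\sum_(i <- r) v i) /\ L (\sum_(i <- r) v i) = \sum_(i <- r) L (v i).
Proof.
move=> lin Lv; elim: r => [|i r [IH1 IH2]].
  by rewrite !big_nil; split; [exact: inL10|exact: linearL1_0].
rewrite !big_cons; split; first exact: inL1D.
by have := lin 1 (v i) _ (Lv i) IH1; rewrite scale1r mul1r IH2.
Qed.

Variables (F : fct -> R) (F' : fct -> fct -> R) (F'' : fct -> fct -> fct -> R).
Hypothesis F_twice : twice_frechet T F F' F''.

(** The mean value theorem is applied to the second-order remainder along the segment from [u] to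
    [u + h]. Its derivative is the first-order remainder of [F'] at [u] for the increment [s *: h],
    paired with [h]. *)
Lemma taylor2 u : inL1 T u -> forall e, 0 < e -> exists2 delta, 0 < delta &
  forall h, inL1 T h -> normL1 T h <= delta ->
    `|F (u + h) - F u - F' u h - 2^-1 * F'' u h h| <= e * normL1 T h ^+ 2.
Proof.
move=> Lu e e0; have [_ [Bdual Blin _ Bder]] := F_twice Lu.
have [d d0 H] := Bder e e0; exists d => // h Lh hd.
have [[F'lin _] _] := (F_twice Lu).1.
pose psi (s : R) := F (u + s *: h) - s * F' u h - s ^+ 2 / 2 * F'' u h h.
pose dpsi (s : R) := F' (u + s *: h) h - F' u h - s * F'' u h h.
have dpsiE (s : R) : is_derive s 1 psi (dpsi s).
  apply: little_o_is_derive => e1 e10.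
  have Lus : inL1 T (u + s *: h) by apply: inL1D => //; exact: inL1Z.
  have [[[lin _] fr] _] := F_twice Lus.
  (* Half of [e1] pays for the first-order remainder of [F], the other half for the quadratic term
     in [y]. *)
  have e2 : 0 < e1 / (2 * (normL1 T h + 1)).
    by rewrite divr_gt0// mulr_gt0// ltr_wpDl// normL1_ge0.
  have [r r0 Hr] := fr _ e2.
  have N1 : 0 < normL1 T h + 1 by rewrite ltr_wpDl// normL1_ge0.
  pose c := `|F'' u h h| + 1; have c0 : 0 < c by rewrite ltr_wpDl.
  exists (Num.min (r / (normL1 T h + 1)) (e1 / c)) => [|y]; first by rewrite lt_min !divr_gt0.
  rewrite le_min => /andP[]; rewrite ler_pdivlMr// ler_pdivlMr// => y1 y2.
  have yr : normL1 T (y *: h) <= r.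
    rewrite normL1Z//; apply: le_trans y1; rewrite ler_wpM2l//; lra.
  have := Hr _ (inL1Z y Lh) yr; rewrite (linearL1_Z y lin Lh) normL1Z//.
  rewrite /psi /dpsi scalerDl addrA => h1.
  set X := F (u + s *: h + y *: h) in h1 *; set Y := F (u + s *: h) in h1 *.
  set Z := F' (u + s *: h) h in h1 *; set W := F' u h; set B := F'' u h h in c c0 y2 *.
  rewrite (_ : _ - _ - _ = (X - Y - y * Z) - y ^+ 2 / 2 * B); last by field.
  apply: le_trans (ler_normB _ _) _.
  have -> : e1 * `|y| = e1 * `|y| / 2 + e1 * `|y| / 2 by field.
  apply: lerD.
    apply: le_trans h1 _.
    apply: (@le_trans _ _ (e1 / (2 * (normL1 T h + 1)) * (`|y| * (normL1 T h + 1)))).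
      by rewrite ler_wpM2l ?(ltW e2)// ler_wpM2l// lerDl.
    by rewrite le_eqVlt; apply/orP; left; apply/eqP; field; rewrite gt_eqF.
  rewrite 2!normrM normfV normrX expr2 (_ : `|2| = 2 :> R); last by rewrite ger0_norm.
  rewrite (_ : `|y| * `|y| / 2 * `|B| = `|y| / 2 * (`|y| * `|B|)); last by ring.
  rewrite (_ : e1 * `|y| / 2 = `|y| / 2 * e1); last by ring.
  rewrite ler_wpM2l ?divr_ge0//; apply: le_trans y2.
  by rewrite ler_wpM2l// /c lerDl.
have cpsi : {within `[0, 1], continuous psi}.
  apply: continuous_subspaceT => s; apply/differentiable_continuous/derivable1_diffP.
  by have [] := dpsiE s.
have [c] := @MVT R psi dpsi 0 1 ltr01 (fun s _ => dpsiE s) cpsi.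
rewrite in_itv/= subr0 mulr1 => /andP[c0 c1].
rewrite /psi scale1r scale0r addr0 !mul1r mul0r subr0 expr1n expr0n/= !mul0r subr0 => E.
have -> : F (u + h) - F u - F' u h - 2^-1 * F'' u h h = dpsi c by rewrite -E; ring.
have cd : normL1 T (c *: h) <= d.
  by rewrite normL1Z// gtr0_norm// (le_trans _ hd)// ler_piMl ?normL1_ge0// ltW.
have := H _ (inL1Z c Lh) cd h Lh.
rewrite (linearL1_Z c (Blin h Lh) Lh) => /le_trans; apply.
rewrite normL1Z// gtr0_norm// expr2 !mulrA ler_wpM2r ?normL1_ge0// ler_wpM2r ?normL1_ge0//.
by rewrite ler_piMr// ltW.
Qed.

End L1.

Section KernelEstimate.
Context {R : realType} (T : R).
Hypothesis T_gt0 : 0 < T.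
Notation mu := (@lebesgue_measure R).
Local Notation D := (`]0, T[%classic : set (measurableTypeR R)).

(* [clamp] retracts [R] onto [[0, T]] and so turns continuity within [[0, T]]
   into continuity on [R]. *)
Definition clamp (x : R) := Num.max 0 (Num.min x T).

Lemma clamp_itv x : clamp x \in `[0, T].
Proof. by rewrite /clamp in_itv/= le_max lexx/= ge_max (ltW T_gt0)/= ge_min lexx orbT. Qed.

Lemma clamp_id x : x \in `]0, T[ -> clamp x = x.
Proof.
rewrite in_itv/= => /andP[x0 xT].
by rewrite /clamp min_l ?max_r// ltW.
Qed.

Lemma continuous_clamp : continuous clamp.
Proof.
move=> x; apply: (@continuous_max _ _ (cst (0 : R^o)) (fun x : R => Num.min x T : R^o)).
  exact: cst_continuous.
apply: (@continuous_min _ _ (fun x : R => x : R^o) (cst (T : R^o))).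
  exact: cvg_id.
exact: cst_continuous.
Qed.

Lemma continuous_comp_clamp (U : topologicalType) (f : R -> U) :
  {within `[0, T], continuous f} -> continuous (f \o clamp).
Proof.
move=> cf x; have cx : clamp x \in `[0, T]%classic by rewrite inE; exact: clamp_itv.
move/subspace_continuousP : cf => /(_ (clamp x) (clamp_itv x)) H.
move=> W /H /(continuous_clamp); rewrite /nbhs/= /fmap/=; apply: (@filterS _ (nbhs x)) => y /=.
exact: (fun h => h (clamp_itv y)).
Qed.

Lemma intg_within_mul (f k : R -> R) : intg T f -> {within `[0, T], continuous k} ->
  intg T (fun s => f s * k s).
Proof.
move=> If /continuous_comp_clamp ck; apply: (@eq_intg _ _ (fun s => f s * (k \o clamp) s)).
  by move=> s sT /=; rewrite clamp_id.
exact: intg_continuous_mul.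
Qed.

Variable K : R -> R -> R.
Hypothesis cK : {within `[0, T] `*` `[0, T], continuous (fun x : R * R => K x.1 x.2)}.

Let Kc r s := K (clamp r) (clamp s).

Let continuous_Kc : continuous (fun x : R * R => Kc x.1 x.2).
Proof.
move=> x; pose A : set (R * R) := `[0, T] `*` `[0, T].
pose c (y : R * R) := (clamp y.1, clamp y.2).
have Ac y : A (c y) by split; exact: clamp_itv.
have h1 : clamp y.1 @[y --> x] --> clamp x.1.
  by apply: continuous_cvg; [exact: continuous_clamp|exact: cvg_fst].
have h2 : clamp y.2 @[y --> x] --> clamp x.2.
  by apply: continuous_cvg; [exact: continuous_clamp|exact: cvg_snd].
have cc : c @ x --> c x := cvg_pair h1 h2.
move/subspace_continuousP : cK => /(_ (c x) (Ac x)) H.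
move=> W /H /cc; rewrite /nbhs/= /fmap/=; apply: filterS => y /=.
exact: (fun h => h (Ac y)).
Qed.

Let continuous_Kc2 (f k : R -> R) : continuous f -> continuous k ->
  continuous (fun x => Kc (f x) (k x)).
Proof.
move=> cf ck x; apply: (@continuous2_cvg R R R R (nbhs x) _ f k Kc); [|exact: cf|exact: ck].
exact: (@continuous_Kc (f x, k x)).
Qed.

Let Kc_bounded : exists C, forall r s, `|Kc r s| <= C.
Proof.
have cA : compact (`[0, T]%classic `*` `[0, T]%classic : set (R * R)).
  by apply: compact_setX; exact: segment_compact.
have /compact_bounded[C [_ HC]] := continuous_compact cK cA.
exists (C + 1) => r s; apply: (HC (C + 1)); first by rewrite ltrDl.
exists (clamp r, clamp s) => //.
by split; exact: clamp_itv.
Qed.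

Lemma Int_kernelZ f (s c : R) : intg T f -> s \in `]0, T[ ->
  Int T (fun x => f x * K x s * c) = Int T (fun x => f x * K x s) * c.
Proof.
move=> If sT; rewrite mulrC -IntZ; first by apply: eq_Int => x _; rewrite mulrC.
apply: (@eq_intg _ _ (fun x => f x * Kc x s)); first by move=> x xT; rewrite /Kc !clamp_id.
by apply: intg_continuous_mul => //; apply: continuous_Kc2 => x; [exact: cvg_id|exact: cvg_cst].
Qed.

(** By continuity [K] is within [e] of [K t1 t2] where [f] and [k] both live, so freezing it there
    costs [e] times the product of their L1 norms. *)
Lemma kernel_estimate (t1 t2 : R) : t1 \in `]0, T[ -> t2 \in `]0, T[ ->
  forall e, 0 < e -> exists2 r, 0 < r & forall f k : R -> R, intg T f -> intg T k ->
    (forall s, r < `|s - t1| -> f s = 0) -> (forall s, r < `|s - t2| -> k s = 0) ->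
    `|Int T (fun s => Int T (fun x => f x * K x s) * k s) - K t1 t2 * Int T f * Int T k|
      <= e * Int T (fun s => `|f s|) * Int T (fun s => `|k s|).
Proof.
move=> t1T t2T e e0; have [C HC] := Kc_bounded.
have /cvgrPdist_le /(_ e e0) [[A B]/= [nA nB] AB] := @continuous_Kc (t1, t2).
move: nA nB => [ra /= ra0 Hra] [rb /= rb0 Hrb].
exists (Num.min ra rb / 2) => [|f k If Ik f0 k0]; first by rewrite divr_gt0// lt_min ra0.
set r := _ / 2 in f0 k0.
have r0 : 0 < r by rewrite divr_gt0// lt_min ra0.
have rab : (r < ra) /\ (r < rb).
  have : r < Num.min ra rb by rewrite /r ltr_pdivrMr// ltr_pMr ?ltr1n// lt_min ra0.
  by rewrite lt_min => /andP.
have Kcm1 s : measurable_fun D (fun x => Kc x s : R).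
  by apply: meas_continuous; apply: continuous_Kc2 => x; [exact: cvg_id|exact: cvg_cst].
pose Phi s := Int T (fun x => f x * Kc x s).
have IK s : intg T (fun x => f x * Kc x s) by apply: (intgM (C := C)).
(* Measurability of the inner integral is obtained from its continuity, by domination with a
   multiple of [|f|]. *)
have mPhi : measurable_fun D (Phi : measurableTypeR R -> R).
  apply: open_continuous_measurable_fun; first exact: interval_open.
  apply: (@continuity_under_integral R _ _ mu (fun s x => f x * Kc x s) D (@measD R T) 0 T _ _
    (fun x => C * `|f x|)).
  - by move=> s _; exact: IK.
  - apply: aeW => x _ s _; apply: cvgM; first exact: cvg_cst.
    by apply: (@continuous_Kc2 (cst x) id) => y; [exact: cvg_cst|exact: cvg_id].
  - exact/intgZ/intg_norm.
  - by move=> s _; apply: aeW => x _; rewrite normrM mulrC ler_wpM2r.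
have Phi_bound s : `|Phi s| <= C * Int T (fun x => `|f x|).
  apply: (le_trans (le_norm_Int (IK s))); rewrite -IntZ; last exact: intg_norm.
  apply: le_Int; [exact: intg_norm|exact/intgZ/intg_norm|].
  by move=> x _; rewrite normrM mulrC ler_wpM2r.
have IPhi : intg T (fun s => Phi s * k s).
  rewrite (_ : (fun s => _) = fun s => k s * Phi s); last by apply/funext => s; rewrite mulrC.
  exact: (intgM (C := C * Int T (fun x => `|f x|))).
rewrite (@eq_Int _ _ _ (fun s => Phi s * k s)); last first.
  move=> s sT; congr (_ * _); apply: eq_Int => x xT.
  by rewrite /Kc !clamp_id.
have KE : K t1 t2 = Kc t1 t2 by rewrite /Kc !clamp_id.
rewrite KE -IntZ// -IntB//; last exact: intgZ.
set M := Int T (fun s => `|f s|).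
apply: (le_trans (le_norm_Int _)); first by apply: intgB => //; exact: intgZ.
rewrite -[leRHS]IntZ; last exact: intg_norm.
apply: le_Int.
- by apply: intg_norm; apply: intgB => //; exact: intgZ.
- exact/intgZ/intg_norm.
move=> s sT; rewrite -mulrBl normrM.
have [st|st] := leP `|s - t2| r; last by rewrite k0// normr0 !mulr0.
rewrite ler_wpM2r// /Phi -IntZ// -IntB//; last exact: intgZ.
apply: (le_trans (le_norm_Int _)); first by apply: intgB => //; exact: intgZ.
rewrite /M -[leRHS]IntZ; last exact: intg_norm.
apply: le_Int.
- by apply: intg_norm; apply: intgB => //; exact: intgZ.
- exact/intgZ/intg_norm.
move=> x xT; rewrite [Kc t1 t2 * _]mulrC -mulrBr normrM mulrC.
have [xt|xt] := leP `|x - t1| r; last by rewrite f0// normr0 !mulr0.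
rewrite ler_wpM2r//; rewrite distrC.
apply: (AB (x, s)); split => /=.
  by apply: Hra => /=; rewrite distrC (le_lt_trans xt)// rab.1.
by apply: Hrb => /=; rewrite distrC (le_lt_trans st)// rab.2.
Qed.

End KernelEstimate.

Lemma continuous_scaled_coord (R : realType) (m n : nat) (c : R) i j :
  continuous (fun A : 'M[R]_(m, n) => c * A i j).
Proof.
move=> A; apply: (@continuous_comp _ _ _ (fun A : 'M[R]_(m, n) => A i j) ( *%R c)).
  exact: coord_continuous.
exact: mulrl_continuous.
Qed.

Section Expansion.
Context {R : realType} {M : nat} (T : R).
Hypothesis T_gt0 : 0 < T.
Notation fct := (R -> 'cV[R]_M).
Variables (F : fct -> R) (F' : fct -> fct -> R) (F'' : fct -> fct -> fct -> R).
Variables (u : fct) (g : fct) (H : R -> R -> 'M[R]_M).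
Hypothesis F_twice : twice_frechet T F F' F''.
Hypothesis Lu : inL1 T u.
Hypothesis g_gradient : is_gradient T (F' u) g.
Hypothesis g_cont : {within `[0, T], continuous g}.
Hypothesis H_hessian : is_hessian T (F'' u) H.
Hypothesis H_cont :
  {within `[0, T] `*` `[0, T], continuous (fun x : R * R => H x.1 x.2)}.
Variables (J : finType) (tt : J -> R) (nu : J -> 'cV[R]_M).
Hypothesis ttT : forall j, tt j \in `]0, T[.

Definition comb (th : J -> R -> R) : fct := fun s => \sum_j th j s *: nu j.

Lemma inL1_scaled (f : R -> R) (x : 'cV[R]_M) : intg T f -> inL1 T (fun s => f s *: x).
Proof.
move=> If i; apply: (@eq_intg _ _ (fun s => x i 0 * f s)).
  by move=> s _; rewrite mxE mulrC.
exact: intgZ.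
Qed.

Lemma comb_sum th : comb th = \sum_j (fun s => th j s *: nu j).
Proof. by apply/funext => s; rewrite fct_sumE. Qed.

Lemma inL1_comb th : (forall j, intg T (th j)) -> inL1 T (comb th).
Proof.
move=> Ith i; apply: (@eq_intg _ _ (fun s => \sum_j nu j i 0 * th j s)).
  by move=> s _; rewrite summxE; apply: eq_bigr => j _; rewrite mxE mulrC.
by apply: intg_sum => j _; exact: intgZ.
Qed.

Definition mass (th : J -> R -> R) := \sum_j Int T (fun s => `|th j s|).

Lemma mass_ge0 th : 0 <= mass th.
Proof. by apply: sumr_ge0 => j _; exact: Int_ge0. Qed.

Lemma normL1_comb : exists2 C, 0 < C & forall th, (forall j, intg T (th j)) ->
  normL1 T (comb th) <= C * mass th.
Proof.
pose C := \sum_j \sum_i `|nu j i 0|.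
have C0 : 0 <= C by apply: sumr_ge0 => j _; exact: sumr_ge0.
exists (C + 1) => [|th Ith]; first by rewrite ltr_wpDl.
have IJ : intg T (fun s => \sum_j `|th j s|) by apply: intg_sum => j _; exact: intg_norm.
rewrite /mass -Int_sum => [|j _]; last exact: intg_norm.
rewrite -IntZ//; apply: le_Int; [exact/intg_norm1/inL1_comb|exact: intgZ|].
move=> s _; apply: (@le_trans _ _ (C * \sum_j `|th j s|)); last first.
  by rewrite ler_wpM2r ?lerDl// sumr_ge0.
apply: (@le_trans _ _ (\sum_i \sum_j `|th j s| * `|nu j i 0|)).
  apply: ler_sum => i _; rewrite summxE; apply: le_trans (ler_norm_sum _ _ _) _.
  by apply: ler_sum => j _; rewrite mxE normrM.
rewrite exchange_big/= mulr_sumr; apply: ler_sum => j _.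
rewrite -mulr_sumr mulrC ler_wpM2r// /C (bigD1 j)//= lerDl.
by apply: sumr_ge0 => k _; exact: sumr_ge0.
Qed.

Lemma within_dotp x : {within `[0, T], continuous (fun s => dotp x (g s))}.
Proof.
rewrite (_ : (fun s => _) = (fun y : 'cV[R]_M => dotp x y) \o g)//.
move=> s; apply: (@continuous_comp (subspace `[0, T]%classic) _ _ g); first exact: g_cont.
rewrite (_ : (fun y => _) = fun y : 'cV[R]_M => \sum_i x i 0 * y i 0); last first.
  by apply/funext => y; rewrite dotpE.
by apply: continuous_sum => i; exact: continuous_scaled_coord.
Qed.

Lemma gradient_comb th : (forall j, intg T (th j)) ->
  F' u (comb th) = \sum_j Int T (fun s => th j s * dotp (nu j) (g s)).
Proof.
move=> Ith; rewrite g_gradient; last exact: inL1_comb.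
rewrite -Int_sum => [|j _]; last by apply: intg_within_mul => //; exact: within_dotp.
apply: eq_Int => s _; rewrite dotp_sumr; apply: eq_bigr => j _.
by rewrite dotpZr dotpC.
Qed.

Definition hess j k (r s : R) := dotp (nu j) (H r s *m nu k).

Lemma hess_cont j k :
  {within `[0, T] `*` `[0, T], continuous (fun x : R * R => hess j k x.1 x.2)}.
Proof.
rewrite (_ : (fun x => _) = (fun A : 'M[R]_M => dotp (nu j) (A *m nu k)) \o
  (fun x : R * R => H x.1 x.2))//.
move=> s; apply: (@continuous_comp (subspace (`[0, T]%classic `*` `[0, T]%classic)) _ _
  (fun x : R * R => H x.1 x.2)); first exact: H_cont.
rewrite (_ : (fun y => _) = fun A : 'M[R]_M => \sum_i \sum_l nu j i 0 * nu k l 0 * A i l); last first.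
  apply/funext => A; rewrite dotpE; apply: eq_bigr => i _; rewrite mxE mulr_sumr.
  by apply: eq_bigr => l _; ring.
by apply: continuous_sum => i; apply: continuous_sum => l; exact: continuous_scaled_coord.
Qed.

Lemma hessian_comb th : (forall j, intg T (th j)) ->
  F'' u (comb th) (comb th) =
  \sum_j \sum_k Int T (fun s => Int T (fun r => th j r * hess j k r s) * th k s).
Proof.
move=> Ith; have [_ [Bdual Blin _ _]] := F_twice Lu.
have Ls j : inL1 T (fun s => th j s *: nu j) by exact: inL1_scaled.
have Lc := inL1_comb Ith.
rewrite {1}comb_sum; have [_ /= ->] := linearL1_sum (index_enum J) (Blin _ Lc) Ls.
apply: eq_bigr => j _; have [lin _] := Bdual _ (Ls j).
rewrite comb_sum; have [_ /= ->] := linearL1_sum (index_enum J) lin Ls.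
apply: eq_bigr => k _; rewrite H_hessian//; apply: eq_Int => s sT.
rewrite -(Int_kernelZ T_gt0 (hess_cont (j := j) (k := k)))//.
by apply: eq_Int => r _; rewrite /hess dotpZl -scalemxAr dotpZr; ring.
Qed.

Lemma expansion e : 0 < e -> exists2 r, 0 < r & forall th : J -> R -> R,
  (forall j, intg T (th j)) -> (forall j s, r < `|s - tt j| -> th j s = 0) ->
  mass th <= r ->
  `|F (u + comb th) - F u - \sum_j Int T (fun s => th j s * dotp (nu j) (g s))
    - 2^-1 * \sum_j \sum_k hess j k (tt j) (tt k) * Int T (th j) * Int T (th k)|
  <= e * mass th ^+ 2.
Proof.
move=> e0; have [C C0 HC] := normL1_comb.
(* With [C] bounding the norm by the mass, the Taylor remainder uses up half of [e]. The other half
   goes to freezing the Hessian, whose error carries the factor 1/2. *)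
have e1 : 0 < e / (2 * C ^+ 2) by rewrite divr_gt0// mulr_gt0// exprn_gt0.
have [d d0 Hd] := taylor2 F_twice Lu e1.
have /choice[rk Hrk] : forall jk : J * J, exists r, 0 < r /\
    forall f k : R -> R, intg T f -> intg T k ->
    (forall s, r < `|s - tt jk.1| -> f s = 0) -> (forall s, r < `|s - tt jk.2| -> k s = 0) ->
    `|Int T (fun s => Int T (fun x => f x * hess jk.1 jk.2 x s) * k s)
      - hess jk.1 jk.2 (tt jk.1) (tt jk.2) * Int T f * Int T k|
      <= e * Int T (fun s => `|f s|) * Int T (fun s => `|k s|).
  move=> [j k] /=.
  by have [r ? ?] := kernel_estimate T_gt0 (hess_cont (j := j) (k := k)) (ttT j) (ttT k) e0; exists r.
have [r0 r00 Hr0] := fin_min_gt0 (fun jk => (Hrk jk).1).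
exists (Num.min r0 (d / C)) => [|th Ith th0]; first by rewrite lt_min r00 divr_gt0.
rewrite le_min => /andP[m1]; rewrite ler_pdivlMr// => m2.
have nd : normL1 T (comb th) <= d by apply: (le_trans (HC _ Ith)); rewrite mulrC.
have := Hd _ (inL1_comb Ith) nd; rewrite gradient_comb// hessian_comb//.
set B := \sum_j \sum_k Int T _; set B' := \sum_j \sum_k hess _ _ _ _ * _ * _ => h1.
have h2 : `|B - B'| <= e * mass th ^+ 2.
  rewrite /B /B' -sumrB; apply: le_trans (ler_norm_sum _ _ _) _.
  rewrite expr2 mulrA mulr_sumr ler_sum// => j _; rewrite -sumrB.
  apply: le_trans (ler_norm_sum _ _ _) _; rewrite (_ : e * mass th * _ = e * Int T (fun s => `|th j s|) * mass th); last by ring.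
  rewrite /mass mulr_sumr ler_sum// => k _; have [_ Hjk] := Hrk (j, k).
  have rr : Num.min r0 (d / C) <= rk (j, k) by rewrite ge_min Hr0.
  by apply: Hjk => //= s rs; apply: th0; exact: le_lt_trans rr rs.
have h3 : e / (2 * C ^+ 2) * normL1 T (comb th) ^+ 2 <= e / 2 * mass th ^+ 2.
  rewrite (_ : e / 2 * _ = e / (2 * C ^+ 2) * (C * mass th) ^+ 2); last first.
    by field; rewrite gt_eqF.
  rewrite ler_wpM2l ?(ltW e1)// lerXn2r ?nnegrE ?normL1_ge0 ?mulr_ge0 ?mass_ge0 ?(ltW C0)//.
  exact: HC.
move: h1 h2 => /le_trans /(_ h3); rewrite !ler_norml => /andP[? ?] /andP[? ?].
by apply/andP; split; lra.
Qed.

End Expansion.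

(** * Admissible functions near a staircase *)

Section Staircase.
Context {R : realType} {M : nat}.
Variables (T : R) (n : nat) (a : nat -> 'cV[int]_M) (t : nat -> R).
Hypotheses (n_gt0 : (0 < n)%N) (t0 : t 0%N = 0) (tn : t n = T)
  (t_lt : forall j, (j < n)%N -> t j < t j.+1).

Local Notation J := 'I_n.-1.
Definition jpoint (j : J) : R := t j.+1.
Definition jheight (j : J) : 'cV[R]_M := jump a j.+1.
Definition step_stair : R -> 'cV[R]_M := stair (toR (a n)) jpoint jheight.

Lemma jpoint_lt (j : J) : (j.+1 < n)%N.
Proof. by case: n n_gt0 j => // n' _ j; rewrite ltnS. Qed.

Lemma t_ltn i k : (i < k)%N -> (k <= n)%N -> t i < t k.
Proof.
elim: k => // k IH; rewrite ltnS leq_eqVlt => /predU1P[->|ik] kn; first exact: t_lt.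
by apply: lt_trans (t_lt kn); apply: IH => //; exact: ltnW.
Qed.

Lemma t_leq i k : (i <= k)%N -> (k <= n)%N -> t i <= t k.
Proof.
by rewrite leq_eqVlt => /predU1P[->//|ik] kn; apply: ltW; exact: t_ltn.
Qed.

Lemma jpoint_itv j : jpoint j \in `]0, T[.
Proof.
have jn := jpoint_lt j; rewrite in_itv/= -t0 -tn /jpoint.
by rewrite !t_ltn//; exact: ltnW.
Qed.

Lemma piece_exists s : s \in `]0, T[ ->
  exists2 i, (1 <= i <= n)%N & t i.-1 <= s < t i.
Proof.
rewrite in_itv/= => /andP[s0 sT].
have ex : exists i, s < t i by exists n; rewrite tn.
case: (ex_minnP ex) => -[|i] si min.
  by move: si; rewrite t0 ltNge (ltW s0).
exists i.+1; first by rewrite /= min// tn.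
by rewrite si andbT leNgt; apply/negP => /min; rewrite ltnn.
Qed.

(** The jumps to the right of [s] telescope from [a n] back to [a i]. The two implications extend
    the first and the last piece to infinity, where the staircase has no further jump. *)
Lemma stair_val i s : (1 <= i <= n)%N -> (i != 1)%N ==> (t i.-1 <= s) ->
  (i != n) ==> (s < t i) -> step_stair s = toR (a i).
Proof.
move=> /andP[i1 iN] hi1 hi2; rewrite /step_stair /stair.
have jE (j : J) : (s < jpoint j) = (i <= j.+1)%N.
  have jn := jpoint_lt j; rewrite /jpoint; case: (leqP i j.+1) => ij.
    apply: lt_le_trans (t_leq ij (ltnW jn)).
    by apply: (implyP hi2); rewrite neq_ltn (leq_ltn_trans ij).
  apply/negbTE; rewrite -leNgt; apply: (@le_trans _ _ (t i.-1)).
    by apply: t_leq; [rewrite -ltnS prednK|rewrite (leq_trans (leq_pred _))].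
  by apply: (implyP hi1); rewrite neq_ltn (leq_ltn_trans _ ij) ?orbT.
under eq_bigr => j _ do rewrite jE.
rewrite -(big_mkord xpredT (fun j => (i <= j.+1)%N%:R *: jump a j.+1)).
rewrite (@big_cat_nat _ _ _ i.-1)//=; last by rewrite -ltnS !prednK.
rewrite big_nat big1 ?add0r => [|j /andP[_ ji]]; last first.
  by rewrite leqNgt (leq_trans _ (_ : i.-1.+1 <= i)%N) ?scale0r// prednK.
rewrite (@eq_big_nat _ _ _ _ _ _ (fun j => - (toR (a j.+2) - toR (a j.+1)))); last first.
  move=> j /andP[ij _]; rewrite -[i]prednK// ltnS ij scale1r opprB//.
rewrite sumrN telescope_sumr ?prednK//; last by rewrite -ltnS !prednK.
by rewrite opprB addrC subrK.
Qed.

Lemma step_fun_val i s : s \in `]0, T[ -> (1 <= i <= n)%N -> t i.-1 <= s < t i ->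
  step_fun n a t s = toR (a i).
Proof.
rewrite in_itv/= => /andP[s0 _] /andP[i1 iN] /andP[s1 s2]; rewrite /step_fun.
have jE j : (2 <= j < n.+1)%N -> \1_(`[t j.-1, t j[) s = ((j == i)%:R : R).
  move=> /andP[j2 jn]; rewrite indicE mem_setE in_itv/=.
  have j0 : (0 < j)%N by exact: leq_trans j2.
  congr (nat_of_bool _)%:R; case: (ltngtP j i) => ji.
  - have h : t j <= s.
      apply: le_trans s1; apply: t_leq; first by rewrite -ltnS prednK.
      by rewrite (leq_trans (leq_pred _)).
    by rewrite [s < _]ltNge h andbF.
  - have h : s < t j.-1.
      apply: (lt_le_trans s2); apply: t_leq; first by rewrite -ltnS prednK.
      by rewrite (leq_trans (leq_pred _)).
    by rewrite leNgt h.
  - by rewrite ji s1 s2.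
rewrite big_nat_cond (eq_bigr (fun j => (j == i)%:R *: toR (a j))); last first.
  by move=> j /andP[h _]; rewrite jE.
rewrite -big_nat_cond indicE mem_setE in_itv/= t0 s0/=.
have [i1'|i1'] := eqVneq i 1%N.
  rewrite i1' in s2 *; rewrite s2 scale1r big_nat big1 ?addr0// => j /andP[j2 _].
  by rewrite gtn_eqF// scale0r.
have i2 : (2 <= i)%N by rewrite ltn_neqAle eq_sym i1'.
have -> : (s < t 1%N) = false.
  apply/negbTE; rewrite -leNgt (le_trans _ s1)//; apply: t_leq.
    by rewrite -ltnS prednK.
  by rewrite (leq_trans (leq_pred _)).
rewrite scale0r add0r.
rewrite (bigD1_seq i) ?iota_uniq ?mem_index_iota ?i2 ?ltnS ?iN//= eqxx scale1r big1 ?addr0//.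
by move=> j /negbTE ->; rewrite scale0r.
Qed.

Lemma step_funE s : s \in `]0, T[ -> step_fun n a t s = step_stair s.
Proof.
move=> sT; have [i iN /andP[s1 s2]] := piece_exists sT.
rewrite (step_fun_val sT iN) ?s1//; symmetry; apply: stair_val => //; exact/implyP.
Qed.

(** The factor 4 keeps the windows of radius [2 * d] about the jumps, which will contain the base
    points, from overlapping. *)
Lemma gap_exists : exists2 d : R, 0 < d & forall j, (j < n)%N -> t j + 4 * d <= t j.+1.
Proof.
have [d d0 H] : exists2 d, 0 < d & forall j : 'I_n, d <= (t j.+1 - t j) / 4.
  by apply: fin_min_gt0 => j; rewrite divr_gt0// subr_gt0 t_lt.
exists d => // j jn; have := H (Ordinal jn); rewrite /= ler_pdivlMr// lerBrDl.
by rewrite [d * _]mulrC.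
Qed.

Variable d : R.
Hypotheses (d_gt0 : 0 < d) (t_gap : forall j, (j < n)%N -> t j + 4 * d <= t j.+1).

Lemma t_sep i k : (i < k)%N -> (k <= n)%N -> t i + 4 * d <= t k.
Proof.
move=> ik kn; apply: le_trans (t_leq ik kn).
by apply: t_gap; exact: leq_trans kn.
Qed.

Lemma jpoint_sep (j k : J) : j != k ->
  jpoint j + 4 * d <= jpoint k \/ jpoint k + 4 * d <= jpoint j.
Proof.
have jn := jpoint_lt j; have kn := jpoint_lt k.
by rewrite neq_ltn => /orP[jk|jk]; [left|right]; apply: t_sep; rewrite ?ltnS// ltnW.
Qed.

Lemma jpoint_bounds (j : J) : 4 * d <= jpoint j /\ jpoint j + 4 * d <= T.
Proof.
have jn := jpoint_lt j; split; last by rewrite -tn; exact: t_sep.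
by rewrite -[leLHS]add0r -t0; apply: t_sep => //; exact: ltnW.
Qed.

Lemma stair_left (j : J) s : jpoint j - 4 * d <= s < jpoint j ->
  step_stair s = toR (a j.+1).
Proof.
have jn := jpoint_lt j; move=> /andP[s1 s2].
apply: stair_val; first exact: ltnW.
  apply/implyP => _ /=; apply: le_trans s1; rewrite lerBrDr.
  exact: t_gap (ltnW jn).
by apply/implyP.
Qed.

Lemma stair_right (j : J) s : jpoint j <= s < jpoint j + 4 * d ->
  step_stair s = toR (a j.+2).
Proof.
have jn := jpoint_lt j; move=> /andP[s1 s2].
apply: stair_val; [by []|by apply/implyP|apply/implyP => j2].
apply: (lt_le_trans s2); apply: t_gap.
exact: jn.
Qed.

End Staircase.

Section UadStair.
Context {R : realType} {M : nat} (T : R).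
Hypothesis T_gt0 : 0 < T.

Lemma inBV_stair (I : finType) (c : 'cV[R]_M) tau (nu : I -> 'cV[R]_M) :
  (forall k, tau k \in `]0, T[) -> inBV T (stair c tau nu).
Proof.
move=> tauT; split=> [|i]; first exact: inL1_stair.
have -> : component (stair c tau nu) i =
    stair (const_mx (c i 0)) tau (fun k => const_mx (nu k i 0)).
  apply/funext => s; apply/matrixP => k l; rewrite /component /stair !mxE !summxE.
  by congr (_ + _); apply: eq_bigr => m _; rewrite !mxE.
by apply: (le_lt_trans (@TV_stair_le _ _ T T_gt0 1%E _ _ _ _ (lexx _) tauT)); exact: ltry.
Qed.

Lemma Uad_stair (V : {fset 'cV[int]_M}) (I : finType) (c : 'cV[R]_M) tau (nu : I -> 'cV[R]_M) :
  (forall k, tau k \in `]0, T[) ->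
  (forall s, s \in `]0, T[ -> setV V (stair c tau nu s)) -> Uad T V (stair c tau nu).
Proof. by move=> tauT VT; split; [exact: inBV_stair|exact: aeTW]. Qed.

End UadStair.

Lemma ae_point (R : realType) (P : R -> Prop) (c d : R) :
  {ae (@lebesgue_measure R), forall s, P s} -> c < d -> exists2 s, c < s < d & P s.
Proof.
move=> [N [mN N0 PN]] cd; apply: contrapT => h.
have sub : (`]c, d[%classic : set (measurableTypeR R)) `<=` N.
  by move=> s /=; rewrite in_itv/= => scd; apply: PN => /= Ps; apply: h; exists s.
have : ((@lebesgue_measure R) `]c, d[%classic <= (@lebesgue_measure R) N)%E.
  by apply: le_measure => //; rewrite inE//; exact: measurable_itv.
by rewrite N0 lebesgue_measure_itv/= lte_fin cd -EFinD lee_fin leNgt subr_gt0 cd.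
Qed.

(** * Structure of admissible functions with small excess of variation *)

Section Structure.
Context {R : realType} {M : nat}.
Variables (T : R) (V : {fset 'cV[int]_M}).
Hypothesis T_gt0 : 0 < T.
Implicit Types (w : R -> 'cV[R]_M).
Notation mu := (@lebesgue_measure R).

Section Gap.
Variable (K : 'cV[R]_M -> Prop).
Hypothesis K_ball : unit_ball K.
Local Notation N := (suppf K).

(* [V] is finite, so the defect in the triangle inequality takes finitely many
   values: below some threshold it vanishes. *)
Lemma suppf_gap : exists2 c : R, 0 < c & forall x b y : 'cV[R]_M, setV V x -> setV V b -> setV V y ->
  N (x - b) + N (b - y) <= N (x - y) + 2 * c -> N (x - b) + N (b - y) <= N (x - y).
Proof.
(* A positive defect [g] with [c <= g / 3] cannot satisfy [g <= 2 * c]. Triples without positive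
   defect impose nothing and get the value 1. *)
pose f (z : V * V * V) := let x : 'cV[R]_M := toR (val z.1.1) in
  let b : 'cV[R]_M := toR (val z.1.2) in let y : 'cV[R]_M := toR (val z.2) in
  let g := N (x - b) + N (b - y) - N (x - y) in if 0 < g then g / 3 else 1.
have f0 z : 0 < f z by rewrite /f; case: ifP => // h; rewrite divr_gt0.
have [c c0 H] := fin_min_gt0 f0; exists c => // _ _ _ [x xV <-] [b bV <-] [y yV <-].
rewrite /= in xV bV yV.
have := H ([` xV], [` bV], [` yV])%fset; rewrite /f/=.
case: ifP => [h1 h2 h3|/negbT]; last by rewrite -leNgt subr_le0.
lra.
Qed.

(** Apply the gap to the round trip from [x] to [y] and back: its defect is twice [N (x - y)], hence
    vanishes as soon as it is at most [2 * c]. *)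
Lemma suppf_small c : (forall x b y, setV V x -> setV V b -> setV V y ->
    N (x - b) + N (b - y) <= N (x - y) + 2 * c -> N (x - b) + N (b - y) <= N (x - y)) ->
  forall x y : 'cV[R]_M, setV V x -> setV V y -> N (x - y) <= c -> x = y.
Proof.
move=> H x y xV yV h; apply/eqP; rewrite -subr_eq0; apply: contraT => xy.
have := suppf_gt0 K_ball xy; have := H x y x xV yV xV.
rewrite subrr -(scale0r 0) suppf_scale// normr0 mul0r -(opprB x y) suppfN//; lra.
Qed.

End Gap.

(** Distinct integer vectors differ by at least 1 in some entry. The L1 distance thus bounds the
    measure of the set where two admissible functions differ. *)
Lemma setV_dist (x y : 'cV[R]_M) : setV V x -> setV V y -> x != y -> 1 <= \sum_i `|x i 0 - y i 0|.
Proof.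
move=> [x' _ <-] [y' _ <-] xy.
have [i xyi] : exists i, x' i 0 != y' i 0.
  apply: contrapT => h; move/eqP: xy; apply; congr toR; apply/matrixP => i j.
  by rewrite ord1; apply/eqP/negPn/negP => ?; apply: h; exists i.
rewrite (bigD1 i)//= -[leLHS]addr0 lerD ?sumr_ge0//.
by rewrite !mxE -intrB -intr_norm (ler_int _ 1) -gtz0_ge1 normr_gt0 subr_eq0.
Qed.

(** Otherwise [w] and [v] would differ almost everywhere on (c, d) and be at distance at least
    [d - c]. *)
Lemma close_point w v c d : inL1 T w -> inL1 T v ->
  {ae mu, forall s, s \in `]0, T[ -> setV V (w s)} ->
  (forall s, s \in `]0, T[ -> setV V (v s)) ->
  0 <= c -> d <= T -> normL1 T (w - v) < d - c ->
  exists s, [/\ c < s < d, lebesgue_vpt T w s, setV V (w s) & w s = v s].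
Proof.
move=> Lw Lv wV vV c0 dT h.
have cd : c < d by rewrite -subr_gt0 (le_lt_trans _ h)// normL1_ge0.
pose G s := lebesgue_vpt T w s /\ (s \in `]0, T[ -> setV V (w s)).
have aeG : {ae mu, forall s, G s}.
  exact: (@filterI _ _ (ae_filter_ringOfSetsType mu) _ _ (ae_lebesgue_vpt Lw) wV).
have inT s : c < s < d -> s \in `]0, T[.
  by rewrite in_itv/= => /andP[s1 s2]; rewrite (le_lt_trans c0 s1) (lt_le_trans s2).
apply: contrapT => no.
have : d - c <= normL1 T (w - v).
  have FTC := @Int_indic_itvoo _ T (cst 1) id c d c0 (ltW cd) dT
    (@cst_continuous _ _ _) (fun z : R => is_derive_id z 1).
  rewrite -FTC; apply: ae_le_Int.
  - apply: (@intg_bounded _ _ _ 1) => [|s _]; last first.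
      by rewrite mulr1 normr_nat; case: (_ < _ < _).
    rewrite (_ : (fun s => _) = \1_(`]c, d[%classic)).
      by apply: measurable_funTS; apply: measurable_indic; exact: measurable_itv.
    by apply/funext => s; rewrite indicE mem_setE in_itv/= mulr1.
  - by apply/intg_norm1/inL1B.
  - move: aeG; apply: (@filterS _ _ (ae_filter_ringOfSetsType mu)) => s [Gs GV] sT.
    rewrite mulr1; case: (boolP (c < s < d)) => [scd|_]; last exact: sumr_ge0.
    have wv : w s != v s.
      by apply/eqP => wv; apply: no; exists s; split=> //; exact: GV.
    have := setV_dist (GV sT) (vV s sT) wv.
    congr (_ <= _); apply: eq_bigr => i _; by rewrite !mxE.
by rewrite leNgt h.
Qed.

Variables (n : nat) (a : nat -> 'cV[int]_M) (t : nat -> R).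
Hypotheses (n_gt0 : (0 < n)%N) (t0 : t 0%N = 0) (tn : t n = T)
  (t_lt : forall j, (j < n)%N -> t j < t j.+1)
  (aV : forall j, (1 <= j <= n)%N -> a j \in V)
  (a_neq : forall j, (1 <= j < n)%N -> a j != a j.+1).
Variable d : R.
Hypotheses (d_gt0 : 0 < d) (t_gap : forall j, (j < n)%N -> t j + 4 * d <= t j.+1).

Local Notation J := 'I_n.-1.
Local Opaque jpoint.
Local Notation tt := (@jpoint R n t).
Local Notation nu := (@jheight R M n a).
Local Notation u0 := (@step_stair R M n a t).

Lemma setV_stair s : s \in `]0, T[ -> setV V (u0 s).
Proof.
move=> sT; have [i iN /andP[s1 s2]] := piece_exists t0 tn sT.
rewrite (@stair_val R M n a t n_gt0 t_lt i s)//; [|exact/implyP|exact/implyP].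
by exists (a i) => //=; exact: aV.
Qed.

Lemma toR_inj : injective (@toR R M).
Proof.
move=> x y /matrixP h; apply/matrixP => i j.
by have := h i j; rewrite !mxE => /intr_inj.
Qed.

Lemma jheight_neq0 (j : J) : nu j != 0.
Proof.
have jn := jpoint_lt n_gt0 j.
by rewrite subr_eq0; apply/eqP => /toR_inj/eqP; apply/negP; exact: a_neq.
Qed.

Lemma setV_a j : (1 <= j <= n)%N -> setV V (toR (a j) : 'cV[R]_M).
Proof. by move=> jn; exists (a j) => //=; exact: aV. Qed.

Variables (p : \bar R).
Hypothesis p_ge1 : (1 <= p)%E.
Let K := @dual_ball R M p.
Let K_ball : unit_ball K := qnorm_unit_ball p_ge1.
Local Notation N := (suppf K).

Section Families.
Variables (w : R -> 'cV[R]_M) (lp rp : J -> R).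
Hypotheses (Lw : inL1 T w)
  (lrp : forall j, [/\ tt j - 2 * d <= lp j, lp j < rp j & rp j <= tt j + 2 * d])
  (wlr : forall j, lebesgue_vpt T w (lp j) /\ lebesgue_vpt T w (rp j)).

Let lrpT j : [/\ 0 < lp j, lp j < rp j & rp j < T].
Proof.
have d0 := d_gt0.
have [h1 h2 h3] := lrp j; have [b1 b2] := jpoint_bounds n_gt0 t0 tn t_lt t_gap j.
by split=> //; lra.
Qed.

Let lrp_sep j k : j != k -> rp j <= lp k \/ rp k <= lp j.
Proof.
have d0 := d_gt0.
move=> /(jpoint_sep n_gt0 t_lt t_gap) h.
have [? ? ?] := lrp j; have [? ? ?] := lrp k.
by case: h => h; [left|right]; lra.
Qed.

Lemma TV_base : ((\sum_j N (w (lp j) - w (rp j)))%:E <= TV T p w)%E.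
Proof. exact: TV_ge_pairs. Qed.

(** When the base pairs already account for the variation of the staircase and the excess is at most
    [c], the values at an extra pair can differ by at most [c] in [N]. The restrictions on [w] below
    come from such an extra pair. *)
Lemma TV_extra y1 y2 : 0 < y1 -> y1 < y2 -> y2 < T ->
  lebesgue_vpt T w y1 -> lebesgue_vpt T w y2 ->
  (forall j, y2 <= lp j \/ rp j <= y1) ->
  ((\sum_j N (w (lp j) - w (rp j)) + N (w y1 - w y2))%:E <= TV T p w)%E.
Proof.
move=> y10 y12 y2T wy1 wy2 ylr.
pose f (i : J + 'I_1) := match i with inl j => lp j | inr _ => y1 end.
pose k (i : J + 'I_1) := match i with inl j => rp j | inr _ => y2 end.
have -> : \sum_j N (w (lp j) - w (rp j)) + N (w y1 - w y2) =
    \sum_i N (w (f i) - w (k i)) by rewrite big_sumType/= big_ord1.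
apply: (TV_ge_pairs T_gt0 p_ge1 Lw).
- by case=> [j|i] /=; [exact: lrpT|split].
- by case=> [j|i] /=; [exact: wlr|split].
- move=> [i|i] [j|j]//= ij.
  + exact: lrp_sep.
  + by case: (ylr i); [right|left].
  + by move: ij; rewrite !ord1 eqxx.
Qed.

End Families.

Variables (w : R -> 'cV[R]_M) (r c : R).
Hypotheses (wU : Uad T V w) (r_gt0 : 0 < r) (rd : r <= d) (wr : normL1 T (w - u0) < r).

Let Lw : inL1 T w. Proof. by have [[]] := wU. Qed.
Let Lu0 : inL1 T u0. Proof. exact: inL1_stair. Qed.

Definition good s := [/\ s \in `]0, T[, lebesgue_vpt T w s & setV V (w s)].

Lemma ae_good : {ae mu, forall s, s \in `]0, T[ -> good s}.
Proof.
have [_ wV] := wU.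
move: (@filterI _ _ (ae_filter_ringOfSetsType mu) _ _ (ae_lebesgue_vpt Lw) wV).
by apply: (@filterS _ _ (ae_filter_ringOfSetsType mu)) => s [? h] sT; split=> //; exact: h.
Qed.

Lemma good_close y1 y2 : 0 <= y1 -> y2 <= T -> r <= y2 - y1 ->
  exists s, [/\ y1 < s < y2, good s & w s = u0 s].
Proof.
move=> y10 y2T y12; have [_ wV] := wU.
have [s [s1 s2 s3 s4]] := close_point Lw Lu0 wV setV_stair y10 y2T (lt_le_trans wr y12).
exists s; split=> //; split=> //; move: s1; rewrite in_itv/= => /andP[h1 h2].
by rewrite (le_lt_trans y10 h1) (lt_le_trans h2).
Qed.

(** The offset [q] keeps a window about each jump free of base points: [q = 0] when the point under
    study is far from the jumps, [q = r] when it lies inside a window. *)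
Lemma base_points (q : R) : 0 <= q <= d -> exists lp rp : J -> R, [/\
  forall j, tt j - q - r < lp j < tt j - q,
  forall j, tt j + q < rp j < tt j + q + r,
  forall j, good (lp j) /\ good (rp j) &
  forall j, w (lp j) = toR (a j.+1) /\ w (rp j) = toR (a j.+2)].
Proof.
have d0 := d_gt0; have r0 := r_gt0; have rd' := rd.
move=> /andP[q0 qd].
have /choice[lp Hl] : forall j : J, exists s,
    [/\ tt j - q - r < s < tt j - q, good s & w s = u0 s].
  move=> j; have [b1 b2] := jpoint_bounds n_gt0 t0 tn t_lt t_gap j.
  by apply: good_close; lra.
have /choice[rp Hr] : forall j : J, exists s,
    [/\ tt j + q < s < tt j + q + r, good s & w s = u0 s].
  move=> j; have [b1 b2] := jpoint_bounds n_gt0 t0 tn t_lt t_gap j.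
  by apply: good_close; lra.
exists lp, rp; split=> j; have [/andP[l1 l2] l3 l4] := Hl j; have [/andP[r1 r2] r3 r4] := Hr j.
- by rewrite l1.
- by rewrite r1.
- by [].
- split; first by rewrite l4 (@stair_left R M n a t n_gt0 t_lt d t_gap j)//; apply/andP; split; lra.
  by rewrite r4 (@stair_right R M n a t n_gt0 t_lt d t_gap j)//; apply/andP; split; lra.
Qed.

Lemma TV_ge_stair : ((\sum_j N (nu j))%:E <= TV T p w)%E.
Proof.
have d0 := d_gt0; have r0 := r_gt0; have rd' := rd.
have [lp [rp [Hl Hr G E]]] : exists lp rp : J -> R, [/\
  forall j, tt j - 0 - r < lp j < tt j - 0,
  forall j, tt j + 0 < rp j < tt j + 0 + r,
  forall j, good (lp j) /\ good (rp j) &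
  forall j, w (lp j) = toR (a j.+1) /\ w (rp j) = toR (a j.+2)].
  by apply: base_points; rewrite ?lexx ?(ltW r_gt0)//= ltW.
apply: le_trans (@TV_base w lp rp Lw _ _).
- rewrite lee_fin; apply: ler_sum => j _; have [-> ->] := E j; exact: lexx.
- by move=> j; have := Hl j; have := Hr j => /andP[? ?] /andP[? ?]; split; lra.
- by move=> j; have [[? ? ?] [? ? ?]] := G j.
Qed.

Hypotheses (c_gap : forall x b y, setV V x -> setV V b -> setV V y ->
    N (x - b) + N (b - y) <= N (x - y) + 2 * c -> N (x - b) + N (b - y) <= N (x - y))
  (c_ge0 : 0 <= c) (TVw : (TV T p w <= (\sum_j N (nu j) + c)%:E)%E).

(** The same piece contains a good point [y] at which [w] agrees with the staircase, and no base
    interval separates [s] from [y]. As an extra pair, [s] and [y] have values within [c] of each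
    other, hence equal ones. *)
Lemma good_far s : good s -> (forall j, r <= `|s - tt j|) -> w s = u0 s.
Proof.
have d0 := d_gt0; have r0 := r_gt0; have rd' := rd.
have c0 := c_ge0; move=> [sT s2 s3] far; apply/eqP/negPn/negP => /eqP ws.
have [lp [rp [Hl Hr G E]]] : exists lp rp : J -> R, [/\
  forall j, tt j - 0 - r < lp j < tt j - 0,
  forall j, tt j + 0 < rp j < tt j + 0 + r,
  forall j, good (lp j) /\ good (rp j) &
  forall j, w (lp j) = toR (a j.+1) /\ w (rp j) = toR (a j.+2)].
  by apply: base_points; rewrite ?lexx ?(ltW r_gt0)//= ltW.
have [i iN /andP[ti1 ti2]] := piece_exists t0 tn sT.
have /andP[i0 iN'] := iN.
have ipred : t i.-1 + 4 * d <= t i.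
  by have := t_gap (j := i.-1); rewrite prednK//; apply.
have ti0 : 0 <= t i.-1.
  by rewrite -t0; apply: (t_leq t_lt) => //; rewrite (leq_trans (leq_pred _)).
have tiT : t i <= T by rewrite -tn; apply: (t_leq t_lt).
have [y [/andP[y1 y2] yg wy]] : exists y, [/\ t i.-1 + r < y < t i - r, good y & w y = u0 y].
  by apply: good_close; lra.
have us : u0 s = toR (a i) by apply: (@stair_val R M n a t n_gt0 t_lt i s) => //; exact/implyP.
have uy : u0 y = toR (a i).
  by apply: (@stair_val R M n a t n_gt0 t_lt i y) => //; apply/implyP => _; lra.
have [yT yl yV] := yg.
have sy : s != y by apply: contra_notN ws => /eqP ->; rewrite wy.
have side j : (s <= lp j /\ y <= lp j) \/ (rp j <= s /\ rp j <= y).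
  have := Hl j; have := Hr j; rewrite subr0 addr0.
  move=> /andP[r1 r2] /andP[l1 l2]; have jn := jpoint_lt n_gt0 j.
  have := far j; rewrite ler_normr; case: (leqP i j.+1) => ij.
    have h : t i <= tt j by apply: (t_leq t_lt) => //; exact: ltnW.
    by move=> /orP[]h'; left; split; lra.
  have h : tt j <= t i.-1.
    apply: (t_leq t_lt); last by rewrite (leq_trans (leq_pred _)).
    by rewrite -ltnS prednK.
  by move=> /orP[]h'; right; split; lra.
have base_ok : forall j, [/\ tt j - 2 * d <= lp j, lp j < rp j & rp j <= tt j + 2 * d].
  by move=> j; have := Hl j; have := Hr j => /andP[? ?] /andP[? ?]; split; lra.
have base_leb : forall j, lebesgue_vpt T w (lp j) /\ lebesgue_vpt T w (rp j).
  by move=> j; have [[? ? ?] [? ? ?]] := G j.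
have sumE : \sum_j N (w (lp j) - w (rp j)) = \sum_j N (nu j).
  by apply: eq_bigr => j _; have [-> ->] := E j.
have small : N (w s - w y) <= c.
  move: sT yT; rewrite !in_itv/= => /andP[s0 sT] /andP[y0 yT].
  case: (ltgtP s y) => [lt|lt|/eqP]; last by rewrite (negbTE sy).
    have := @TV_extra w lp rp Lw base_ok base_leb s y s0 lt yT s2 yl.
    move=> /(_ _)/le_trans/(_ TVw); rewrite sumE lee_fin lerD2l; apply.
    by move=> j; case: (side j) => -[? ?]; [left|right].
  have := @TV_extra w lp rp Lw base_ok base_leb y s y0 lt sT yl s2.
  move=> /(_ _)/le_trans/(_ TVw); rewrite sumE lee_fin lerD2l -opprB suppfN//; apply.
  by move=> j; case: (side j) => -[? ?]; [left|right].
by apply: ws; rewrite us -uy -wy; exact: (suppf_small K_ball c_gap).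
Qed.

(* Near the jump [j], pair the left base point with [s1], and [s1] with [s2] or
   with the right base point. *)
Lemma two_pairs j s1 s2 : good s1 -> good s2 -> s1 < s2 ->
  tt j - r < s1 -> s2 < tt j + r ->
  N (toR (a j.+1) - w s1) + N (w s1 - w s2) <= N (nu j) + c /\
  N (toR (a j.+1) - w s1) + N (w s1 - toR (a j.+2)) <= N (nu j) + c.
Proof.
have d0 := d_gt0; have r0 := r_gt0; have rd' := rd.
move=> g1 g2 s12 hs1 hs2.
have [s1T s1l _] := g1; have [s2T s2l _] := g2.
have [lp [rp [Hl Hr G E]]] : exists lp rp : J -> R, [/\
  forall j, tt j - r - r < lp j < tt j - r,
  forall j, tt j + r < rp j < tt j + r + r,
  forall j, good (lp j) /\ good (rp j) &
  forall j, w (lp j) = toR (a j.+1) /\ w (rp j) = toR (a j.+2)].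
  by apply: base_points; rewrite ?lexx ?(ltW r_gt0)//= ltW.
have LR k : [/\ tt k - 2 * d <= lp k, lp k < tt k - r, tt k + r < rp k & rp k <= tt k + 2 * d].
  by have := Hl k; have := Hr k => /andP[? ?] /andP[? ?]; split; lra.
pose rp' k := if k == j then s1 else rp k.
have ok : forall k, [/\ tt k - 2 * d <= lp k, lp k < rp' k & rp' k <= tt k + 2 * d].
  move=> k; have [? ? ? ?] := LR k; rewrite /rp'; case: eqVneq => [->|_]; split=> //; try lra.
  - by have [? ? ? ?] := LR j; lra.
  - by have [? ? ? ?] := LR j; lra.
have leb : forall k, lebesgue_vpt T w (lp k) /\ lebesgue_vpt T w (rp' k).
  move=> k; have [[_ lk _] [_ rk _]] := G k; split; first exact: lk.
  by rewrite /rp'; case: ifP => _; [exact: s1l|exact: rk].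
have sumE : \sum_k N (w (lp k) - w (rp' k)) =
    \sum_k N (nu k) - N (nu j) + N (toR (a j.+1) - w s1).
  rewrite (bigD1 j)//= [\sum_k N (nu k)](bigD1 j)//= /rp' eqxx (E j).1.
  rewrite [N (nu j) + _]addrC addrK addrC; congr (_ + _).
  by apply: eq_bigr => k /negbTE kj; rewrite kj (E k).1 (E k).2.
have key y : good y -> s1 < y -> y <= rp j -> N (toR (a j.+1) - w s1) + N (w s1 - w y) <= N (nu j) + c.
  move=> [yT yl _] sy yr.
  move: s1T yT; rewrite !in_itv/= => /andP[s10 s1T] /andP[y0 yT].
  have : (forall k, y <= lp k \/ rp' k <= s1).
    move=> k; rewrite /rp'; case: eqVneq => [_|kj]; first by right.
    have [? ? ? ?] := LR k; have [? ? ? ?] := LR j.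
    by case: (jpoint_sep n_gt0 t_lt t_gap kj) => ?; [right|left]; lra.
  have := @TV_extra w lp rp' Lw ok leb s1 y s10 sy yT s1l yl.
  move=> H /H/le_trans/(_ TVw); rewrite sumE lee_fin -!addrA lerD2l => h.
  by rewrite -lerBlDl [leLHS]addrC.
have [? ? ? ?] := LR j; split; first by apply: key => //; lra.
by rewrite -(E j).2; apply: key; [exact: (G j).2|lra|].
Qed.

Hypothesis N_strict : forall x y, N x + N y <= N (x + y) ->
  exists2 l, 0 <= l <= 1 & y = l *: (x + y).

(** By the gap, passing through [w s] on the way across the jump costs exactly the jump. Strict
    convexity then puts [w s] on the segment. *)
Lemma good_near j s : good s -> `|s - tt j| < r ->
  exists2 l, 0 <= l <= 1 & w s = toR (a j.+2) + l *: nu j.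
Proof.
have r0 := r_gt0; have rd' := rd; have d0 := d_gt0.
move=> gs; rewrite ltr_norml => /andP[s1 s2].
have jn := jpoint_lt n_gt0 j.
have [b1 b2] := jpoint_bounds n_gt0 t0 tn t_lt t_gap j.
have sr : s < tt j + r by lra.
(* [two_pairs] takes a second good point right of [s]; the estimate kept here does not mention
   it. *)
have [s' /andP[ss' s'r] gs'] := ae_point ae_good sr.
have {}gs' : good s'.
  by move: (gs) => [sT _ _]; apply: gs'; move: sT; rewrite !in_itv/= => /andP[? ?]; apply/andP; split; lra.
have sl : tt j - r < s by lra.
have [_ H] := two_pairs gs gs' ss' sl s'r.
have [_ _ sV] := gs.
have VV1 : setV V (toR (a j.+1) : 'cV[R]_M) by apply: setV_a; exact: ltnW.
have VV2 : setV V (toR (a j.+2) : 'cV[R]_M) by exact: setV_a.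
have nuE : (toR (a j.+1) - w s) + (w s - toR (a j.+2)) = nu j by rewrite subrKA.
have {}H : N (toR (a j.+1) - w s) + N (w s - toR (a j.+2)) <= N (nu j).
  by apply: c_gap => //; apply: (le_trans H); rewrite lerD2l mulr_natl mulr2n lerDl.
rewrite -nuE in H; have [l l01 lE] := N_strict H.
by exists l => //; rewrite -nuE -lE subrKC.
Qed.

(** A return from the right value to the left one would spend the jump twice, while any nonzero
    difference in [V] exceeds [c]. *)
Lemma good_mono j s1 s2 : good s1 -> good s2 -> s1 < s2 -> tt j - r < s1 -> s2 < tt j + r ->
  w s1 = toR (a j.+2) -> w s2 = toR (a j.+1) -> False.
Proof.
move=> g1 g2 s12 h1 h2 w1 w2; have jn := jpoint_lt n_gt0 j.
have [H _] := two_pairs g1 g2 s12 h1 h2; move: H.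
rewrite w1 w2 -/(nu j) -(opprB (toR (a j.+1))) -/(nu j) suppfN// lerD2l => H.
have := jheight_neq0 j; rewrite subr_eq0 => /eqP; apply.
by apply: (suppf_small K_ball c_gap) => //; apply: setV_a => //; exact: ltnW.
Qed.

(** The orthogonal projection of [w - u0] onto the jump, cut off at distance [r]. This form makes it
    integrable at once; that [w - u0] is a multiple of the jump is known only at good points. *)
Definition profile (j : J) (s : R) : R :=
  (`|s - tt j| < r)%R%:R * (dotp (w s - u0 s) (nu j) / dotp (nu j) (nu j)).

Lemma intg_profile j : intg T (profile j).
Proof.
apply: (@eq_intg _ _ (fun s => (dotp (nu j) (nu j))^-1 * dotp ((w - u0) s) (nu j) *
    (`|s - tt j| < r)%R%:R)).
  by move=> s _; rewrite /profile mulrC [_^-1 * _]mulrC.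
apply: (intgM (C := 1)).
- by apply: intgZ; apply: intg_dotp_const; exact: inL1B.
- rewrite (_ : (fun s => _) = \1_(`]tt j - r, tt j + r[%classic)).
    by apply: measurable_funTS; apply: measurable_indic; exact: measurable_itv.
  by apply/funext => s; rewrite indicE mem_setE in_itv/= ltr_distl.
- by move=> s _; rewrite normr_nat; case: (_ < r).
Qed.

Lemma profile_eq0 j s : r <= `|s - tt j| -> profile j s = 0.
Proof. by move=> h; rewrite /profile ltNge h mul0r. Qed.

Lemma profile_near j s x : `|s - tt j| < r -> w s = u0 s + x *: nu j -> profile j s = x.
Proof.
move=> h ws; rewrite /profile h mul1r ws addrC addKr dotpZl mulfK//.
by rewrite gt_eqF// dotp_gt0// jheight_neq0.
Qed.

Lemma near_unique j k s : `|s - tt j| < r -> k != j -> r <= `|s - tt k|.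
Proof.
have r0 := r_gt0; have rd' := rd; have d0 := d_gt0.
rewrite ltr_norml => /andP[h1 h2] /(jpoint_sep n_gt0 t_lt t_gap) h.
by rewrite ler_normr; apply/orP; case: h => h; [left|right]; lra.
Qed.

Lemma profile_value j s : good s -> `|s - tt j| < r -> exists l, [/\ 0 <= l <= 1,
  w s = toR (a j.+2) + l *: nu j, profile j s = l - (s < tt j)%R%:R &
  w s = u0 s + profile j s *: nu j].
Proof.
have r0 := r_gt0; have rd' := rd; have d0 := d_gt0.
move=> gs near; have [l l01 ws] := good_near gs near; exists l.
have ws' : w s = u0 s + (l - (s < tt j)%R%:R) *: nu j.
  move: (near); rewrite ltr_norml => /andP[h1 h2].
  case: ltP => st.
    rewrite (@stair_left R M n a t n_gt0 t_lt d t_gap j); last by apply/andP; split; lra.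
    have a12 : toR (a j.+1) - nu j = toR (a j.+2) by rewrite /jheight /jump subKr.
    by rewrite scalerBl scale1r addrCA a12 ws addrC.
  rewrite (@stair_right R M n a t n_gt0 t_lt d t_gap j); last by apply/andP; split; lra.
  by rewrite subr0.
have pE := profile_near near ws'.
by split=> //; rewrite pE.
Qed.

Lemma profile_comb : eqL1 T w (u0 + comb nu profile).
Proof.
apply: aeT_imp ae_good => s sT gs.
rewrite -[(u0 + _) s]/(u0 s + comb nu profile s) /comb.
have [[j near]|far] := pselect (exists j, `|s - tt j| < r).
  rewrite (bigD1 j)//= big1 ?addr0; first by have [l []] := profile_value gs near.
  by move=> k kj; rewrite profile_eq0 ?scale0r//; exact: near_unique kj.
have {}far j : r <= `|s - tt j| by rewrite leNgt; apply/negP => h; apply: far; exists j.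
by rewrite big1 ?addr0 ?(good_far gs)// => k _; rewrite profile_eq0 ?scale0r.
Qed.

Lemma profile_sign j : aeT T (fun s => if s < tt j then -1 <= profile j s <= 0
  else 0 <= profile j s <= 1).
Proof.
apply: aeT_imp ae_good => s sT gs.
have [near|far] := ltP `|s - tt j| r; last first.
  by rewrite profile_eq0//; case: ifP => _; rewrite ?lexx ?ler01 ?lerN10.
have [l [/andP[l0 l1] _ -> _]] := profile_value gs near.
by case: (s < tt j) => /=; apply/andP; split; lra.
Qed.

(** With no element of [V] inside the segment, [w] takes only the two end values near the jump, and
    by [good_mono] never the right value before the left one: the jump has merely moved. *)
Lemma profile_step (j : J) : ~ inJ (R := R) V n a j.+1 -> exists2 b, tt j - r <= b <= tt j + r &
  aeT T (fun s => profile j s = (s < b)%R%:R - (s < tt j)%R%:R).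
Proof.
have r0 := r_gt0; have rd' := rd; have d0 := d_gt0.
move=> nJ; have jn := jpoint_lt n_gt0 j.
have val s : good s -> `|s - tt j| < r ->
    (w s = toR (a j.+1) /\ profile j s = 1 - (s < tt j)%R%:R) \/
    (w s = toR (a j.+2) /\ profile j s = 0 - (s < tt j)%R%:R).
  move=> gs near; have [l [/andP[l0 l1] ws pE _]] := profile_value gs near.
  have [_ _ sV] := gs.
  have [l1'|l1'] := eqVneq l 1.
    by left; rewrite pE ws l1' scale1r /jheight /jump subrKC.
  have [l0'|l0'] := eqVneq l 0.
    by right; rewrite pE ws l0' scale0r addr0.
  exfalso; apply: nJ; split; first by rewrite jn.
  exists l; split; first by rewrite !lt_neqAle eq_sym l0' l0 l1' l1.
  rewrite scalerBl scale1r addrCA -scalerBr; by move: sV; rewrite ws.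
(* The new position is the supremum of the good points with the left value. Adding [tt j - r] makes
   [S] nonempty when there are none. *)
pose S := [set s | s = tt j - r \/ (good s /\ `|s - tt j| < r /\ w s = toR (a j.+1))].
have Sub : ubound S (tt j + r).
  move=> s [->|[_ [h _]]]; first lra.
  by move: h; rewrite ltr_norml => /andP[? ?]; lra.
have hS : has_sup S by split; [exists (tt j - r); left|exists (tt j + r)].
exists (sup S); first by rewrite sup_upper_bound//=; [exact: sup_le_ub hS.1 Sub|left].
(* The supremum itself may carry either value and is discarded as a null set. *)
move: (aeT_and ae_good (aeT_neq T (sup S))); apply: aeT_imp => s sT [gs snS].
have [near|far] := ltP `|s - tt j| r; last first.
  rewrite profile_eq0//; move: (far); rewrite ler_normr => /orP[h|h].
    have e1 : (s < tt j) = false by apply/negbTE; rewrite -leNgt; lra.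
    have e2 : (s < sup S) = false.
      apply/negbTE; rewrite -leNgt; apply: (le_trans (sup_le_ub hS.1 Sub)); lra.
    by rewrite e1 e2 subrr.
  have e1 : s < tt j by lra.
  have e2 : tt j - r <= sup S by apply: (sup_upper_bound hS); left.
  have e3 : s < sup S.
    by rewrite lt_neqAle snS; apply: le_trans e2; lra.
  by rewrite e1 e3 subrr.
have [[ws ->]|[ws ->]] := val s gs near; congr (_ - _).
  rewrite lt_neqAle snS sup_upper_bound//=.
  by right.
have e : sup S <= s.
  apply: (sup_le_ub hS.1) => s' [->|[gs' [near' ws']]].
    by move: near; rewrite ltr_norml => /andP[? ?]; lra.
  rewrite leNgt; apply/negP => ss'; move: near near'; rewrite !ltr_norml => /andP[n1 n2] /andP[n3 n4].
  have n5 : tt j - r < s by lra.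
  have n6 : s' < tt j + r by lra.
  exact: (good_mono gs gs' ss' n5 n6 ws ws').
by rewrite ltNge e.
Qed.

End Structure.

(** * Perturbations of the jumps *)

Section Perturbation.
Context {R : realType} {M : nat}.
Variables (T : R) (V : {fset 'cV[int]_M}).
Hypothesis T_gt0 : 0 < T.
Variables (n : nat) (a : nat -> 'cV[int]_M) (t : nat -> R).
Hypotheses (n_gt0 : (0 < n)%N) (t0 : t 0%N = 0) (tn : t n = T)
  (t_lt : forall j, (j < n)%N -> t j < t j.+1)
  (aV : forall j, (1 <= j <= n)%N -> a j \in V)
  (a_neq : forall j, (1 <= j < n)%N -> a j != a j.+1).
Variable d : R.
Hypotheses (d_gt0 : 0 < d) (t_gap : forall j, (j < n)%N -> t j + 4 * d <= t j.+1).

Local Notation J := 'I_n.-1.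
Local Notation tt := (@jpoint R n t).
Local Notation nu := (@jheight R M n a).
Local Notation u0 := (@step_stair R M n a t).
Local Opaque jpoint.

Lemma Int_lt_mul (f F : R -> R) (b : R) : 0 <= b -> b <= T ->
  continuous f -> (forall x : R, is_derive x 1 F (f x)) ->
  Int T (fun s => (s < b)%R%:R * f s) = F b - F 0.
Proof.
move=> b0 bT cf dF; rewrite -(Int_indic_itvoo (lexx 0) b0 bT cf dF).
by apply: eq_Int => s; rewrite in_itv/= => /andP[-> _].
Qed.

Lemma Int_lt (b : R) : 0 <= b -> b <= T -> Int T (fun s => (s < b)%R%:R) = b.
Proof.
move=> b0 bT; rewrite -[RHS]subr0.
rewrite -(@Int_lt_mul (cst 1) id b b0 bT (@cst_continuous _ _ _) (fun z : R => is_derive_id z 1)).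
by apply: eq_Int => s _; rewrite mulr1.
Qed.

Lemma Int_lt_affine (b x : R) : 0 <= b -> b <= T ->
  Int T (fun s => (s < b)%R%:R * (s - x)) = (b - x) ^+ 2 / 2 - x ^+ 2 / 2.
Proof.
move=> b0 bT.
have cf : continuous (fun s : R => s - x).
  by move=> s; apply: cvgB; [exact: cvg_id|exact: cvg_cst].
have dF (s : R) : is_derive s 1 (fun s : R => (s - x) ^+ 2 / 2) (s - x).
  apply: (@quadratic_is_derive _ _ _ _ 1) => y.
  rewrite (_ : _ - _ - _ = y ^+ 2 / 2); last by field.
  by rewrite mul1r ger0_norm ?divr_ge0 ?sqr_ge0// ler_pdivrMr// ler_peMr ?sqr_ge0// ler1n.
by rewrite (Int_lt_mul b0 bT cf dF) sub0r sqrrN.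
Qed.

(** Within [d] of a jump the other profiles vanish, and a jump between distinct integer vectors has
    1-norm at least 1. *)
Lemma normL1_comb_ge th k : (forall j, intg T (th j)) ->
  (forall j s, d < `|s - tt j| -> th j s = 0) ->
  Int T (fun s => `|th k s|) <= normL1 T (comb nu th).
Proof.
have d0 := d_gt0.
move=> Ith th0; apply: le_Int; [exact: intg_norm|exact/intg_norm1/inL1_comb|].
move=> s _; have [h|h] := ltP d `|s - tt k|.
  by rewrite th0// normr0 sumr_ge0.
have -> : comb nu th s = th k s *: nu k.
  rewrite /comb (bigD1 k)//= big1 ?addr0// => j jk.
  rewrite (th0 j) ?scale0r//; move: h; rewrite ler_norml ltr_normr => /andP[h1 h2].
  by apply/orP; case: (jpoint_sep n_gt0 t_lt t_gap jk) => h; [left|right]; lra.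
under eq_bigr do rewrite mxE normrM.
have kn := jpoint_lt n_gt0 k.
rewrite -mulr_sumr ler_peMr//.
have h1 : setV V (toR (a k.+1) : 'cV[R]_M) by apply: (setV_a aV); exact: ltnW.
have h2 : setV V (toR (a k.+2) : 'cV[R]_M) by exact: (setV_a aV).
have h3 : toR (a k.+1) != toR (a k.+2) :> 'cV[R]_M.
  by apply/eqP => /toR_inj/eqP; apply/negP; exact: a_neq.
have := setV_dist h1 h2 h3.
by congr (_ <= _); apply: eq_bigr => i _; rewrite !mxE.
Qed.

Variables (lam al be : J -> R).
Hypotheses (lam01 : forall k, 0 <= lam k <= 1) (al_le : forall k, `|al k| <= d)
  (be_le : forall k, `|be k| <= d).

(* The jump [nu k] at [tt k] is split into a jump [lam k *: nu k] at
   [tt k + al k] and a jump [(1 - lam k) *: nu k] at [tt k + be k]; for [lam k = 1]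
   it is merely translated. *)
Definition shift_profile (k : J) (s : R) : R :=
  lam k * (s < tt k + al k)%R%:R + (1 - lam k) * (s < tt k + be k)%R%:R - (s < tt k)%R%:R.

Local Notation th := shift_profile.

Let shift_itv (k : J) : [/\ 0 < tt k, tt k < T, 0 < tt k + al k, tt k + al k < T &
  0 < tt k + be k /\ tt k + be k < T].
Proof.
have d0 := d_gt0; have [b1 b2] := jpoint_bounds n_gt0 t0 tn t_lt t_gap k.
have := al_le k; have := be_le k; rewrite !ler_norml => /andP[? ?] /andP[? ?].
by split; [lra|lra|lra|lra|split; lra].
Qed.

Lemma intg_shift k : intg T (th k).
Proof.
by apply: intgB; [apply: intgD; apply: intgZ; exact: intg_lt|exact: intg_lt].
Qed.

Lemma shift_eq0 k s : Num.max `|al k| `|be k| < `|s - tt k| -> th k s = 0.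
Proof.
rewrite gt_max /shift_profile => /andP[h1 h2].
have := ler_norm (al k); have := ler_norm (be k).
have := ler_norm (- al k); have := ler_norm (- be k); rewrite !normrN.
have [sk|sk] := ltP s (tt k).
  move: h1 h2; rewrite (@ltr0_norm _ (s - tt k)) ?subr_lt0// => h1 h2 n1 n2 _ _.
  have -> : s < tt k + al k by lra.
  have -> : s < tt k + be k by lra.
  by rewrite !mulr1 subrKC subrr.
move: h1 h2; rewrite (@ger0_norm _ (s - tt k)) ?subr_ge0// => h1 h2 _ _ n1 n2.
have -> : (s < tt k + al k) = false by apply/negbTE; rewrite -leNgt; lra.
have -> : (s < tt k + be k) = false by apply/negbTE; rewrite -leNgt; lra.
by rewrite !mulr0 addr0 subr0.
Qed.

Lemma shift_bound k s : `|th k s| <= 1.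
Proof.
have /andP[l0 l1] := lam01 k; rewrite /shift_profile ler_norml.
by case: (s < tt k + al k); case: (s < tt k + be k); case: (s < tt k) => /=; apply/andP; split; lra.
Qed.

Lemma Int_shift k : Int T (th k) = lam k * al k + (1 - lam k) * be k.
Proof.
have [h1 h2 h3 h4 [h5 h6]] := shift_itv k.
rewrite IntB; last 2 first.
- by apply: intgD; apply: intgZ; exact: intg_lt.
- exact: intg_lt.
rewrite IntD; try by apply: intgZ; exact: intg_lt.
rewrite !IntZ; try exact: intg_lt.
rewrite !Int_lt; try exact: ltW.
ring.
Qed.

Lemma Int_shift_affine k : Int T (fun s => th k s * (s - tt k)) =
  (lam k * al k ^+ 2 + (1 - lam k) * be k ^+ 2) / 2.
Proof.
have [h1 h2 h3 h4 [h5 h6]] := shift_itv k.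
have I b : intg T (fun s => (s < b)%R%:R * (s - tt k)).
  apply: intg_continuous_mul => //; first exact: intg_lt.
  by move=> s; apply: cvgB; [exact: cvg_id|exact: cvg_cst].
rewrite (@eq_Int _ _ _ (fun s => lam k * ((s < tt k + al k)%R%:R * (s - tt k)) +
  (1 - lam k) * ((s < tt k + be k)%R%:R * (s - tt k)) - (s < tt k)%R%:R * (s - tt k))); last first.
  by move=> s _; rewrite /shift_profile; ring.
have IZ b x : intg T (fun s => x * ((s < b)%R%:R * (s - tt k))) by exact: intgZ.
rewrite IntB//; last by apply: intgD; exact: IZ.
rewrite IntD//; try exact: IZ.
rewrite !IntZ//; try exact: I.
rewrite !Int_lt_affine; try exact: ltW.
by field.
Qed.

Definition shift_stair : R -> 'cV[R]_M := stair (toR (a n))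
  (fun i : J + J => match i with inl k => tt k + al k | inr k => tt k + be k end)
  (fun i : J + J => match i with inl k => lam k *: nu k | inr k => (1 - lam k) *: nu k end).

Lemma shift_stairE : shift_stair = u0 + comb nu th.
Proof.
apply/funext => s; rewrite -[(u0 + _) s]/(u0 s + comb nu th s).
rewrite /shift_stair /step_stair /stair /comb -addrA; congr (_ + _).
rewrite big_sumType/= -!big_split/=; apply: eq_bigr => k _.
by rewrite !scalerA -!scalerDl /shift_profile; congr (_ *: _); ring.
Qed.

Lemma shift_itvP (i : J + J) :
  match i with inl k => tt k + al k | inr k => tt k + be k end \in `]0, T[.
Proof.
by case: i => k; have [h1 h2 h3 h4 [h5 h6]] := shift_itv k; rewrite in_itv/=; apply/andP.
Qed.

(** Both parts of a split jump are nonnegative multiples of it, so homogeneity alone shows that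
    splitting costs no variation; this holds for every [p]. *)
Lemma TV_shift_le p : (1 <= p)%E ->
  (TV T p shift_stair <= (\sum_k suppf (@dual_ball R M p) (nu k))%:E)%E.
Proof.
move=> p1; have K_ball := qnorm_unit_ball p1 : unit_ball (@dual_ball R M p).
apply: le_trans (TV_stair_le T_gt0 _ _ p1 shift_itvP) _.
rewrite lee_fin big_sumType/= -big_split/=; apply: ler_sum => k _.
have /andP[l0 l1] := lam01 k.
rewrite !(suppf_scale K_ball) !ger0_norm ?subr_ge0// -mulrDl subrKC mul1r.
exact: lexx.
Qed.

Lemma shift_near k s : `|s - tt k| <= d -> shift_stair s = toR (a k.+2) +
  (lam k * (s < tt k + al k)%R%:R + (1 - lam k) * (s < tt k + be k)%R%:R) *: nu k.
Proof.
have d0 := d_gt0; rewrite ler_norml => /andP[h1 h2].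
rewrite shift_stairE -[(u0 + _) s]/(u0 s + comb nu th s) /comb (bigD1 k)//= big1 ?addr0.
  have -> : u0 s = toR (a k.+2) + (s < tt k)%R%:R *: nu k.
    case: ltP => sk.
      rewrite (@stair_left R M n a t n_gt0 t_lt d t_gap k); last by apply/andP; split; lra.
      by rewrite scale1r /jheight /jump subrKC.
    rewrite (@stair_right R M n a t n_gt0 t_lt d t_gap k); last by apply/andP; split; lra.
    by rewrite scale0r addr0.
  by rewrite -addrA -scalerDl /shift_profile; congr (_ + _ *: _); ring.
move=> j jk; rewrite shift_eq0 ?scale0r//.
apply: (@le_lt_trans _ _ d); first by rewrite ge_max al_le be_le.
rewrite ltr_normr; apply/orP.
by case: (jpoint_sep n_gt0 t_lt t_gap jk) => h; [left|right]; lra.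
Qed.

Hypothesis shift_V : forall (k : J) s, setV V ((toR (a k.+2) : 'cV[R]_M) +
  (lam k * (s < tt k + al k)%R%:R + (1 - lam k) * (s < tt k + be k)%R%:R) *: nu k).

Lemma Uad_shift : Uad T V shift_stair.
Proof.
apply: Uad_stair => //; first exact: shift_itvP.
move=> s sT; have [[k near]|far] := pselect (exists k, `|s - tt k| <= d).
  by rewrite -/(shift_stair s) (shift_near near); exact: shift_V.
rewrite -/(shift_stair s) shift_stairE -[(u0 + _) s]/(u0 s + comb nu th s) /comb.
rewrite big1 ?addr0; first exact: (setV_stair n_gt0 t0 tn t_lt aV sT).
move=> j _; rewrite shift_eq0 ?scale0r//.
apply: (@le_lt_trans _ _ d); first by rewrite ge_max al_le be_le.
by rewrite ltNge; apply/negP => h; apply: far; exists j.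
Qed.

End Perturbation.

(** * Expansion of F about the staircase in terms of the profiles *)

Section LocalExpansion.
Context {R : realType} {M : nat}.
Variables (T : R) (V : {fset 'cV[int]_M}).
Local Notation fct := (R -> 'cV[R]_M).
Variables (F : fct -> R) (F' : fct -> fct -> R) (F'' : fct -> fct -> fct -> R).
Variables (u : fct) (n : nat) (a : nat -> 'cV[int]_M) (t : nat -> R).
Variables (g : fct) (H : R -> R -> 'M[R]_M).
Hypothesis T_gt0 : 0 < T.
Hypothesis F_eqL1 : forall v w, inL1 T v -> inL1 T w -> eqL1 T v w -> F v = F w.
Hypotheses (n_gt0 : (0 < n)%N) (t0 : t 0%N = 0) (tn : t n = T)
  (t_lt : forall j, (j < n)%N -> t j < t j.+1)
  (aV : forall j, (1 <= j <= n)%N -> a j \in V)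
  (a_neq : forall j, (1 <= j < n)%N -> a j != a j.+1).
Hypotheses (uU : Uad T V u) (u_step : eqL1 T u (step_fun n a t)).
Hypotheses (F_twice : twice_frechet T F F' F'') (g_gradient : is_gradient T (F' u) g)
  (g_C1 : C1 T g) (H_hessian : is_hessian T (F'' u) H)
  (H_cont : {within `[0, T] `*` `[0, T], continuous (fun x : R * R => H x.1 x.2)}).
Variable d : R.
Hypotheses (d_gt0 : 0 < d) (t_gap : forall j, (j < n)%N -> t j + 4 * d <= t j.+1).

Local Notation J := 'I_n.-1.
Local Notation tt := (@jpoint R n t).
Local Notation nu := (@jheight R M n a).
Local Notation u0 := (@step_stair R M n a t).
Local Opaque jpoint.

Definition gslope (j : J) : R := dotp (nu j) (g (tt j)).
Definition gcurv (j : J) : R := dotp (nu j) (derive1 g (tt j)).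
Definition hcoef (j k : J) : R := hess H nu j k (tt j) (tt k).

Lemma inL1_u : inL1 T u. Proof. by have [[]] := uU. Qed.

Lemma u_stair : eqL1 T u u0.
Proof. by apply: aeT_imp u_step => s sT ->; exact: (@step_funE R M T n a t n_gt0 t0 tn t_lt s sT). Qed.

Lemma inL1_u0 : inL1 T u0. Proof. exact: inL1_stair. Qed.

Lemma normL1_u0 w : inL1 T w -> normL1 T (w - u) = normL1 T (w - u0).
Proof.
move=> Lw; apply: normL1_ae; [exact: inL1B inL1_u|exact: inL1B inL1_u0|].
by apply: aeT_imp u_stair => s _; rewrite -[(w - u) s]/(w s - u s) => ->.
Qed.

Lemma normL1_uu0 : normL1 T (u - u0) = 0.
Proof.
rewrite -normL1_u0; last exact: inL1_u.
rewrite subrr -[RHS](@Int0 R T); apply: eq_Int => s _.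
by rewrite big1// => i _; rewrite mxE normr0.
Qed.

(** The lower bound is the minimality of the staircase among nearby admissible functions, applied to
    [u] itself. *)
Lemma TV_u p : (1 <= p)%E -> TV T p u = (\sum_j suppf (@dual_ball R M p) (nu j))%:E.
Proof.
move=> p1; apply/eqP; rewrite eq_le; apply/andP; split.
  rewrite (TV_eqL1 T_gt0 p inL1_u inL1_u0 u_stair).
  by apply: TV_stair_le => //; exact: jpoint_itv.
apply: (TV_ge_stair T_gt0 n_gt0 t0 tn t_lt aV d_gt0 t_gap p1 uU d_gt0 (lexx d)).
by rewrite normL1_uu0.
Qed.

Lemma perturbed_norm w th : inL1 T w -> (forall j, intg T (th j)) ->
  eqL1 T w (u0 + comb nu th) -> normL1 T (w - u) = normL1 T (comb nu th).
Proof.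
move=> Lw Ith wth; rewrite normL1_u0//.
apply: normL1_ae; [exact: inL1B inL1_u0|exact: inL1_comb|].
apply: aeT_imp wth => s _; rewrite -[(w - u0) s]/(w s - u0 s) => ->.
by rewrite -[(u0 + _) s]/(u0 s + comb nu th s) addrC addKr.
Qed.

Lemma perturbed_F w th : inL1 T w -> (forall j, intg T (th j)) ->
  eqL1 T w (u0 + comb nu th) -> F w = F (u + comb nu th).
Proof.
move=> Lw Ith wth; apply: F_eqL1 => //; first by apply: inL1D; [exact: inL1_u|exact: inL1_comb].
move: (aeT_and wth u_stair); apply: aeT_imp => s _ [-> us].
by rewrite -[(u0 + _) s]/(u0 s + comb nu th s) -[(u + _) s]/(u s + comb nu th s) us.
Qed.

Lemma gradient_diff : forall e, 0 < e -> exists2 r, 0 < r & forall (j : J) s,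
  `|s - tt j| <= r ->
  `|dotp (nu j) (g s) - gslope j - gcurv j * (s - tt j)| <= e * `|s - tt j|.
Proof.
move=> e e0; have [_ dg _] := g_C1.
have der (j : J) : is_derive (tt j) 1 (fun s : R => dotp (nu j) (g s)) (gcurv j).
  have dgj := dg (tt j) (jpoint_itv n_gt0 t0 tn t_lt j).
  have E : (fun s : R => dotp (nu j) (g s)) = \sum_(i < M) (nu j i 0 \*: (fun s => g s i 0)).
    by apply/funext => s; rewrite fct_sumE dotpE; apply: eq_bigr => i _.
  rewrite E (_ : gcurv j = \sum_(i < M) nu j i 0 *: derive1 g (tt j) i 0); last first.
    by rewrite /gcurv dotpE; apply: eq_bigr.
  apply: is_derive_sum => i; apply: is_deriveZ.
  apply: DeriveDef; first by move/derivable_mxP : dgj; apply.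
  by rewrite derive1E derive_mx// mxE.
have /choice[r Hr] : forall j : J, exists r, 0 < r /\ forall y, `|y| <= r ->
    `|dotp (nu j) (g (tt j + y)) - gslope j - gcurv j * y| <= e * `|y|.
  by move=> j; have [r ? ?] := is_derive_little_o (der j) e0; exists r.
have [r1 r10 Hr1] := fin_min_gt0 (fun j => (Hr j).1).
exists r1 => // j s sr; have := (Hr j).2 (s - tt j) (le_trans sr (Hr1 j)).
by rewrite subrKC.
Qed.

Definition moment (th : J -> R -> R) := \sum_j Int T (fun s => `|th j s| * `|s - tt j|).

Lemma intg_moment (f : R -> R) x : intg T f -> intg T (fun s => f s * (s - x)).
Proof.
move=> If; apply: intg_continuous_mul => //.
by move=> s; apply: cvgB; [exact: cvg_id|exact: cvg_cst].
Qed.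

Lemma intg_abs_moment (f : R -> R) x : intg T f -> intg T (fun s => `|f s| * `|s - x|).
Proof.
move=> If; have := intg_norm (intg_moment x If).
by apply: eq_intg => s _; rewrite normrM.
Qed.

(** The quadratic terms leave an error proportional to the squared mass, and linearizing the
    gradient at [tt j] leaves one proportional to the moment. A short profile placed away from its
    jump has a moment far larger than its squared mass, so both are kept. *)
Lemma local_expansion e : 0 < e -> exists2 r, 0 < r & forall th : J -> R -> R,
  (forall j, intg T (th j)) -> (forall j s, r < `|s - tt j| -> th j s = 0) ->
  mass T th <= r ->
  `|F (u + comb nu th) - F u
    - \sum_j (gslope j * Int T (th j) + gcurv j * Int T (fun s => th j s * (s - tt j)))
    - 2^-1 * \sum_j \sum_k hcoef j k * Int T (th j) * Int T (th k)|
  <= e * (mass T th ^+ 2 + moment th).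
Proof.
move=> e0; have [g_cont _ _] := g_C1.
have [r1 r10 H1] := @expansion R M T T_gt0 F F' F'' u g H F_twice inL1_u g_gradient g_cont
  H_hessian H_cont J tt nu (jpoint_itv n_gt0 t0 tn t_lt) e e0.
have [r2 r20 H2] := gradient_diff e0.
exists (Num.min r1 r2) => [|th Ith th0]; first by rewrite lt_min r10.
rewrite le_min => /andP[m1 _].
have th1 j s : r1 < `|s - tt j| -> th j s = 0.
  by move=> h; apply: th0; rewrite gt_min h.
have th2 j s : r2 < `|s - tt j| -> th j s = 0.
  by move=> h; apply: th0; rewrite gt_min h orbT.
have := H1 th Ith th1 m1.
set A := \sum_j Int T _; set B := \sum_j (_ + _); set C := 2^-1 * _ => h1.
have h2 : `|A - B| <= e * moment th.
  rewrite /A /B -sumrB (le_trans (ler_norm_sum _ _ _))// /moment mulr_sumr ler_sum// => j _.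
  have Ig : intg T (fun s => th j s * dotp (nu j) (g s)).
    by apply: intg_within_mul => //; exact: within_dotp.
  have Im := intg_moment (tt j) (Ith j); have Ia := intg_abs_moment (tt j) (Ith j).
  rewrite -(IntZ _ (Ith j)) -(IntZ _ Im) -(IntZ _ Ia).
  rewrite -(IntD (intgZ _ (Ith j)) (intgZ _ Im)).
  rewrite -(IntB Ig (intgD (intgZ _ (Ith j)) (intgZ _ Im))).
  have If : intg T (fun s => th j s * dotp (nu j) (g s) - (gslope j * th j s + gcurv j * (th j s * (s - tt j)))).
    by apply: intgB => //; apply: intgD; apply: intgZ.
  apply: (le_trans (le_norm_Int If)); apply: le_Int.
  - exact: intg_norm.
  - exact: intgZ.
  move=> s _.
  rewrite (_ : _ - _ = th j s * (dotp (nu j) (g s) - gslope j - gcurv j * (s - tt j))); last by ring.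
  rewrite normrM [e * _]mulrCA.
  have [sr|sr] := ltP r2 `|s - tt j|; first by rewrite th2// normr0 !mul0r.
  by rewrite ler_wpM2l// H2.
rewrite mulrDr; move: h1 h2; rewrite !ler_norml.
by move=> /andP[? ?] /andP[? ?]; apply/andP; split; lra.
Qed.

End LocalExpansion.

(** * Necessity *)

Lemma second_order (R : realType) (c m Q : R) : 0 <= c ->
  (forall e, 0 < e -> exists2 s0, 0 < s0 & forall s, 0 < s -> s <= s0 ->
    c * s ^+ 2 <= s * m + s ^+ 2 / 2 * Q + e * s ^+ 2) ->
  0 <= m /\ (m = 0 -> c <= Q / 2).
Proof.
move=> c0 H; split.
  rewrite leNgt; apply/negP => m0; have [s0 s00 Hs] := H 1 ltr01.
  have Q0 : 0 < 2 * (`|Q| + 1) by rewrite mulr_gt0// ltr_wpDl.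
  (* Small enough that [s * (Q / 2 + 1)] is at most half of [- m], which makes the right-hand side
     negative. *)
  pose s := Num.min s0 (- m / (2 * (`|Q| + 1))).
  have sp : 0 < s by rewrite lt_min s00 divr_gt0// oppr_gt0.
  have := Hs s sp; rewrite ge_min lexx => /(_ isT).
  have : s * (2 * (`|Q| + 1)) <= - m by rewrite -ler_pdivlMr// ge_min lexx orbT.
  have h1 := ler_norm Q; have h2 := normr_ge0 Q; have h3 : 0 <= c * s by rewrite mulr_ge0// ltW.
  move=> h4; rewrite (_ : _ + _ + _ = s * (m + s * (Q / 2 + 1))); last by field.
  rewrite (_ : c * _ = s * (c * s)); last by ring.
  rewrite ler_pM2l// leNgt => /negP; apply; apply: (lt_le_trans _ h3).
  have h5 : s * (Q / 2 + 1) <= s * (`|Q| + 1) by rewrite ler_pM2l//; lra.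
  by lra.
move=> m0; apply/ler_addgt0Pr => e e0; have [s0 s00 Hs] := H e e0.
have := Hs s0 s00 (lexx _); rewrite m0 mulr0 add0r.
rewrite (_ : _ + _ = (Q / 2 + e) * s0 ^+ 2); last by field.
by rewrite ler_pM2r// exprn_gt0.
Qed.

Section Necessity.
Context {R : realType} {M : nat}.
Variables (T : R) (V : {fset 'cV[int]_M}).
Local Notation fct := (R -> 'cV[R]_M).
Variables (F : fct -> R) (F' : fct -> fct -> R) (F'' : fct -> fct -> fct -> R).
Variables (u : fct) (n : nat) (a : nat -> 'cV[int]_M) (t : nat -> R).
Variables (g : fct) (H : R -> R -> 'M[R]_M).
Hypothesis T_gt0 : 0 < T.
Hypothesis F_eqL1 : forall v w, inL1 T v -> inL1 T w -> eqL1 T v w -> F v = F w.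
Hypotheses (n_gt0 : (0 < n)%N) (t0 : t 0%N = 0) (tn : t n = T)
  (t_lt : forall j, (j < n)%N -> t j < t j.+1)
  (aV : forall j, (1 <= j <= n)%N -> a j \in V)
  (a_neq : forall j, (1 <= j < n)%N -> a j != a j.+1).
Hypotheses (uU : Uad T V u) (u_step : eqL1 T u (step_fun n a t)).
Hypotheses (F_twice : twice_frechet T F F' F'') (g_gradient : is_gradient T (F' u) g)
  (g_C1 : C1 T g) (H_hessian : is_hessian T (F'' u) H)
  (H_cont : {within `[0, T] `*` `[0, T], continuous (fun x : R * R => H x.1 x.2)}).
Variable d : R.
Hypotheses (d_gt0 : 0 < d) (t_gap : forall j, (j < n)%N -> t j + 4 * d <= t j.+1).

Local Notation J := 'I_n.-1.
Local Notation tt := (@jpoint R n t).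
Local Notation nu := (@jheight R M n a).
Local Notation u0 := (@step_stair R M n a t).
Local Notation gslope := (gslope a t g).
Local Notation gcurv := (gcurv a t g).
Local Notation hcoef := (hcoef a t H).
Local Opaque jpoint.

Lemma narrow_bounds (f : R -> R) (j : J) r : 0 < r -> 2 * r <= d -> intg T f ->
  (forall s, `|f s| <= 1) -> (forall s, r < `|s - tt j| -> f s = 0) ->
  Int T (fun s => `|f s|) <= 4 * r /\ Int T (fun s => `|f s| * `|s - tt j|) <= 4 * r ^+ 2.
Proof.
move=> r0 rd If f1 f0; have d0 := d_gt0.
have [b1 b2] := jpoint_bounds n_gt0 t0 tn t_lt t_gap j.
(* The indicator of a window of radius [2 * r]: being half-open, the window of radius [r] would miss
   its right end. *)
pose k s : R := (s < tt j + 2 * r)%R%:R - (s < tt j - 2 * r)%R%:R.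
have Ik : intg T k by apply: intgB; exact: intg_lt.
have k4 : Int T k = 4 * r.
  rewrite /k IntB; try exact: intg_lt.
  by rewrite !Int_lt; lra.
have fk s : `|f s| <= k s.
  have [h|h] := ltP r `|s - tt j|.
    rewrite f0// normr0 /k subr_ge0 ler_nat.
    by case: (ltP s (tt j - 2 * r)) => // h1; have -> : s < tt j + 2 * r by lra.
  move: h; rewrite ler_norml => /andP[h1 h2]; rewrite /k.
  have -> : s < tt j + 2 * r by lra.
  have -> : (s < tt j - 2 * r) = false by apply/negbTE; rewrite -leNgt; lra.
  by rewrite subr0 f1.
split; first by rewrite -k4; apply: le_Int => //; exact: intg_norm.
rewrite (_ : 4 * _ = r * (4 * r)); last by ring.
rewrite -k4 -(IntZ r Ik); apply: le_Int; [exact: intg_abs_moment|exact: intgZ|].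
move=> s _; have [h|h] := ltP r `|s - tt j|.
  by rewrite f0// normr0 mul0r mulr_ge0 ?(ltW r0)// (le_trans _ (fk s)).
by rewrite mulrC ler_pM.
Qed.

Variables (beta eta : R) (p : \bar R).
Hypotheses (beta_gt0 : 0 < beta) (eta_ge0 : 0 <= eta) (p_ge1 : (1 <= p)%E).
Hypothesis growth : exists2 e, 0 < e & forall w, Uad T V w -> normL1 T (w - u) <= e ->
  (objective T F beta p u + (eta / 2 * normL1 T (w - u) ^+ 2)%:E <= objective T F beta p w)%E.

(** The value [eta = 0] encodes local minimality and [eta > 0] quadratic growth, so one argument
    yields both sets of necessary conditions. Competitors without extra variation transfer the
    growth to [F]. *)
Lemma growth_F : exists2 e, 0 < e & forall w, Uad T V w -> normL1 T (w - u) <= e ->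
  (TV T p w <= TV T p u)%E -> F u + eta / 2 * normL1 T (w - u) ^+ 2 <= F w.
Proof.
have [e e0 He] := growth; exists e => // w wU we wTV.
have := He w wU we; rewrite /objective.
have TVu := TV_u T_gt0 n_gt0 t0 tn t_lt aV uU u_step d_gt0 t_gap p_ge1.
rewrite TVu in wTV *.
case: (TV T p w) wTV => [x| |]//; last first.
  by rewrite (gt0_muleNy (beta_gt0 : (0 < beta%:E)%E)) addeNy -!EFinM -!EFinD leeNy_eq.
rewrite lee_fin => h; rewrite -!EFinM -!EFinD lee_fin.
set S := \sum_j _ in h *; have : beta * x <= beta * S by rewrite ler_pM2l.
by set X := eta / 2 * _; lra.
Qed.

Section Shift.
Variables (lam A B : J -> R) (L kappa : R).
Hypotheses (L_gt0 : 0 < L) (lam01 : forall k, 0 <= lam k <= 1)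
  (A_le : forall k, `|A k| <= L) (B_le : forall k, `|B k| <= L) (kappa_ge0 : 0 <= kappa).
Local Notation th s := (shift_profile t lam (fun k => s * A k) (fun k => s * B k)).
Hypothesis shift_V : forall s (k : J) x, 0 < s -> setV V ((toR (a k.+2) : 'cV[R]_M) +
  (lam k * (x < tt k + s * A k)%R%:R + (1 - lam k) * (x < tt k + s * B k)%R%:R) *: nu k).
Hypothesis shift_norm : forall s, 0 < s -> s * L <= d ->
  kappa * s <= normL1 T (comb nu (th s)).

Let m k := lam k * A k + (1 - lam k) * B k.
Let q k := lam k * A k ^+ 2 + (1 - lam k) * B k ^+ 2.

Lemma shift_expansion e : 0 < e -> exists2 s0, 0 < s0 & forall s, 0 < s -> s <= s0 ->
  eta / 2 * kappa ^+ 2 * s ^+ 2 <= s * (\sum_j gslope j * m j) +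
    s ^+ 2 / 2 * (\sum_j gcurv j * q j + \sum_j \sum_k hcoef j k * m j * m k) + e * s ^+ 2.
Proof.
have d0 := d_gt0; have L0 := L_gt0.
move=> e0; have [e1 e10 Hg] := growth_F.
(* The first two terms bound the squared mass and the moment of the perturbation, each divided by
   [s ^+ 2]; the 1 makes [C] positive. *)
pose C := 16 * (n.-1)%:R ^+ 2 * L ^+ 2 + 4 * (n.-1)%:R * L ^+ 2 + 1 : R.
have nn : 0 <= (n.-1)%:R :> R by [].
have C0 : 0 < C by rewrite ltr_wpDl// addr_ge0 ?mulr_ge0 ?(ltW L0).
have eC : 0 < e / C by rewrite divr_gt0.
have [r r0 Hr] := local_expansion a T_gt0 n_gt0 t0 tn t_lt uU F_twice g_gradient g_C1 H_hessian H_cont eC.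
have [D D0 HD] := normL1_comb T nu.
(* The four bounds keep the support within [r], give [narrow_bounds] its room, keep the mass below
   [r], and keep the competitor within [e1] of [u]. *)
pose s0 := Num.min (Num.min (r / L) (d / (2 * L)))
  (Num.min (r / (4 * (n.-1)%:R * L + 1)) (e1 / (D * (4 * (n.-1)%:R * L + 1)))).
have X0 : 0 < 4 * (n.-1)%:R * L + 1 by rewrite ltr_wpDl// !mulr_ge0// ltW.
exists s0 => [|s sp]; first by rewrite !lt_min !divr_gt0// mulr_gt0.
rewrite !le_min ler_pdivlMr// ler_pdivlMr ?mulr_gt0// ler_pdivlMr// ler_pdivlMr ?mulr_gt0//.
move=> /andP[/andP[sr sd] /andP[sm se]].
have sL0 : 0 < s * L by rewrite mulr_gt0.
have sLd : s * L <= d by lra.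
have alL k : `|s * A k| <= s * L by rewrite normrM (gtr0_norm sp) ler_pM2l.
have beL k : `|s * B k| <= s * L by rewrite normrM (gtr0_norm sp) ler_pM2l.
have ald k : `|s * A k| <= d := le_trans (alL k) sLd.
have bed k : `|s * B k| <= d := le_trans (beL k) sLd.
have Ith := intg_shift T t lam (fun k => s * A k) (fun k => s * B k).
have th0 j x : s * L < `|x - tt j| -> th s j x = 0.
  by move=> h; apply: shift_eq0; apply: le_lt_trans h; rewrite ge_max alL beL.
have sd2 : 2 * (s * L) <= d by rewrite mulrCA.
have nb j := narrow_bounds sL0 sd2 (Ith j) (shift_bound t _ _ lam01 j) (th0 j).
have mass_s : mass T (th s) <= s * (4 * (n.-1)%:R * L).
  rewrite (_ : _ * _ = \sum_(j < n.-1) 4 * (s * L)); last first.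
    by rewrite sumr_const card_ord -mulr_natr; ring.
  by apply: ler_sum => j _; have [] := nb j.
have moment_s : moment T t (th s) <= 4 * (n.-1)%:R * L ^+ 2 * s ^+ 2.
  rewrite (_ : _ * _ = \sum_(j < n.-1) 4 * (s * L) ^+ 2); last first.
    by rewrite sumr_const card_ord -mulr_natr; ring.
  by apply: ler_sum => j _; have [] := nb j.
have wE : eqL1 T (shift_stair a t lam (fun k => s * A k) (fun k => s * B k)) (u0 + comb nu (th s)).
  by apply: aeTW => x _; rewrite shift_stairE.
have wU := Uad_shift T_gt0 n_gt0 t0 tn t_lt aV d_gt0 t_gap ald bed (fun k x => shift_V k x sp).
have Lw : inL1 T (shift_stair a t lam (fun k => s * A k) (fun k => s * B k)) by have [[]] := wU.
have wN := perturbed_norm n_gt0 t0 tn t_lt uU u_step Lw Ith wE.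
have wF := perturbed_F F_eqL1 n_gt0 t0 tn t_lt uU u_step Lw Ith wE.
have sX : s * (4 * (n.-1)%:R * L) <= s * (4 * (n.-1)%:R * L + 1) by rewrite ler_pM2l// lerDl.
have n1 : normL1 T (comb nu (th s)) <= e1.
  apply: (le_trans (HD _ Ith)); apply: le_trans se.
  by rewrite mulrCA ler_pM2l// (le_trans mass_s).
have TVw := TV_shift_le T_gt0 a n_gt0 t0 tn t_lt d_gt0 t_gap lam01 ald bed p_ge1.
rewrite -wN in n1.
rewrite -(TV_u T_gt0 n_gt0 t0 tn t_lt aV uU u_step d_gt0 t_gap p_ge1) in TVw.
have h1 := Hg _ wU n1 TVw; rewrite wN wF in h1.
have thr j x : r < `|x - tt j| -> th s j x = 0.
  by move=> h; apply: th0; apply: le_lt_trans h.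
have := Hr (th s) Ith thr (le_trans mass_s (le_trans sX sm)).
rewrite ler_norml => /andP[_ h2].
have h3 : e / C * (mass T (th s) ^+ 2 + moment T t (th s)) <= e * s ^+ 2.
  rewrite -mulrA ler_pM2l// mulrC ler_pdivrMr//.
  have : mass T (th s) ^+ 2 <= (s * (4 * (n.-1)%:R * L)) ^+ 2.
    by rewrite lerXn2r// ?nnegrE ?mass_ge0// mulr_ge0 ?mulr_ge0 ?(ltW L0) ?(ltW sp).
  have : 0 <= s ^+ 2 by exact: sqr_ge0.
  rewrite /C; lra.
have h4 : (kappa * s) ^+ 2 <= normL1 T (comb nu (th s)) ^+ 2.
  rewrite lerXn2r ?nnegrE ?normL1_ge0//; first by rewrite mulr_ge0 ?kappa_ge0// ltW.
  exact: shift_norm.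
have h5 : eta / 2 * (kappa * s) ^+ 2 <= eta / 2 * normL1 T (comb nu (th s)) ^+ 2.
  by rewrite ler_wpM2l// divr_ge0.
have E1 : \sum_j (gslope j * Int T (th s j) + gcurv j * Int T (fun x => th s j x * (x - tt j))) =
    s * (\sum_j gslope j * m j) + s ^+ 2 / 2 * \sum_j gcurv j * q j.
  rewrite !mulr_sumr -big_split/=; apply: eq_bigr => j _.
  rewrite (Int_shift n_gt0 t0 tn t_lt d_gt0 t_gap lam ald bed).
  rewrite (Int_shift_affine T_gt0 n_gt0 t0 tn t_lt d_gt0 t_gap lam ald bed).
  by rewrite /m /q; field.
have E2 : \sum_j \sum_k hcoef j k * Int T (th s j) * Int T (th s k) =
    s ^+ 2 * \sum_j \sum_k hcoef j k * m j * m k.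
  rewrite !mulr_sumr; apply: eq_bigr => j _; rewrite mulr_sumr; apply: eq_bigr => k _.
  rewrite !(Int_shift n_gt0 t0 tn t_lt d_gt0 t_gap lam ald bed).
  by rewrite /m; ring.
move: h1 h2; rewrite E1 E2 => h1 h2.
rewrite exprMn in h4 h5.
rewrite mulrDr; lra.
Qed.

Lemma shift_conditions : 0 <= \sum_j gslope j * m j /\
  (\sum_j gslope j * m j = 0 ->
   eta * kappa ^+ 2 <= \sum_j gcurv j * q j + \sum_j \sum_k hcoef j k * m j * m k).
Proof.
have c0 : 0 <= eta / 2 * kappa ^+ 2 by rewrite mulr_ge0 ?sqr_ge0// divr_ge0.
have [h1 h2] := second_order c0 shift_expansion.
by split=> // /h2; lra.
Qed.

End Shift.
Lemma setV_ends (k : J) (b : bool) : setV V ((toR (a k.+2) : 'cV[R]_M) + b%:R *: nu k).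
Proof.
have kn := jpoint_lt n_gt0 k; case: b; last by rewrite scale0r addr0; exact: (setV_a aV).
by rewrite scale1r /jheight /jump subrKC; apply: (setV_a aV); exact: ltnW.
Qed.

(** For [lam = 1] the jumps move with velocities [tau], and the second-order term is the quadratic
    form at [tau]. The index [j] selects the profile whose integral bounds the distance to [u] from
    below. *)
Lemma translation_conditions (tau : J -> R) (j : J) : 0 <= \sum_k gslope k * tau k /\
  (\sum_k gslope k * tau k = 0 ->
   eta * tau j ^+ 2 <= \sum_k gcurv k * tau k ^+ 2 + \sum_i \sum_k hcoef i k * tau i * tau k).
Proof.
pose L := 1 + \sum_k `|tau k|.
have L0 : 0 < L by rewrite ltr_wpDr// sumr_ge0.
have tauL k : `|tau k| <= L.
  by rewrite /L (bigD1 k)//= addrCA lerDl addr_ge0// sumr_ge0.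
have lam01 (k : J) : 0 <= (1 : R) <= 1 by rewrite ler01 lexx.
have sV s (k : J) x : 0 < s -> setV V ((toR (a k.+2) : 'cV[R]_M) +
    (1 * (x < tt k + s * tau k)%R%:R + (1 - 1) * (x < tt k + s * tau k)%R%:R) *: nu k).
  by move=> _; rewrite subrr mul0r addr0 mul1r; exact: setV_ends.
have sN s : 0 < s -> s * L <= d -> `|tau j| * s <=
    normL1 T (comb nu (shift_profile t (fun=> 1) (fun k => s * tau k) (fun k => s * tau k))).
  move=> s0 sL.
  have tL k : `|s * tau k| <= d.
    by apply: le_trans sL; rewrite normrM (gtr0_norm s0) ler_pM2l.
  have Ith := intg_shift T t (fun=> 1) (fun k => s * tau k) (fun k => s * tau k).
  apply: (le_trans _ (normL1_comb_ge n_gt0 t_lt aV a_neq d_gt0 t_gap j Ith _)); last first.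
    by move=> k x h; apply: shift_eq0; apply: le_lt_trans h; rewrite ge_max !tL.
  apply: le_trans (le_norm_Int (Ith j)).
  rewrite (Int_shift n_gt0 t0 tn t_lt d_gt0 t_gap (fun=> 1) tL tL).
  by rewrite subrr mul0r addr0 mul1r normrM (gtr0_norm s0) mulrC.
have [h1 h2] := shift_conditions L0 lam01 tauL tauL (normr_ge0 _) sV sN.
have E k : 1 * tau k + (1 - 1) * tau k = tau k by ring.
have E2 k : 1 * tau k ^+ 2 + (1 - 1) * tau k ^+ 2 = tau k ^+ 2 by ring.
rewrite (eq_bigr _ (fun k _ => congr1 _ (E k))) in h1 h2.
rewrite (eq_bigr _ (fun k _ => congr1 _ (E2 k))) real_normK ?num_real// in h2.
split=> // /h2; congr (_ <= _ + _); apply: eq_bigr => i _; apply: eq_bigr => k _.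
by rewrite !E.
Qed.

Lemma slope_eq0 (j : J) : gslope j = 0.
Proof.
have S (c : R) : \sum_k gslope k * (if k == j then c else 0) = gslope j * c.
  rewrite (bigD1 j)//= eqxx big1 ?addr0// => k /negbTE ->; exact: mulr0.
have [h1 _] := translation_conditions (fun k => if k == j then 1 else 0) j.
have [h2 _] := translation_conditions (fun k => if k == j then -1 else 0) j.
move: h1 h2; rewrite !S mulr1 mulrN1 oppr_ge0 => h1 h2.
by apply/eqP; rewrite eq_le h1 h2.
Qed.

Lemma quad_growth (tau : J -> R) (j : J) :
  eta * tau j ^+ 2 <= \sum_k gcurv k * tau k ^+ 2 + \sum_i \sum_k hcoef i k * tau i * tau k.
Proof.
have [_] := translation_conditions tau j; apply.
by rewrite big1// => k _; rewrite slope_eq0 mul0r.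
Qed.

(** The part [l] of the jump moves right by [s * (1 - l)], the rest left by [s * l], and in between
    the function takes the intermediate value in [V]. The velocities balance the mean to zero, so
    only the curvature term [l * (1 - l)] survives. *)
Lemma split_growth (j : J) (l : R) : 0 < l < 1 ->
  setV V (l *: toR (a j.+1) + (1 - l) *: toR (a j.+2)) ->
  eta * (l * (1 - l) / 2) ^+ 2 <= gcurv j * (l * (1 - l)).
Proof.
move=> /andP[l0 l1] lV.
pose lam (k : J) := if k == j then l else 1.
pose A (k : J) := if k == j then 1 - l else 0.
pose B (k : J) := if k == j then - l else 0.
have lam01 k : 0 <= lam k <= 1.
  by rewrite /lam; case: ifP => _; rewrite ?ler01 ?lexx// (ltW l0) ltW.
have A1 k : `|A k| <= 1.
  by rewrite /A; case: ifP => _; rewrite ?normr0// ger0_norm; lra.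
have B1 k : `|B k| <= 1.
  by rewrite /B; case: ifP => _; rewrite ?normr0// normrN ger0_norm; lra.
have ll : 0 < l * (1 - l) by rewrite mulr_gt0// subr_gt0.
have sV s (k : J) x : 0 < s -> setV V ((toR (a k.+2) : 'cV[R]_M) +
    (lam k * (x < tt k + s * A k)%R%:R + (1 - lam k) * (x < tt k + s * B k)%R%:R) *: nu k).
  move=> s0; rewrite /lam /A /B; have [->|_] := eqVneq k j; last first.
    by rewrite subrr mul0r addr0 mul1r; exact: setV_ends.
  have s1 : 0 < s * (1 - l) by rewrite mulr_gt0// subr_gt0.
  have s2 : 0 < s * l by rewrite mulr_gt0.
  case: (ltP x (tt j + s * - l)) => h2.
    have -> : x < tt j + s * (1 - l) by lra.
    by rewrite !mulr1 subrKC; exact: (setV_ends j true).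
  rewrite mulr0 addr0; case: (ltP x _) => h1; last first.
    by rewrite mulr0; exact: (setV_ends j false).
  rewrite mulr1 (_ : _ + _ = l *: toR (a j.+1) + (1 - l) *: toR (a j.+2))//.
  by rewrite /jheight /jump scalerBr scalerBl scale1r addrCA.
have sN s : 0 < s -> s * 1 <= d -> l * (1 - l) / 2 * s <=
    normL1 T (comb nu (shift_profile t lam (fun k => s * A k) (fun k => s * B k))).
  rewrite mulr1 => s0 sd.
  have As k : `|s * A k| <= s by rewrite normrM (gtr0_norm s0) ler_piMr// ltW.
  have Bs k : `|s * B k| <= s by rewrite normrM (gtr0_norm s0) ler_piMr// ltW.
  have Ad k := le_trans (As k) sd; have Bd k := le_trans (Bs k) sd.
  set th := shift_profile _ _ _ _.
  have Ith : forall k, intg T (th k) by exact: intg_shift.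
  have th0 k x : s < `|x - tt k| -> th k x = 0.
    by move=> h; apply: shift_eq0; apply: le_lt_trans h; rewrite ge_max As Bs.
  apply: (le_trans _ (normL1_comb_ge n_gt0 t_lt aV a_neq d_gt0 t_gap j Ith _)); last first.
    by move=> k x h; apply: th0; apply: le_lt_trans h.
  (* The profile has mean zero, so its mass is bounded below through its first moment: on its
     support the distance to the jump is at most [s]. *)
  have E := Int_shift_affine T_gt0 n_gt0 t0 tn t_lt d_gt0 t_gap lam Ad Bd j.
  rewrite -(ler_pM2l s0) -(IntZ s (intg_norm (Ith j))).
  apply: (@le_trans _ _ (Int T (fun x => th j x * (x - tt j)))).
    by rewrite E /lam /A /B eqxx le_eqVlt; apply/orP; left; apply/eqP; field.
  apply: le_Int; [exact: intg_moment|by apply: intgZ; exact: intg_norm|move=> x _].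
  have [h|h] := ltP s `|x - tt j|; first by rewrite th0// mul0r normr0 mulr0.
  by apply: (le_trans (ler_norm _)); rewrite normrM mulrC ler_wpM2r.
have k0 : 0 <= l * (1 - l) / 2 by rewrite divr_ge0// ltW.
have [_] := shift_conditions ltr01 lam01 A1 B1 k0 sV sN.
have m0 k : lam k * A k + (1 - lam k) * B k = 0.
  by rewrite /lam /A /B; case: ifP => _; ring.
rewrite big1 => [/(_ erefl)|k _]; last by rewrite m0 mulr0.
rewrite (bigD1 j)//= big1 => [|k /negbTE kj]; last first.
  by rewrite /lam /A /B kj; ring.
rewrite big1 => [|i _]; last by apply: big1 => k _; rewrite !m0 mulr0.
by rewrite !addr0; congr (_ <= _ * _); rewrite /lam /A /B eqxx; ring.
Qed.

End Necessity.

(** * Sufficiency *)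

Section Bathtub.
Context {R : realType}.
Variables (T : R) (th : R -> R) (x : R).
Hypothesis T_gt0 : 0 < T.
Hypothesis Ith : intg T th.

Section Sign.
Hypothesis th_sign : aeT T (fun s => if s < x then -1 <= th s <= 0 else 0 <= th s <= 1).

Lemma sign_moment : Int T (fun s => th s * (s - x)) = Int T (fun s => `|th s| * `|s - x|).
Proof.
apply: ae_eq_Int; [exact: (intg_meas (intg_moment T_gt0 x Ith))|exact: (intg_meas (intg_abs_moment T_gt0 x Ith))|].
apply: aeT_imp th_sign => s _; case: ltP => sx /andP[h1 h2].
  by rewrite ler0_norm// ltr0_norm ?subr_lt0// mulrNN.
by rewrite ger0_norm// ger0_norm ?subr_ge0.
Qed.

(* Among all profiles with given masses [A], [B] on the two sides of [x], the
   first absolute moment is least for the indicator of [x - A, x + B]. *)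
Lemma bathtub : Int T (fun s => `|th s|) <= x -> x + Int T (fun s => `|th s|) <= T ->
  (Int T th ^+ 2 + Int T (fun s => `|th s|) ^+ 2) / 4 <= Int T (fun s => `|th s| * `|s - x|).
Proof.
set m := Int T th; set K := Int T (fun s => `|th s|) => Kx xK.
have mK : `|m| <= K by exact: le_norm_Int.
have := ler_norm m; have := ler_norm (- m); rewrite normrN => m1 m2.
(* The masses of [|th|] on the left and on the right of [x]. *)
pose A := (K - m) / 2; pose B := (K + m) / 2.
have A0 : 0 <= A by rewrite /A; lra.
have B0 : 0 <= B by rewrite /B; lra.
pose q (b c s : R) := c * (s < b)%R%:R - (s < b)%R%:R * (s - x).
have Iq b c : intg T (q b c).
  apply: intgB; first by apply: intgZ; exact: intg_lt.
  by apply: intg_moment => //; exact: intg_lt.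
have qE b c : 0 <= b -> b <= T -> Int T (q b c) = c * b - ((b - x) ^+ 2 / 2 - x ^+ 2 / 2).
  move=> b0 bT; rewrite /q IntB; last 2 first.
  - by apply: intgZ; exact: intg_lt.
  - by apply: intg_moment => //; exact: intg_lt.
  by rewrite IntZ ?Int_lt ?Int_lt_affine//; exact: intg_lt.
(* A pointwise Lagrangian minorant with multipliers [A] on the left and [B] on the right: the first
   term is [A * |th|] or [B * |th|], and the truncated distances subtracted from it are the largest
   gain possible under [|th| <= 1]. *)
pose k s := 2^-1 * (K * `|th s| + m * th s) - (q (x + B) B s - q x B s) - (q (x - A) (- A) s - q x (- A) s).
have In : intg T (fun s => `|th s|) by exact: intg_norm.
have Ia : intg T (fun s => K * `|th s| + m * th s) by apply: intgD; exact: intgZ.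
have Ib : intg T (fun s => q (x + B) B s - q x B s) by exact: intgB.
have Ic : intg T (fun s => q (x - A) (- A) s - q x (- A) s) by exact: intgB.
have Id : intg T (fun s => 2^-1 * (K * `|th s| + m * th s)) by exact: intgZ.
have kE : Int T k = (m ^+ 2 + K ^+ 2) / 4.
  rewrite /k (IntB (intgB Id Ib) Ic) (IntB Id Ib) (IntZ _ Ia).
  rewrite (IntD (intgZ _ In) (intgZ _ Ith)) !IntZ// -/m -/K.
  rewrite (IntB (Iq (x + B) B) (Iq x B)) (IntB (Iq (x - A) (- A)) (Iq x (- A))) !qE; by rewrite /A /B; lra.
rewrite -kE; apply: ae_le_Int.
- exact: intgB (intgB Id Ib) Ic.
- exact: (intg_abs_moment T_gt0 x Ith).
apply: aeT_imp th_sign => s _; rewrite /k /q.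
case: (ltP s x) => sx /andP[h1 h2].
  rewrite ler0_norm// (ltr0_norm (_ : s - x < 0)) ?subr_lt0//.
  have -> : s < x + B by lra.
  rewrite (_ : K = A + B); last by rewrite /A /B; lra.
  rewrite (_ : m = B - A); last by rewrite /A /B; lra.
  have [h|h] := ltP s (x - A).
    have : 0 <= - th s * (x - A - s) by rewrite mulr_ge0//; lra.
    by move=> /=; lra.
  have : 0 <= (1 + th s) * (s - (x - A)) by rewrite mulr_ge0//; lra.
  by move=> /=; lra.
rewrite ger0_norm// (ger0_norm (_ : 0 <= s - x)) ?subr_ge0//.
have -> : (s < x - A) = false by apply/negbTE; rewrite -leNgt; lra.
rewrite (_ : K = A + B); last by rewrite /A /B; lra.
rewrite (_ : m = B - A); last by rewrite /A /B; lra.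
have [h|h] := ltP s (x + B).
  have : 0 <= (1 - th s) * (x + B - s) by rewrite mulr_ge0//; lra.
  by move=> /=; lra.
have : 0 <= th s * (s - (x + B)) by rewrite mulr_ge0//; lra.
by move=> /=; lra.
Qed.

End Sign.

Lemma step_moment b : 0 <= b <= T -> 0 <= x <= T ->
  aeT T (fun s => th s = (s < b)%R%:R - (s < x)%R%:R) ->
  Int T (fun s => th s * (s - x)) = Int T th ^+ 2 / 2.
Proof.
move=> /andP[b0 bT] /andP[x0 xT] thE.
have Ik : intg T (fun s => (s < b)%R%:R - (s < x)%R%:R) by apply: intgB; exact: intg_lt.
have -> : Int T th = b - x.
  rewrite (ae_eq_Int (intg_meas Ith) (intg_meas Ik) thE) IntB; try exact: intg_lt.
  by rewrite !Int_lt.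
have Im c : intg T (fun s => (s < c)%R%:R * (s - x)) by apply: intg_moment => //; exact: intg_lt.
rewrite (@ae_eq_Int _ _ _ (fun s => (s < b)%R%:R * (s - x) - (s < x)%R%:R * (s - x))).
- by rewrite IntB// !Int_lt_affine//; field.
- exact: (intg_meas (intg_moment T_gt0 x Ith)).
- apply: intg_meas; exact: intgB.
- by apply: aeT_imp thE => s _ ->; rewrite mulrBl.
Qed.

End Bathtub.

(** * Coercivity of the quadratic form *)

Lemma ler_coord_norm (R : realType) (k : nat) (v : 'rV[R]_k) j : `|v 0 j| <= `|v|.
Proof.
rewrite [leRHS]/Num.Def.normr/= mx_normrE.
exact: (le_bigmax _ (fun ij : 'I_1 * 'I_k => `|v ij.1 ij.2|) (0, j)).
Qed.

(** The minimum over the unit sphere of the maximum norm, extended by homogeneity. This norm gives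
    the bound for each coordinate separately. *)
Lemma quadratic_pos_min (R : realType) (k : nat) (f : 'rV[R]_k -> R) :
  continuous f -> (forall (c : R) (v : 'rV[R]_k), f (c *: v) = c ^+ 2 * f v) ->
  (forall v, v != 0 -> 0 < f v) ->
  exists2 c : R, 0 < c & forall (v : 'rV[R]_k) j, c * v 0 j ^+ 2 <= f v.
Proof.
move=> cf fZ f0.
have fge (v : 'rV[R]_k) : v != 0 -> `| `|v|^-1 *: v| = 1.
  move=> v0; rewrite normrZ normfV normr_id mulVf//.
  by rewrite normr_eq0.
have f00 : f 0 = 0 by rewrite -[X in f X](scale0r 0) fZ expr0n mul0r.
(* In dimension 0 the sphere is empty and has no minimum. *)
have [[v1 v10]|none] := pselect (exists v : 'rV[R]_k, v != 0); last first.
  exists 1 => // v j; have -> : v = 0 by apply/eqP/negPn/negP => h; apply: none; exists v.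
  by rewrite f00 mxE expr0n mulr0.
pose A := [set v : 'rV[R]_k | `|v| = 1].
have A0 : A !=set0 by exists (`|v1|^-1 *: v1); exact: fge.
have cA : compact A.
  apply: bounded_closed_compact.
    exists 1; split => // x x1 v /= ->; exact: ltW.
  apply: (@preimage_closed _ _ (fun v : 'rV[R]_k => `|v|) [set 1]); last exact: closed_eq.
  by move=> v _; exact: norm_continuous.
have [c cA' Hc] := EVT_min_rV A0 cA (continuous_subspaceT cf).
have c0 : c != 0.
  by apply/eqP => cE; move: cA'; rewrite inE /A /= cE normr0 => /eqP; rewrite eq_sym oner_eq0.
exists (f c) => [|v j]; first exact: f0.
have [->|v0] := eqVneq v 0; first by rewrite f00 mxE expr0n mulr0.
have -> : f v = `|v| ^+ 2 * f (`|v|^-1 *: v).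
  by rewrite -fZ scalerA divff ?scale1r// normr_eq0.
rewrite mulrC; apply: ler_pM => //; rewrite ?sqr_ge0 ?(ltW (f0 _ c0))//.
  rewrite -real_normK ?num_real// lerXn2r ?nnegrE//; exact: ler_coord_norm.
by apply: Hc; rewrite inE /A /=; exact: fge.
Qed.

Section QuadLower.
Context {R : realType} (k : nat) (P : 'I_k -> Prop) (b : 'I_k -> R) (h : 'I_k -> 'I_k -> R).
Hypothesis b_gt0 : forall j, P j -> 0 < b j.
Hypothesis bh_gt0 : forall v : 'rV[R]_k, v != 0 ->
  0 < \sum_j b j * v 0 j ^+ 2 + \sum_i \sum_j h i j * v 0 i * v 0 j.

(* With [D j = Q j - m j ^+ 2 / 2], the left-hand side splits into half the
   quadratic form at [m] and [\sum_j b j * D j], where [D j] vanishes off [P]. *)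
Lemma quad_lower : exists2 c : R, 0 < c & forall m K Q : 'I_k -> R,
  (forall j, `|m j| <= K j) -> (forall j, (m j ^+ 2 + K j ^+ 2) / 4 <= Q j) ->
  (forall j, ~ P j -> Q j = m j ^+ 2 / 2) ->
  c * \sum_j (K j ^+ 2 + Q j) <=
    \sum_j b j * Q j + 2^-1 * \sum_i \sum_j h i j * m i * m j.
Proof.
pose f (v : 'rV[R]_k) := \sum_j b j * v 0 j ^+ 2 + \sum_i \sum_j h i j * v 0 i * v 0 j.
have cc j : continuous (fun v : 'rV[R]_k => v 0 j) by exact: coord_continuous.
have cf : continuous f.
  have c1 : continuous (fun v : 'rV[R]_k => \sum_j b j * v 0 j ^+ 2).
    apply: continuous_sum => j x.
    exact: (cvgM (cvg_cst (b j)) (cvgM (cc j x) (cc j x))).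
  have c2 : continuous (fun v : 'rV[R]_k => \sum_i \sum_j h i j * v 0 i * v 0 j).
    apply: continuous_sum => i; apply: continuous_sum => j x.
    exact: (cvgM (cvgM (cvg_cst (h i j)) (cc i x)) (cc j x)).
  by move=> v; exact: cvgD (c1 v) (c2 v).
have fZ (c : R) (v : 'rV[R]_k) : f (c *: v) = c ^+ 2 * f v.
  rewrite /f mulrDr !mulr_sumr; congr (_ + _); apply: eq_bigr => i _.
    by rewrite mxE; ring.
  by rewrite mulr_sumr; apply: eq_bigr => j _; rewrite !mxE; ring.
have [c c0 Hc] := quadratic_pos_min cf fZ bh_gt0.
have [g g0 Hg] : exists2 g, 0 < g & forall j, P j -> g <= b j.
  have b1 (j : 'I_k) : 0 < (if `[< P j >] then b j else 1) by case: asboolP => [/b_gt0|_].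
  have [g g0 Hg] := fin_min_gt0 b1.
  by exists g => // j Pj; have := Hg j; rewrite asboolT.
(* The denominators match [K ^+ 2 + Q <= 3 / 2 * m ^+ 2 + 5 * D]: [e] times the right-hand side
   stays below half the quadratic form plus [g * D]. Dividing by [k + 1] pays for summing the
   coordinatewise bound. *)
pose e := Num.min (c / (k%:R + 1) / 3) (g / 5).
have k0 : 0 < k%:R + 1 :> R by rewrite ltr_wpDl.
have e0 : 0 < e by rewrite lt_min !divr_gt0.
exists e => // m K Q mK mQ Qm.
pose D j := Q j - m j ^+ 2 / 2.
have m2 j : m j ^+ 2 <= K j ^+ 2.
  by rewrite -real_normK ?num_real// lerXn2r ?nnegrE//; apply: le_trans (mK j).
have DE j : (K j ^+ 2 - m j ^+ 2) / 4 <= D j by have := mQ j; rewrite /D; lra.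
have fm : c / (k%:R + 1) * \sum_j m j ^+ 2 <=
    \sum_j b j * m j ^+ 2 + \sum_i \sum_j h i j * m i * m j.
  have := bh_gt0.
  have E : f (\row_j m j) = \sum_j b j * m j ^+ 2 + \sum_i \sum_j h i j * m i * m j.
    rewrite /f; congr (_ + _); apply: eq_bigr => i _; first by rewrite mxE.
    by apply: eq_bigr => j _; rewrite !mxE.
  rewrite -E mulrAC ler_pdivrMr// mulr_sumr => _.
  apply: (@le_trans _ _ (\sum_(j < k) f (\row_j m j))).
    by apply: ler_sum => j _; have := Hc (\row_j m j) j; rewrite mxE.
  rewrite sumr_const card_ord -[leLHS]mulr_natr ler_wpM2l// ?lerDl//.
  have [->|v0] := eqVneq (\row_j m j) 0; last exact/ltW/bh_gt0.
  by rewrite -[X in f X](scale0r 0) fZ expr0n mul0r.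
have bD : g * \sum_j D j <= \sum_j b j * D j.
  rewrite mulr_sumr; apply: ler_sum => j _; have [Pj|nPj] := pselect (P j).
    rewrite ler_wpM2r ?Hg//; apply: le_trans (DE j).
    by have := m2 j; lra.
  by rewrite /D (Qm _ nPj) subrr !mulr0.
have -> : \sum_j b j * Q j = 2^-1 * \sum_j b j * m j ^+ 2 + \sum_j b j * D j.
  by rewrite mulr_sumr -big_split/=; apply: eq_bigr => j _; rewrite /D; field.
have KQ : \sum_j (K j ^+ 2 + Q j) <= 3 / 2 * \sum_j m j ^+ 2 + 5 * \sum_j D j.
  rewrite !mulr_sumr -big_split/=; apply: ler_sum => j _.
  by have := DE j; rewrite /D; lra.
have D0 : 0 <= \sum_j D j.
  by apply: sumr_ge0 => j _; apply: le_trans (DE j); have := m2 j; lra.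
have s0 : 0 <= \sum_j m j ^+ 2 by apply: sumr_ge0 => j _; exact: sqr_ge0.
have e1 : e * \sum_j m j ^+ 2 <= c / (k%:R + 1) / 3 * \sum_j m j ^+ 2.
  by rewrite ler_wpM2r// ge_min lexx.
have e2 : e * \sum_j D j <= g / 5 * \sum_j D j by rewrite ler_wpM2r// ge_min lexx orbT.
have e3 : e * \sum_j (K j ^+ 2 + Q j) <= e * (3 / 2 * \sum_j m j ^+ 2 + 5 * \sum_j D j).
  by rewrite ler_wpM2l// ltW.
lra.
Qed.

End QuadLower.

Section Sufficiency.
Context {R : realType} {M : nat}.
Variables (T : R) (V : {fset 'cV[int]_M}).
Local Notation fct := (R -> 'cV[R]_M).
Variables (F : fct -> R) (F' : fct -> fct -> R) (F'' : fct -> fct -> fct -> R).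
Variables (u : fct) (n : nat) (a : nat -> 'cV[int]_M) (t : nat -> R).
Variables (g : fct) (H : R -> R -> 'M[R]_M).
Hypothesis T_gt0 : 0 < T.
Hypothesis F_eqL1 : forall v w, inL1 T v -> inL1 T w -> eqL1 T v w -> F v = F w.
Hypotheses (n_gt0 : (0 < n)%N) (t0 : t 0%N = 0) (tn : t n = T)
  (t_lt : forall j, (j < n)%N -> t j < t j.+1)
  (aV : forall j, (1 <= j <= n)%N -> a j \in V)
  (a_neq : forall j, (1 <= j < n)%N -> a j != a j.+1).
Hypotheses (uU : Uad T V u) (u_step : eqL1 T u (step_fun n a t)).
Hypotheses (F_twice : twice_frechet T F F' F'') (g_gradient : is_gradient T (F' u) g)
  (g_C1 : C1 T g) (H_hessian : is_hessian T (F'' u) H)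
  (H_cont : {within `[0, T] `*` `[0, T], continuous (fun x : R * R => H x.1 x.2)}).
Variable d : R.
Hypotheses (d_gt0 : 0 < d) (t_gap : forall j, (j < n)%N -> t j + 4 * d <= t j.+1).

Local Notation J := 'I_n.-1.
Local Notation tt := (@jpoint R n t).
Local Notation nu := (@jheight R M n a).
Local Notation u0 := (@step_stair R M n a t).
Local Notation gslope := (gslope a t g).
Local Notation gcurv := (gcurv a t g).
Local Notation hcoef := (hcoef a t H).
Local Opaque jpoint.

Variables (beta : R) (p : \bar R) (gam : R).
Hypotheses (F_lsc : lsc T F) (beta_gt0 : 0 < beta) (p_ge1 : (1 <= p)%E).
Let N := suppf (@dual_ball R M p).
Hypothesis N_strict : forall x y, N x + N y <= N (x + y) ->
  exists2 l, 0 <= l <= 1 & y = l *: (x + y).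
Hypotheses (gam_gt0 : 0 < gam)
  (gam_gap : forall x b y, setV V x -> setV V b -> setV V y ->
    N (x - b) + N (b - y) <= N (x - y) + 2 * gam -> N (x - b) + N (b - y) <= N (x - y)).
Hypotheses (slope0 : forall j : J, gslope j = 0)
  (curv_gt0 : forall j : J, inJ (R := R) V n a j.+1 -> 0 < gcurv j)
  (quad_gt0 : forall tau : 'rV[R]_n.-1, tau != 0 ->
    0 < \sum_j gcurv j * tau 0 j ^+ 2 + \sum_i \sum_j hcoef i j * tau 0 i * tau 0 j).

Lemma sqr_sum_le (k : nat) (x : 'I_k -> R) :
  (\sum_j x j) ^+ 2 <= k%:R * \sum_j x j ^+ 2.
Proof.
rewrite expr2 mulr_suml.
apply: (@le_trans _ _ (\sum_i \sum_j 2^-1 * (x i ^+ 2 + x j ^+ 2))).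
  apply: ler_sum => i _; rewrite mulr_sumr; apply: ler_sum => j _.
  by have := sqr_ge0 (x i - x j); lra.
rewrite le_eqVlt; apply/orP; left; apply/eqP.
under eq_bigr => i _ do rewrite -mulr_sumr big_split/= sumr_const card_ord.
rewrite -mulr_sumr big_split/= sumr_const card_ord sumrMnl.
by rewrite -[(\sum_i x i ^+ 2) *+ k]mulr_natl; field.
Qed.

Lemma F_growth : exists2 r, 0 < r & exists2 c, 0 < c & forall w, Uad T V w ->
  normL1 T (w - u) < r -> (TV T p w <= (\sum_j N (nu j) + gam)%:E)%E ->
  F u + c * normL1 T (w - u) ^+ 2 <= F w.
Proof.
have d0 := d_gt0.
have [c c0 Hc] := quad_lower curv_gt0 quad_gt0.
pose N1 : R := n.-1%:R + 1.
have N10 : 0 < N1 by rewrite ltr_wpDl.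
(* The squared mass is at most [N1] times the sum of the squared [K j], so this error consumes at
   most half of the gain from [quad_lower]. The other half gives the growth. *)
have e0 : 0 < c / (2 * N1) by rewrite divr_gt0// mulr_gt0.
have [r1 r10 Hexp] := local_expansion a T_gt0 n_gt0 t0 tn t_lt uU F_twice g_gradient g_C1 H_hessian H_cont e0.
have [D D0 HD] := normL1_comb T nu.
pose r := Num.min d (r1 / N1).
have r0 : 0 < r by rewrite lt_min d0 divr_gt0.
have rd : r <= d by rewrite ge_min lexx.
have near_T j : [/\ 0 <= tt j - r, 0 <= tt j <= T & tt j + r <= T].
  have [b1 b2] := jpoint_bounds n_gt0 t0 tn t_lt t_gap j.
  by split; first lra; [apply/andP; split|]; lra.
have rr1 : N1 * r <= r1 by rewrite mulrC -ler_pdivlMr// ge_min lexx orbT.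
exists r => //; exists (c / (2 * N1) / D ^+ 2) => [|w wU wr TVw].
  by rewrite divr_gt0// exprn_gt0.
have Lw : inL1 T w by have [[]] := wU.
have wr0 := wr; rewrite (normL1_u0 n_gt0 t0 tn t_lt uU u_step Lw) in wr0.
pose th : J -> R -> R := profile a t w r.
have wE := profile_comb T_gt0 n_gt0 t0 tn t_lt aV a_neq d_gt0 t_gap p_ge1 wU r0 rd wr0
  gam_gap (ltW gam_gt0) TVw N_strict.
have thS := profile_sign T_gt0 n_gt0 t0 tn t_lt aV a_neq d_gt0 t_gap p_ge1 wU r0 rd wr0
  gam_gap (ltW gam_gt0) TVw N_strict.
have thJ := profile_step T_gt0 n_gt0 t0 tn t_lt aV a_neq d_gt0 t_gap p_ge1 wU r0 rd wr0
  gam_gap (ltW gam_gt0) TVw N_strict.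
have Ith : forall j, intg T (th j).
  by move=> j; exact: (intg_profile a t r wU j).
have wN := perturbed_norm n_gt0 t0 tn t_lt uU u_step Lw Ith wE.
have wF := perturbed_F F_eqL1 n_gt0 t0 tn t_lt uU u_step Lw Ith wE.
have th0 j s : d < `|s - tt j| -> th j s = 0.
  by move=> h; apply: profile_eq0; apply: (le_trans rd); exact: ltW.
have th1 j s : r1 < `|s - tt j| -> th j s = 0.
  move=> h; apply: profile_eq0; apply: le_trans (ltW h); apply: le_trans rr1.
  by rewrite ler_peMl ?(ltW r0)// lerDr.
pose K j := Int T (fun s => `|th j s|).
pose m j := Int T (th j).
pose Q j := Int T (fun s => th j s * (s - tt j)).
have Kr j : K j <= r.
  apply: le_trans (ltW wr); rewrite wN.
  exact: (normL1_comb_ge n_gt0 t_lt aV a_neq d_gt0 t_gap j Ith th0).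
have K0 j : 0 <= K j by apply: Int_ge0.
have mK j : `|m j| <= K j by exact: le_norm_Int.
have QE j : Q j = Int T (fun s => `|th j s| * `|s - tt j|) by exact: sign_moment.
have mQ j : (m j ^+ 2 + K j ^+ 2) / 4 <= Q j.
  have [tr _ rt] := near_T j.
  rewrite QE; apply: bathtub => //.
    by apply: (le_trans (Kr j)); rewrite -subr_ge0.
  by apply: le_trans rt; rewrite lerD2l; exact: Kr.
have Qm (j : J) : ~ inJ (R := R) V n a j.+1 -> Q j = m j ^+ 2 / 2.
  move=> nJ; have [y /andP[y1 y2] yE] := thJ j nJ; have [tr tT rt] := near_T j.
  have yT : 0 <= y <= T by rewrite (le_trans tr y1) (le_trans y2 rt).
  exact: (step_moment T_gt0 (Ith j) yT tT yE).
have h1 := Hc m K Q mK mQ Qm.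
have mK2 : mass T th ^+ 2 <= N1 * \sum_j K j ^+ 2.
  apply: (le_trans (sqr_sum_le _)); rewrite ler_wpM2r ?lerDl//.
  by apply: sumr_ge0 => j _; exact: sqr_ge0.
have massr : mass T th <= r1.
  apply: le_trans rr1; apply: (@le_trans _ _ (\sum_(j < n.-1) r)).
    by apply: ler_sum => j _; exact: Kr.
  by rewrite sumr_const card_ord -[leLHS]mulr_natl ler_wpM2r ?(ltW r0)// lerDl.
have := Hexp th Ith th1 massr; rewrite ler_norml => /andP[h2 _].
have E1 : \sum_j (gslope j * Int T (th j) + gcurv j * Int T (fun s => th j s * (s - tt j))) =
    \sum_j gcurv j * Q j by apply: eq_bigr => j _; rewrite slope0 mul0r add0r.
have E2 : moment T t th = \sum_j Q j by apply: eq_bigr => j _; rewrite QE.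
rewrite E1 E2 -wF in h2.
have Q0 : 0 <= \sum_j Q j.
  by apply: sumr_ge0 => j _; rewrite QE; apply: Int_ge0 => s _; rewrite mulr_ge0.
have h3 : c / (2 * N1) * (mass T th ^+ 2 + \sum_j Q j) <=
    c / 2 * \sum_j (K j ^+ 2 + Q j).
  rewrite big_split/= (_ : c / 2 * _ = c / (2 * N1) * (N1 * \sum_j K j ^+ 2 + N1 * \sum_j Q j)).
    rewrite ler_wpM2l ?(ltW e0)// lerD// -[leLHS]mul1r ler_wpM2r// lerDr//.
  by field; rewrite gt_eqF.
have h4 : c / (2 * N1) / D ^+ 2 * normL1 T (w - u) ^+ 2 <= c / (2 * N1) * mass T th ^+ 2.
  rewrite -mulrA ler_wpM2l ?(ltW e0)// ler_pdivrMl ?exprn_gt0// -exprMn.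
  rewrite lerXn2r ?nnegrE ?normL1_ge0 ?mulr_ge0 ?mass_ge0 ?(ltW D0)// wN; exact: HD.
have h5 : c / (2 * N1) * mass T th ^+ 2 <= c / 2 * \sum_j K j ^+ 2.
  rewrite (_ : c / 2 * _ = c / (2 * N1) * (N1 * \sum_j K j ^+ 2)).
    by rewrite ler_wpM2l ?(ltW e0).
  by field; rewrite gt_eqF.
have h6 : c / 2 * \sum_j K j ^+ 2 <= c / 2 * \sum_j (K j ^+ 2 + Q j).
  rewrite ler_wpM2l ?divr_ge0 ?(ltW c0)// big_split/= lerDl//.
rewrite /m /K in h1 h2.
lra.
Qed.

Lemma objective_growth : exists e eta : R, [/\ 0 < e, 0 < eta &
  forall w, Uad T V w -> normL1 T (w - u) <= e ->
    (objective T F beta p u + (eta / 2 * normL1 T (w - u) ^+ 2)%:E <= objective T F beta p w)%E].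
Proof.
have d0 := d_gt0.
have [r r0 [c c0 Hr]] := F_growth.
have bg : 0 < beta * gam by rewrite mulr_gt0.
have bg2 : 0 < beta * gam / 2 by rewrite divr_gt0.
have [r2 r20 Hl] := F_lsc (inL1_u uU) bg2.
pose e := Num.min (Num.min (r / 2) (r2 / 2)) (Num.min (d / 2) 1).
have e0 : 0 < e by rewrite !lt_min !divr_gt0/=.
(* [2 * c] serves an excess of variation up to [gam]. A larger excess gains [beta * gam]: lower
   semicontinuity of [F] takes at most half of it, and the other half dominates the growth term
   because the distance is at most 1. *)
exists e; exists (Num.min (2 * c) (beta * gam)); split=> //.
  by rewrite lt_min bg mulr_gt0.
move=> w wU; rewrite !le_min => /andP[/andP[wr wr2] /andP[wd w1]].
have Lw : inL1 T w by have [[]] := wU.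
have wN0 : 0 <= normL1 T (w - u) by apply: normL1_ge0; exact: inL1B (inL1_u uU).
have wd' : normL1 T (w - u) < d by lra.
rewrite (normL1_u0 n_gt0 t0 tn t_lt uU u_step Lw) in wd'.
have TVw := TV_ge_stair T_gt0 n_gt0 t0 tn t_lt aV d_gt0 t_gap p_ge1 wU d_gt0 (lexx d) wd'.
rewrite /objective (TV_u T_gt0 n_gt0 t0 tn t_lt aV uU u_step d_gt0 t_gap p_ge1).
set x := normL1 T (w - u) in wr wr2 wd w1 wN0 *.
have x1 : x ^+ 2 <= 1 by rewrite expr_le1.
have := sqr_ge0 x => x0.
have m1 : Num.min (2 * c) (beta * gam) / 2 * x ^+ 2 <= c * x ^+ 2.
  rewrite ler_wpM2r// ler_pdivrMr// [c * _]mulrC ge_min lexx//.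
have m2 : Num.min (2 * c) (beta * gam) / 2 * x ^+ 2 <= beta * gam / 2.
  apply: (@le_trans _ _ (beta * gam / 2 * x ^+ 2)).
    by rewrite ler_wpM2r// ler_wpM2r// ge_min lexx orbT.
  by rewrite ler_piMr// ltW.
case E : (TV T p w) TVw => [y| |]//; last first.
  by move=> _; rewrite (gt0_muley (beta_gt0 : (0 < beta%:E)%E)) addey// leey.
rewrite lee_fin => Sy; rewrite -!EFinM -!EFinD lee_fin -/N.
set S := \sum_j _ in Sy *.
have bSy : beta * S <= beta * y by rewrite ler_pM2l.
have [yg|yg] := leP y (S + gam).
  have TVw : (TV T p w <= (S + gam)%:E)%E by rewrite E lee_fin.
  have xr : x < r by lra.
  by have := Hr w wU xr TVw; rewrite -/x; lra.
have xr2 : x < r2 by lra.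
have := Hl w Lw xr2.
have : beta * (S + gam) <= beta * y by rewrite ler_pM2l// ltW.
by lra.
Qed.

End Sufficiency.

(** * The optimality conditions *)

Theorem theorem4p6 (R : realType) (T : R) (M : nat) (beta : R)
    (V : {fset 'cV[int]_M}) (F : (R -> 'cV[R]_M) -> R)
    (F' : (R -> 'cV[R]_M) -> (R -> 'cV[R]_M) -> R)
    (F'' : (R -> 'cV[R]_M) -> (R -> 'cV[R]_M) -> (R -> 'cV[R]_M) -> R)
    (u : R -> 'cV[R]_M) (n : nat) (a : nat -> 'cV[int]_M) (t : nat -> R)
    (g : R -> 'cV[R]_M) (H : R -> R -> 'M[R]_M)
    (T_gt0 : 0 < T) (beta_gt0 : 0 < beta) (card_V : (2 <= #|` V|)%N)
    (F_eqL1 : forall v w, inL1 T v -> inL1 T w -> eqL1 T v w -> F v = F w)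
    (F_bounded_below : bounded_below T F) (F_lsc : lsc T F)
    (u_feasible : Uad T V u)
    (u_repr : minimal_representation T V u n a t)
    (F_twice : twice_frechet T F F' F'')
    (g_gradient : is_gradient T (F' u) g) (g_C1 : C1 T g)
    (H_hessian : is_hessian T (F'' u) H)
    (H_continuous :
      {within `[0, T] `*` `[0, T], continuous (fun x : R * R => H x.1 x.2)}) :
  (forall p : \bar R, (1 <= p)%E ->
    local_minimizer T V F beta p u ->
    [/\ forall j, (1 <= j < n)%N -> dotp (jump a j) (g (t j)) = 0,
        forall j, inJ (R := R) V n a j ->
          0 <= dotp (jump a j) (derive1 g (t j)) &
        forall tau : 'rV[R]_n.-1, 0 <= quad_form a t g H tau])
  /\
  (forall p : \bar R, (1 < p)%E -> (p < +oo)%E ->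
    (local_minimizer T V F beta p u /\ quadratic_growth T V F beta p u) <->
    [/\ forall j, (1 <= j < n)%N -> dotp (jump a j) (g (t j)) = 0,
        forall j, inJ (R := R) V n a j ->
          0 < dotp (jump a j) (derive1 g (t j)) &
        forall tau : 'rV[R]_n.-1, tau != 0 -> 0 < quad_form a t g H tau]).
Proof.
have [n_gt0 [t0 tn t_lt] aV a_neq u_step] := u_repr.
have [d d_gt0 t_gap] := gap_exists t_lt.
have slope p eta := @slope_eq0 R M T V F F' F'' u n a t g H T_gt0 F_eqL1 n_gt0 t0 tn t_lt
  aV a_neq u_feasible u_step F_twice g_gradient g_C1 H_hessian H_continuous d d_gt0 t_gap
  beta eta p beta_gt0.
have quad p eta := @quad_growth R M T V F F' F'' u n a t g H T_gt0 F_eqL1 n_gt0 t0 tn t_lt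
  aV a_neq u_feasible u_step F_twice g_gradient g_C1 H_hessian H_continuous d d_gt0 t_gap
  beta eta p beta_gt0.
have split p eta := @split_growth R M T V F F' F'' u n a t g H T_gt0 F_eqL1 n_gt0 t0 tn t_lt
  aV a_neq u_feasible u_step F_twice g_gradient g_C1 H_hessian H_continuous d d_gt0 t_gap
  beta eta p beta_gt0.
have quadE tau : quad_form a t g H tau = \sum_k gcurv a t g k * tau 0 k ^+ 2 +
  \sum_i \sum_k hcoef a t H i k * tau 0 i * tau 0 k by [].
have jumpE (P : nat -> Prop) : (forall j : 'I_n.-1, P j.+1) -> forall j, (1 <= j < n)%N -> P j.
  move=> HP [|j] //= jn; have jn' : (j < n.-1)%N by rewrite -ltnS prednK.
  exact: HP (Ordinal jn').
split=> [p p1 [e e0 He]|p p1 poo].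
  have growth : exists2 e, 0 < e & forall w, Uad T V w -> normL1 T (w - u) <= e ->
      (objective T F beta p u + (0 / 2 * normL1 T (w - u) ^+ 2)%:E <= objective T F beta p w)%E.
    by exists e => // w wU we; rewrite !mul0r adde0; exact: He.
  split.
  - exact: jumpE (slope p 0 (lexx _) p1 growth).
  - move=> j [jn [l [l01 lV]]]; move: j jn lV; apply: jumpE => j lV.
    have := split p 0 (lexx _) p1 growth j l l01 lV; rewrite mul0r pmulr_lge0//.
    by case/andP: l01 => l0 l1; rewrite mulr_gt0// subr_gt0.
  (* [quad_growth] is stated at a jump; without jumps the quadratic form is an empty sum. *)
  - move=> tau; have [[j _]|none] := pselect (exists j : 'I_n.-1, True); last first.
      by rewrite /quad_form !big1// => j _; case: none; exists j.
    by rewrite quadE; have := quad p 0 (lexx _) p1 growth (tau 0) j; rewrite mul0r.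
have p1' := ltW p1; split=> [[_ [e [eta [e0 eta0 He]]]]|[G C Q]].
  have growth : exists2 e, 0 < e & forall w, Uad T V w -> normL1 T (w - u) <= e ->
      (objective T F beta p u + (eta / 2 * normL1 T (w - u) ^+ 2)%:E <= objective T F beta p w)%E.
    by exists e.
  split.
  - exact: jumpE (slope p eta (ltW eta0) p1' growth).
  - move=> j [jn [l [l01 lV]]]; move: j jn lV; apply: jumpE => j lV.
    have := split p eta (ltW eta0) p1' growth j l l01 lV.
    have ll : 0 < l * (1 - l) by case/andP: l01 => l0 l1; rewrite mulr_gt0// subr_gt0.
    move=> /(lt_le_trans _) h; rewrite -(pmulr_lgt0 _ ll); apply: h.
    by rewrite mulr_gt0// exprn_gt0// divr_gt0.
  - move=> tau tau0; have [j tauj] : exists j, tau 0 j != 0.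
      apply: contrapT => h; move/eqP: tau0; apply; apply/rowP => j; rewrite mxE.
      by apply/eqP/negPn/negP => tj; apply: h; exists j.
    rewrite quadE; apply: lt_le_trans (quad p eta (ltW eta0) p1' growth (tau 0) j).
    by rewrite mulr_gt0// lt_neqAle sqr_ge0 eq_sym sqrf_eq0 tauj.
case: p p1 poo p1' => [p| |]// p1 _ p1'.
have strict (x y : 'cV[R]_M) : suppf (@dual_ball R M p%:E) x + suppf (@dual_ball R M p%:E) y <=
    suppf (@dual_ball R M p%:E) (x + y) -> exists2 l, 0 <= l <= 1 & y = l *: (x + y).
  rewrite /dual_ball (hoelder_conjugate_fin p1); exact: suppf_strict.
have [gam gam0 gap] := suppf_gap V (@dual_ball R M p%:E).
have slope0 (j : 'I_n.-1) : gslope a t g j = 0.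
  by apply: G; rewrite /= -ltn_predRL ltn_ord.
have curv0 (j : 'I_n.-1) : inJ (R := R) V n a j.+1 -> 0 < gcurv a t g j by exact: C.
have [e [eta [e0 eta0 He]]] := objective_growth T_gt0 F_eqL1 n_gt0 t0 tn t_lt aV a_neq
  u_feasible u_step F_twice g_gradient g_C1 H_hessian H_continuous d_gt0 t_gap
  F_lsc beta_gt0 p1' strict gam0 gap slope0 curv0 Q.
split; last by exists e, eta.
exists e; first exact: e0.
move=> w wU we; apply: le_trans (He w wU we).
by rewrite leeDl// lee_fin mulr_ge0 ?sqr_ge0// divr_ge0// ltW.
Qed.
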